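(* Let $d=2$ and assume (A0)-(A4) of the context hold. Suppose moreover that the minimum over $\mathbb{R}^2$ of the function $\max\{\varphi,\varphi_0\}$ is attained at a unique point $a^*=(\alpha^*,\beta^* )$, and that $$\inf_{a\in\mathbb{R}^2}\max\{\varphi(a),\varphi_0(a)\}>\inf_{a\in\mathbb{R}^2}\varphi(a)\qquad\text{and}\qquad \frac{\partial}{\partial\beta}\varphi(\alpha,\beta)\Big|_{(\alpha,\beta)=a^*}<0 .$$ Then the $t$-Martin compactification of the transition kernel $P$ is unstable (i.e. not stable).
   Context: Setting ($d=2$). $\mathbb{N}=\{0,1,2,\ldots\}$. Let $\mu,\mu_0$ be two different positive measures on $\mathbb{Z}^2$ with $0<\mu(\mathbb{Z}^2)\le1$ and $0<\mu_0(\mathbb{Z}^2)\le1$. $Z(n)=(X(n),Y(n))$ is the (possibly substochastic) random walk on $E=\mathbb{Z}\times\mathbb{N}$ with transition kernel $P=(p(z,z'))$, where, for $z=(x,y)$ and $z'$ in $\mathbb{Z}\times\mathbb{N}$, $p(z,z')=\mu(z'-z)$ if $y>0$ and $p(z,z')=\mu_0(z'-z)$ if $y=0$. $\mathbb{P}_z(Z(n)=z')$ denotes the $n$-step transition weight from $z$ to $z'$. Assumptions. (A0) $\mu(z)=0$ for $z=(x,y)\in\mathbb{Z}\times\mathbb{Z}$ with $y<-1$, and $\mu_0(z)=0$ for $z=(x,y)$ with $y<0$. (A1) $(Z(n))$ is irreducible on $\mathbb{Z}\times\mathbb{N}$. (A2) The homogeneous random walk $S$ on $\mathbb{Z}^2$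 with transition probabilities $p_S(z,z')=\mu(z'-z)$ is irreducible on $\mathbb{Z}^2$. (A3) The functions $\varphi(a)=\sum_{z\in\mathbb{Z}^2}\mu(z)e^{a\cdot z}$ and $\varphi_0(a)=\sum_{z\in\mathbb{Z}^2}\mu_0(z)e^{a\cdot z}$ are finite everywhere on $\mathbb{R}^2$; points of $\mathbb{R}^2$ are written $a=(\alpha,\beta)$. (A4) The last coordinate of $S$ is an aperiodic random walk on $\mathbb{Z}$. $t$-Martin boundary and stability. For $t>0$, $G_t(z,z')=\sum_{n=0}^\infty t^{-n}\mathbb{P}_z(Z(n)=z')$; by irreducibility these series converge or diverge simultaneously for all $z,z'$. The convergence norm is $\rho(P)=\inf\{t>0: G_t(z,z')<\infty\}=\limsup_{n\to\infty}\mathbb{P}_z(Z(n)=z')^{1/n}$. The $t$-Martin kernel with a fixed reference point $z_0\in E$ is $K_t(z,z')=G_t(z,z')/G_t(z_0,z')$. A sequence of points $z_n\in E$ is said to converge to a point of the $t$-Martin boundary if it leaves every finite subset of $E$ (for each finite $V\subset E$ there is $n_V$ with $z_n\notin V$ for all $n>n_V$) and the functions $K_t(\cdot,z_n)$ converge pointwise on $E$. The $t$-Martin compactification is the unique smallest compactification of $E$ to which the kernels $K_t(z,\cdot)$ extend continuously. It is called stable if for any sequence $z_n\in E$ leaving the finite subsets of $E$, convergence to a point of the $t$-Martin boundary for some $t>\rho(P)$ implies convergence to a point of the $t$-Martin boundary for all $t>\rho(P)$; otherwise it is unstable. *)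

(* Defs.v *)
From HB Require Import structures.
From mathcomp Require Import all_boot all_order all_algebra.
From mathcomp Require Import all_classical all_reals all_analysis.
Import Order.TTheory GRing.Theory Num.Theory.
Import numFieldNormedType.Exports.

Set Implicit Arguments.
Unset Strict Implicit.
Unset Printing Implicit Defensive.

Local Open Scope classical_set_scope.
Local Open Scope ring_scope.
Local Open Scope ereal_scope.

(* Measures on Z^2 are given by their mass functions [int * int -> R]; a
   transition kernel on a discrete state space is a matrix with entries in
   [\bar R], not required to be stochastic. *)

Section Kernels.
Variables (R : realType) (T : choiceType).
Implicit Types (P : T -> T -> \bar R) (t : R) (z w : T) (u : nat -> T).

Fixpoint nstep P (n : nat) z z' : \bar R :=
  if n is n'.+1 then \esum_(w in [set: T]) (P z w * nstep P n' w z')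
  else ((z == z')%:R)%:E.

Definition irreducible_kernel P : Prop :=
  forall z z', exists n, 0 < nstep P n z z'.

(* The gcd of the possible return times is 1. When no return is possible every
   [d] qualifies, so that such a kernel is not aperiodic. *)
Definition aperiodic_kernel P : Prop :=
  forall z (d : nat),
    (forall n, (0 < n)%N -> 0 < nstep P n z z -> (d %| n)%N) -> d = 1%N.

Definition green P t z z' : \bar R :=
  \sum_(0 <= n <oo) ((t ^- n)%:E * nstep P n z z').

(* For irreducible [P] the value does not depend on [z] and [z']. *)
Definition convergence_norm P z z' : R :=
  inf [set t : R | (0 < t)%R /\ green P t z z' < +oo].

(* Only meaningful when the two Green functions are finite and the denominator
   is nonzero, as is the case for [P] irreducible and [t] greater than the
   convergence norm. *)
Definition martin_kernel P z0 t z z' : R :=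
  (fine (green P t z z') / fine (green P t z0 z'))%R.

Definition leaves_finite_sets u : Prop :=
  forall V : set T, finite_set V ->
    exists nV : nat, forall n, (nV < n)%N -> ~ V (u n).

Definition cvg_to_martin_boundary P z0 t u : Prop :=
  leaves_finite_sets u /\
  forall z, cvgn (fun n => martin_kernel P z0 t z (u n)).

Definition martin_stable P z0 : Prop :=
  forall u, leaves_finite_sets u ->
    (exists t, (convergence_norm P z0 z0 < t)%R /\
               cvg_to_martin_boundary P z0 t u) ->
    forall t, (convergence_norm P z0 z0 < t)%R ->
      cvg_to_martin_boundary P z0 t u.

End Kernels.

Section RandomWalks.
Variable R : realType.
Implicit Types (mu : int * int -> R) (a : R * R).

Definition total_mass mu : \bar R := \esum_(z in [set: int * int]) (mu z)%:E.

Definition reflected_kernel mu mu0 (z z' : int * nat) : \bar R :=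
  let step : int * int := (z'.1 - z.1, z'.2%:Z - z.2%:Z)%R in
  (if z.2 == 0%N then mu0 step else mu step)%:E.

Definition walk_kernel mu (z z' : int * int) : \bar R :=
  (mu (z'.1 - z.1, z'.2 - z.2)%R)%:E.

Definition last_coordinate_kernel mu (y y' : int) : \bar R :=
  \esum_(x in [set: int]) (mu (x, (y' - y)%R))%:E.

Definition emgf mu a : \bar R :=
  \esum_(z in [set: int * int])
    (mu z * expR (a.1 * z.1%:~R + a.2 * z.2%:~R))%:E.

Definition mgf mu a : R := fine (emgf mu a).

End RandomWalks.

(* Main.v *)
Require Import Defs.
From HB Require Import structures.
From mathcomp Require Import all_boot all_order all_algebra.
From mathcomp Require Import all_classical all_reals all_analysis.
From mathcomp Require Import ring lra zify.
Import Order.TTheory GRing.Theory Num.Theory.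
Import numFieldNormedType.Exports.

Set Implicit Arguments.
Unset Strict Implicit.
Unset Printing Implicit Defensive.

Local Open Scope classical_set_scope.
Local Open Scope ring_scope.

(** Why the compactification is unstable.

Write [phi] and [phi0] for the moment generating functions of the two jump
laws and [pexp a] for the exponential function [z |-> exp (a . z)].  Under the
kernel, [pexp a] is multiplied by [phi a] off the axis and by [phi0 a] on the
axis, so [pexp a] is t-superharmonic exactly when [a] lies in the lens
[phi <= t, phi0 <= t].  Just above the minimal level [rho] of
[max (phi, phi0)] the lens is a small neighbourhood of the minimizer, located
on the lower part of the level curve of [phi] because the derivative of [phi]
in the second variable is negative there.  Its right end is a corner
[a = (al, b)] where [phi = phi0 = t], and [pexp a] is then a t-harmonic
function.  The instability comes from the following two facts.

- At a level [t1] close to [rho], the whole cone of directions lying to the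
  right of the normal to the curve [phi = t1] at the upper point above the
  corner is sent, together with the direction of the axis, to the single
  boundary point given by [pexp a] (lemmas [renewal] and [cone_limit]).  Going
  to such a far point, the walk saves weight by travelling along the axis
  first, and it is only through these far points of the axis that the starting
  point matters.
- At a fixed higher level [t2] the upper boundary of the level set carries
  normals to the right of the limiting direction as [t1] decreases to [rho]:
  two points of it have distinct slopes, so one of them differs from the
  limiting slope, and after a reflection of the first coordinate it may be
  taken larger.  In that direction the Green function decays, in the first
  coordinate, at a rate [al0] strictly smaller than along the axis
  ([cone_ratio_le] and [axis_ratio_ge]).

Interleaving a sequence on the axis with one in the cone therefore gives a
sequence whose t1-Martin kernels converge and whose t2-Martin kernels do not
([unstable_right]).

No asymptotic expansion of the Green function is used.  Everything rests on
one comparison principle for nonnegative kernels ([comparison]), applied to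
the kernel, to its transpose, and to their restrictions off the axis.  The
sharp statement is the ratio limit on the axis.  Its upper bound is
domination by [pexp a]; its lower bound [axis_green_lower] is a flux argument,
the potential of [min (pexp a, c * pexp astar)] being carried by a narrow
vertical window; and a Choquet-Deny argument ([cluster_rigid]) identifies the
limit.  Lower bounds in the cone come from the walk killed on the axis:
[pexp (al, b1) - pexp (al, b)] vanishes on the axis, which makes a sum
diverge ([killed_sum_diverges]), so that somewhere in the cone the killed
Green function is not exponentially small ([killed_localization]); the
multiplicativity [gr_mul] spreads this one good point along the cone
([cone_lower]). *)

Local Open Scope ereal_scope.

(** * Sums of nonnegative extended reals *)

Notation "\S_ i F" := (\esum_(i in setT) F)
  (at level 41, F at level 41, i name, format "\S_ i  F").

Section Esum.
Variable R : realType.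

Lemma esum_ge_term (T : choiceType) (f : T -> \bar R) i :
  (forall i, 0 <= f i) -> f i <= \S_ i f i.
Proof.
move=> f0; apply: esum_ge; exists [set i]; last by rewrite fsbig_set1.
by split; [exact: finite_set1|].
Qed.

Lemma esum_scale (T : choiceType) (c : \bar R) (f : T -> \bar R) :
  0 <= c -> (forall i, 0 <= f i) -> \S_ i (c * f i) = c * \S_ i f i.
Proof.
have le (d : \bar R) (g : T -> \bar R) : 0 <= d -> (forall i, 0 <= g i) ->
    \S_ i (d * g i) <= d * \S_ i g i.
  move=> d0 g0; apply: ge_ereal_sup => _ [X [finX XI] <-].
  rewrite -ge0_mule_fsumr//; apply: lee_wpmul2l => //.
  by apply: ereal_sup_ubound; exists X.
move=> c0 f0; apply/eqP; rewrite eq_le le//=.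
case: c c0 => [r|_|//].
- rewrite lee_fin => r0; have [<-|/eqP r0'] := eqVneq 0%R r.
    by rewrite mul0e; apply: esum_ge0 => i _; rewrite mul0e.
  have {}r0 : (0 < r)%R by rewrite lt_neqAle r0 andbT; apply/eqP.
  have rf0 i : 0 <= r%:E * f i by rewrite mule_ge0// lee_fin ltW.
  have ri0 : 0 <= (r^-1)%:E by rewrite lee_fin invr_ge0 ltW.
  have := le _ _ ri0 rf0.
  rewrite -(@lee_pmul2l _ r%:E)//.
  rewrite muleA -EFinM mulfV ?gt_eqF// mul1e; apply: le_trans.
  rewrite le_eqVlt; apply/orP; left; apply/eqP; congr (_ * _).
  by apply: eq_esum => i _; rewrite muleA -EFinM mulVf ?gt_eqF// mul1e.
- have [z|] := eqVneq (\S_ i f i) 0.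
    by rewrite z mule0; apply: esum_ge0 => i _; rewrite mule_ge0.
  move=> nz; have [i fi] : exists i, f i != 0.
    apply: contrapT => /forallNP h; move/negP: nz; apply; apply/eqP.
    by apply: esum1 => i _; apply/eqP; have /negP := h i; rewrite negbK.
  have fi0 : 0 < f i by rewrite lt_neqAle eq_sym fi f0.
  apply: (@le_trans _ _ +oo); first by rewrite leey.
  rewrite -[leLHS](gt0_mulye fi0); apply: (@esum_ge_term _ (fun i => +oo * f i) i) => j.
  by rewrite mule_ge0.
Qed.

Lemma esum_exchange (T T' : choiceType) (a : T -> T' -> \bar R) :
  (forall i j, 0 <= a i j) -> \S_ i \S_ j a i j = \S_ j \S_ i a i j.
Proof.
move=> a0; rewrite !esum_esum//.
have -> : [set: T'] `*`` (fun=> [set: T]) = setT by apply/seteqP; split.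
have -> : [set: T] `*`` (fun=> [set: T']) = setT by apply/seteqP; split.
rewrite (@reindex_esum _ _ _ setT setT (fun p : T * T' => (p.2, p.1)))//.
split=> //; first by move=> [x y] [u v] _ _ [-> ->].
by move=> [x y] _; exists (y, x).
Qed.

Lemma esum_inj_le (T T' : choiceType) (e : T -> T') (f : T' -> \bar R) :
  injective e -> (forall i, 0 <= f i) -> \S_ i f (e i) <= \S_ j f j.
Proof.
move=> ei f0; rewrite -(@esum_image _ _ _ setT e f); last first.
  by move=> x y _ _; apply: ei.
by rewrite esum_mkcond; apply: le_esum => i _; case: ifP.
Qed.

Lemma esum_inj_eq (T T' : choiceType) (e : T -> T') (f : T' -> \bar R) :
  injective e -> (forall j, f j != 0 -> exists i, e i = j) ->
  \S_ i f (e i) = \S_ j f j.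
Proof.
move=> ei f0; rewrite -(@esum_image _ _ _ setT e f); last first.
  by move=> x y _ _; apply: ei.
rewrite esum_mkcond; apply: eq_esum => j _; case: ifPn => // /negP h.
apply/esym/eqP; apply: contrapT => /negP/f0[i ij]; apply: h.
by rewrite inE; exists i.
Qed.

Lemma esum_single (T : choiceType) (f : T -> \bar R) i :
  (forall j, j != i -> f j = 0) -> 0 <= f i -> \S_ j f j = f i.
Proof.
move=> f0 fi; rewrite -(@esum_set1 _ _ i f)// [RHS]esum_mkcond.
apply: eq_esum => j _; case: ifPn => //; rewrite notin_setE => /= /eqP/f0 //.
Qed.

Lemma esum_natS (f : nat -> \bar R) : (forall n, 0 <= f n) ->
  \S_ n f n = f 0%N + \S_ n f n.+1.
Proof.
move=> f0; rewrite (esumID [set 0%N])// setTI esum_set1// setTI; congr (_ + _).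
apply: reindex_esum; split => //.
  by move=> x y _ _ [].
by move=> [|n] //= _; exists n.
Qed.

(** The only form of tail control used for these sums. *)
Lemma esum_finite_approx (T : choiceType) (f : T -> \bar R) (e : R) :
  (forall i, 0 <= f i) -> \S_ i f i < +oo -> (0 < e)%R ->
  exists2 F : set T, finite_set F & \esum_(i in ~` F) f i <= e%:E.
Proof.
move=> f0 foo e0.
have fin : \S_ i f i \is a fin_num by rewrite ge0_fin_numE// esum_ge0.
have [_ [F [finF _] <-] lt] := ub_ereal_sup_adherent e0 fin.
exists F => //; move: lt fin; rewrite -/(esum setT f).
rewrite -esum_fset// (esumID F) // !setTI fin_numD => + /andP[fa fb].
by rewrite -(fineK fa) -(fineK fb) -EFinD lte_fin lee_fin; lra.
Qed.

Lemma eq_esumT (T : choiceType) (f g : T -> \bar R) :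
  f =1 g -> \S_ i f i = \S_ i g i.
Proof. by move=> fg; apply: eq_esum. Qed.

End Esum.

(** * Green functions of nonnegative kernels *)

Section KernelCalculus.
Variables (R : realType) (T : choiceType).
Implicit Types (K : T -> T -> \bar R) (f g u : T -> \bar R).

Definition app K f z := \S_ w (K z w * f w).
Definition gr K z z' := \S_ n (nstep K n z z').
Definition dirac_fun z' : T -> \bar R := fun z => ((z == z')%:R)%:E.
(** The Green function as a function of its target is that of the transposed
kernel as a function of its source, so every statement about the first
variable has a dual. *)
Definition transp K : T -> T -> \bar R := fun z w => K w z.

Lemma dirac_fun_ge0 z' z : 0 <= dirac_fun z' z.
Proof. by rewrite lee_fin. Qed.

Lemma nstepE K n z z' : nstep K n z z' = iter n (app K) (dirac_fun z') z.
Proof.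
elim: n z => [//|n IH] z /=.
by apply: eq_esum => w _; rewrite IH.
Qed.

Section nonneg.
Variable K : T -> T -> \bar R.
Hypothesis K0 : forall z w, 0 <= K z w.

Lemma app_ge0 f z : (forall w, 0 <= f w) -> 0 <= app K f z.
Proof. by move=> f0; apply: esum_ge0 => w _; rewrite mule_ge0. Qed.

Lemma iter_app_ge0 n f : (forall w, 0 <= f w) ->
  forall z, 0 <= iter n (app K) f z.
Proof. by move=> f0; elim: n => // n IH z; apply: app_ge0. Qed.

Lemma nstep_ge0 n z z' : 0 <= nstep K n z z'.
Proof. by rewrite nstepE iter_app_ge0// => w; exact: dirac_fun_ge0. Qed.

Lemma gr_ge0 z z' : 0 <= gr K z z'.
Proof. by apply: esum_ge0 => n _; exact: nstep_ge0. Qed.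

Lemma app_le f g : (forall w, f w <= g w) ->
  forall z, app K f z <= app K g z.
Proof. by move=> fg z; apply: le_esum => w _; rewrite lee_wpmul2l. Qed.

Lemma eq_app f g : f =1 g -> app K f =1 app K g.
Proof. by move=> fg z; apply: eq_esum => w _; rewrite fg. Qed.

Lemma iter_app_le n f g : (forall w, f w <= g w) ->
  forall z, iter n (app K) f z <= iter n (app K) g z.
Proof. by move=> fg; elim: n => // n IH z; apply: app_le. Qed.

Lemma appD f g z : (forall w, 0 <= f w) -> (forall w, 0 <= g w) ->
  app K (fun w => f w + g w) z = app K f z + app K g z.
Proof.
move=> f0 g0; rewrite /app -esumD//; last 2 first.
- by move=> w _; rewrite mule_ge0.
- by move=> w _; rewrite mule_ge0.
by apply: eq_esum => w _; rewrite ge0_muleDr.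
Qed.

Lemma appZ c f z : 0 <= c -> (forall w, 0 <= f w) ->
  app K (fun w => c * f w) z = c * app K f z.
Proof.
move=> c0 f0; rewrite /app -esum_scale//; last by move=> w; rewrite mule_ge0.
by apply: eq_esum => w _; rewrite muleCA.
Qed.

Lemma iter_appZ n c f z : 0 <= c -> (forall w, 0 <= f w) ->
  iter n (app K) (fun w => c * f w) z = c * iter n (app K) f z.
Proof.
move=> c0 f0; elim: n z => // n IH z /=; rewrite (eq_app IH) appZ//.
exact: iter_app_ge0.
Qed.

Lemma app_esum (I : choiceType) (F : I -> T -> \bar R) z :
  (forall i w, 0 <= F i w) ->
  app K (fun w => \S_ i F i w) z = \S_ i app K (F i) z.
Proof.
move=> F0; rewrite /app esum_exchange//; last by move=> i j; rewrite mule_ge0.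
by apply: eq_esum => w _; rewrite esum_scale.
Qed.

Lemma app_dirac z z' : app K (dirac_fun z') z = K z z'.
Proof.
rewrite /app (@esum_single _ _ _ z').
- by rewrite /dirac_fun eqxx mule1.
- by move=> j /negbTE jz; rewrite /dirac_fun jz mule0.
- by rewrite /dirac_fun eqxx mule1.
Qed.

Lemma esum_dirac f z : (forall w, 0 <= f w) ->
  \S_ w (nstep K 0 z w * f w) = f z.
Proof.
move=> f0; rewrite (@esum_single _ _ _ z) /= ?eqxx ?mul1e// => j.
by rewrite eq_sym => /negbTE ->; rewrite mul0e.
Qed.

Lemma iter_app_nstep n f z : (forall w, 0 <= f w) ->
  iter n (app K) f z = \S_ w (nstep K n z w * f w).
Proof.
move=> f0; elim: n z => [|n IH] z; first by rewrite esum_dirac.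
rewrite /= (eq_app IH) app_esum; last by move=> i w; rewrite mule_ge0// nstep_ge0.
apply: eq_esum => w _ /=.
rewrite muleC -[X in _ * X]/(app K (fun v => nstep K n v w) z) -appZ//; last first.
  by move=> v; exact: nstep_ge0.
by apply: eq_app => v; rewrite muleC.
Qed.

(** [nstep] unfolds at the first jump; this is the expansion at the last one. *)
Lemma nstepSr n z z' : nstep K n.+1 z z' = \S_ w (nstep K n z w * K w z').
Proof.
rewrite nstepE iterSr -iter_app_nstep//.
by congr (iter _ _ _ _); apply/funext => w; rewrite app_dirac.
Qed.

Lemma gr_first z z' :
  gr K z z' = dirac_fun z' z + app K (fun w => gr K w z') z.
Proof.
rewrite /gr esum_natS; last by move=> n; exact: nstep_ge0.
by congr (_ + _); rewrite app_esum // => *; exact: nstep_ge0.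
Qed.

Lemma gr_last z z' :
  gr K z z' = dirac_fun z z' + app (transp K) (fun w => gr K z w) z'.
Proof.
rewrite /gr esum_natS; last by move=> n; exact: nstep_ge0.
congr (_ + _); first by rewrite /= /dirac_fun eq_sym.
under eq_esumT do rewrite nstepSr.
rewrite esum_exchange; last by move=> n w; rewrite mule_ge0// nstep_ge0.
apply: eq_esumT => w; rewrite /transp -esum_scale//; last first.
  by move=> n; exact: nstep_ge0.
by apply: eq_esumT => n; rewrite muleC.
Qed.

Lemma gr_app f z : (forall w, 0 <= f w) ->
  \S_ w (gr K z w * f w) = \S_ n iter n (app K) f z.
Proof.
move=> f0; under [RHS]eq_esumT do rewrite iter_app_nstep//.
rewrite [RHS]esum_exchange; last by move=> n w; rewrite mule_ge0// nstep_ge0.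
apply: eq_esumT => w; rewrite /gr muleC -esum_scale//; last first.
  by move=> n; exact: nstep_ge0.
by apply: eq_esumT => n; rewrite muleC.
Qed.

Lemma nstepD m n z z' :
  nstep K (m + n) z z' = \S_ w (nstep K m z w * nstep K n w z').
Proof.
rewrite nstepE iterD.
under eq_esumT do rewrite [X in _ * X]nstepE.
by rewrite -iter_app_nstep// => w; apply: iter_app_ge0 => ?; exact: dirac_fun_ge0.
Qed.

Lemma iter_app_gr n z z' :
  iter n (app K) (fun w => gr K w z') z = \S_ k nstep K (n + k) z z'.
Proof.
rewrite iter_app_nstep; last by move=> w; exact: gr_ge0.
under [RHS]eq_esumT do rewrite nstepD.
rewrite [RHS]esum_exchange; last first.
  by move=> i w; rewrite mule_ge0//; exact: nstep_ge0.
apply: eq_esumT => w; rewrite esum_scale//; first exact: nstep_ge0.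
by move=> k; exact: nstep_ge0.
Qed.

(** [K^n] applied to the Green function is the tail of the series defining it. *)
Lemma iter_app_gr_small z z' (e : R) : gr K z z' < +oo -> (0 < e)%R ->
  exists n, iter n (app K) (fun w => gr K w z') z <= e%:E.
Proof.
move=> goo e0.
have n0 n : 0 <= nstep K n z z' by exact: nstep_ge0.
have [F finF le] := esum_finite_approx n0 goo e0.
have [N FN] : exists N, forall k, F k -> (k < N)%N.
  have [X ->] := finite_fsetP.1 finF.
  exists (\max_(k <- finmap.enum_fset X) k.+1) => k /= kX.
  by apply: (@leq_bigmax_seq _ _ _ (fun k => k.+1)).
exists N; rewrite iter_app_gr; apply: le_trans le.
rewrite -(@esum_image _ _ _ setT (addn N) (fun k => nstep K k z z')); last first.
  by move=> x y _ _; exact: addnI.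
rewrite [leLHS]esum_mkcond [leRHS]esum_mkcond.
apply: le_esum => k _; case: ifPn => [|_]; last by case: ifP.
rewrite inE => -[j _ <-]; rewrite ifT// inE/= => /FN.
by rewrite ltnNge leq_addr.
Qed.

(** Feeding the bound back into itself gives [u <= f + K^n u] for all [n].
No subtraction of infinite quantities occurs.  Every maximum principle below
is an instance, for a suitable restriction of the walk or of its transpose. *)
Lemma comparison u f g z :
  (forall w, 0 <= u w) -> (forall w, 0 <= f w) -> (forall w, 0 <= g w) ->
  (forall w, u w <= g w + app K u w) ->
  (forall w, g w + app K f w <= f w) ->
  (forall e : R, (0 < e)%R -> exists n, iter n (app K) u z <= e%:E) ->
  u z <= f z.
Proof.
move=> u0 f0 g0 ule fge small.
have main n w : u w <= f w + iter n (app K) u w.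
  elim: n w => [|n IH] w; first by rewrite leeDr.
  apply: (le_trans (ule w)).
  have := app_le IH w; rewrite appD//; last exact: iter_app_ge0.
  move=> h; apply: (@le_trans _ _ (g w + (app K f w + app K (iter n (app K) u) w))).
    exact: leeD2l.
  by rewrite addeA leeD2r.
apply/lee_addgt0Pr => e /small[n ne].
by apply: le_trans (main n z) _; rewrite leeD2l.
Qed.

(** Strictly superharmonic functions decay geometrically under iteration. *)
Lemma iter_app_geo (r : R) f n z : (0 <= r)%R -> (forall w, 0 <= f w) ->
  (forall w, app K f w <= r%:E * f w) ->
  iter n (app K) f z <= (r ^+ n)%:E * f z.
Proof.
move=> r0 f0 fr; elim: n z => [|n IH] z; first by rewrite expr0 mul1e.
rewrite /=; apply: (le_trans (app_le IH z)).
rewrite appZ// ?lee_fin ?exprn_ge0//.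
rewrite exprSr EFinM -muleA; apply: lee_wpmul2l; last exact: fr.
by rewrite lee_fin exprn_ge0.
Qed.

Lemma geometric_esum (r : R) : (0 <= r < 1)%R ->
  \S_ n ((r ^+ n)%:E) = ((1 - r)^-1)%:E.
Proof.
move=> /andP[r0 r1]; rewrite -nneseries_esumT//; last first.
  by move=> n; rewrite lee_fin exprn_ge0.
apply/cvg_lim => //.
have := @cvg_geometric_series R 1 r; rewrite ger0_norm// div1r => /(_ r1) h.
rewrite (_ : (fun n => _) = EFin \o series (geometric 1 r)); last first.
  apply/funext => n /=; rewrite /series/= sumEFin; congr (_%:E).
  by apply: eq_bigr => i _; rewrite /geometric /= mul1r.
by apply/cvg_EFin => //; exact: nearW.
Qed.

Lemma geo_small (r c e : R) : (0 <= r < 1)%R -> (0 <= c)%R -> (0 < e)%R ->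
  exists n, (r ^+ n * c <= e)%R.
Proof.
move=> /andP[r0 r1] c0 e0.
have h : (fun n => r ^+ n : R)%R @ \oo --> (0 : R)%R.
  by apply: cvg_expr; rewrite ger0_norm.
have c1 : (0 < c + 1)%R by lra.
have /cvgr0Pnorm_le/(_ _ (divr_gt0 e0 c1))[N _ HN] := h.
exists N; have := HN N (leqnn N) => /=; rewrite ger0_norm ?exprn_ge0// => le.
apply: (@le_trans _ _ (e / (c + 1) * c)%R); first by apply: ler_wpM2r.
by rewrite mulrAC ler_pdivrMr//; nra.
Qed.

(** The geometric series bounds the whole sum of the Green function against
[f], hence each of its terms. *)
Lemma gr_le (r : R) f z z' : (0 <= r < 1)%R -> (forall w, 0 <= f w) ->
  (forall w, app K f w <= r%:E * f w) ->
  gr K z z' * f z' <= ((1 - r)^-1)%:E * f z.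
Proof.
move=> /andP[r0 r1] f0 fr.
apply: (@le_trans _ _ (\S_ w (gr K z w * f w))).
  apply: (@esum_ge_term _ _ (fun w => gr K z w * f w)) => w.
  by rewrite mule_ge0// gr_ge0.
rewrite gr_app// -geometric_esum ?r0// muleC -esum_scale//; last first.
  by move=> n; rewrite lee_fin exprn_ge0.
by apply: le_esum => n _; rewrite muleC iter_app_geo.
Qed.

End nonneg.

Lemma app_leK K K' f z : (forall w, 0 <= f w) ->
  (forall z w, K z w <= K' z w) -> app K f z <= app K' f z.
Proof. by move=> f0 le; apply: le_esum => w _; rewrite lee_wpmul2r. Qed.

Lemma iter_app_leK K K' f n z : (forall z w, 0 <= K z w) ->
  (forall w, 0 <= f w) ->
  (forall z w, K z w <= K' z w) -> iter n (app K) f z <= iter n (app K') f z.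
Proof.
move=> K0 f0 le; elim: n z => // n IH z /=.
have K'0 z1 w : 0 <= K' z1 w by apply: le_trans (le _ _).
apply: (@le_trans _ _ (app K' (iter n (app K) f) z)).
  by apply: app_leK => //; exact: iter_app_ge0.
exact: app_le.
Qed.

Lemma gr_leK K K' z z' : (forall z w, 0 <= K z w) ->
  (forall z w, K z w <= K' z w) -> gr K z z' <= gr K' z z'.
Proof.
move=> K0 le; apply: le_esum => n _; rewrite !nstepE.
by apply: iter_app_leK => // w; exact: dirac_fun_ge0.
Qed.

Lemma nstep_transp K n z z' : (forall z w, 0 <= K z w) ->
  nstep (transp K) n z z' = nstep K n z' z.
Proof.
move=> K0; elim: n z z' => [|n IH] z z'; first by rewrite /= eq_sym.
rewrite [RHS]nstepSr//.
change (\S_ w (transp K z w * nstep (transp K) n w z') =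
  \S_ w (nstep K n z' w * K w z)).
apply: eq_esumT => w; rewrite IH.
by rewrite /transp muleC.
Qed.

Lemma gr_transp K z z' : (forall z w, 0 <= K z w) ->
  gr (transp K) z z' = gr K z' z.
Proof. by move=> K0; apply: eq_esumT => n; rewrite nstep_transp. Qed.

(** The Green function towards [z'] is the value on the diagonal times a hitting
weight, and a superharmonic [f] dominates hitting weights: compare for the
kernel killed at [z']. *)
Lemma domination K f z z' : (forall z w, 0 <= K z w) -> (forall w, 0 <= f w) ->
  (forall w, app K f w <= f w) ->
  gr K z z' < +oo -> f z' < +oo ->
  gr K z z' * f z' <= gr K z' z' * f z.
Proof.
move=> K0 f0 sup goo f'oo.
pose K' x w := if x == z' then 0 else K x w.
have K'0 x w : 0 <= K' x w by rewrite /K'; case: ifP.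
have K'K x w : K' x w <= K x w by rewrite /K'; case: ifP.
pose u w := gr K w z' * f z'.
pose F w := gr K z' z' * f w.
have u0 w : 0 <= u w by rewrite mule_ge0// gr_ge0.
have F0 w : 0 <= F w by rewrite mule_ge0// gr_ge0.
have f'fin : f z' \is a fin_num by rewrite ge0_fin_numE.
have ff0 : (0 <= fine (f z'))%R by exact: fine_ge0.
apply: (@comparison _ K'0 u F (fun w => if w == z' then u z' else 0)) => //.
- by move=> w; case: ifP.
- move=> w; case: eqVneq => [->|wz]; first by rewrite leeDl// app_ge0.
  rewrite add0e {1}/u gr_first// /dirac_fun (negbTE wz) add0e.
  rewrite muleC -appZ//; last by move=> v; exact: gr_ge0.
  rewrite le_eqVlt; apply/orP; left; apply/eqP.
  by apply: eq_esumT => v; rewrite /K' (negbTE wz) /u [f z' * _]muleC.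
- move=> w; case: eqVneq => [->|wz].
    rewrite /app esum1 ?adde0// => v _.
    by rewrite /K' eqxx mul0e.
  rewrite add0e; apply: (@le_trans _ _ (app K F w)); first exact: app_leK.
  by rewrite appZ// ?gr_ge0//; apply: lee_wpmul2l => //; exact: gr_ge0.
- move=> e e0.
  have c0 : (0 < e / (fine (f z') + 1))%R by rewrite divr_gt0// ltr_wpDl.
  have [n nle] := iter_app_gr_small K0 goo c0.
  exists n; apply: (@le_trans _ _ (iter n (app K) u z)); first exact: iter_app_leK.
  have -> : u = fun w => f z' * gr K w z' by apply/funext => w; rewrite /u muleC.
  rewrite iter_appZ//; last by move=> w; exact: gr_ge0.
  apply: (@le_trans _ _ (f z' * (e / (fine (f z') + 1))%:E)).
    exact: lee_wpmul2l.
  rewrite -[f z']fineK// -EFinM lee_fin /= mulrCA ger_pMr//.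
  by rewrite ler_pdivrMr ?mul1r ?lerDl ?ltr_wpDl.
Qed.

Lemma gr_superharmonic K z' w : (forall z w, 0 <= K z w) ->
  app K (fun w => gr K w z') w <= gr K w z'.
Proof. by move=> K0; rewrite [leRHS]gr_first// leeDr// dirac_fun_ge0. Qed.

(** The domination principle for the superharmonic function [gr K _ z].  It
serves both to chain lower bounds along a path and as a Harnack inequality. *)
Lemma gr_mul K x y z : (forall z w, 0 <= K z w) ->
  gr K x y < +oo -> gr K y z < +oo ->
  gr K x y * gr K y z <= gr K y y * gr K x z.
Proof.
move=> K0 h1 h2; apply: (@domination K (fun w => gr K w z)) => // w.
  exact: gr_ge0.
exact: gr_superharmonic.
Qed.

(** Turns irreducibility into the existence of jumps: a set that no jump leaves
cannot be left. *)
Lemma nstep_invariant K (Q : T -> Prop) n z z' : (forall z w, 0 <= K z w) ->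
  (forall z w, 0 < K z w -> Q z -> Q w) ->
  0 < nstep K n z z' -> Q z -> Q z'.
Proof.
move=> K0 inv; elim: n z => [|n IH] z.
  by rewrite /=; case: eqVneq => [->//|_]; rewrite ltxx.
move=> pos Qz.
have [w] : exists w, K z w * nstep K n w z' != 0.
  apply: contrapT => /forallNP h; move: pos; rewrite /= esum1 ?ltxx// => w _.
  by apply/eqP; have /negP := h w; rewrite negbK.
move=> nz; apply: (IH w).
  rewrite lt_neqAle nstep_ge0// andbT eq_sym; apply: contra nz => /eqP ->.
  by rewrite mule0.
apply: inv Qz; rewrite lt_neqAle K0 andbT eq_sym; apply: contra nz => /eqP ->.
by rewrite mul0e.
Qed.

End KernelCalculus.

Local Close Scope ereal_scope.

(** * Gradients of convex functions of two variables *)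

Section ConvexPlane.
Variable R : realType.

Definition convex2 (f : R * R -> R) := forall x y x' y' s, 0 <= s <= 1 ->
  f ((1 - s) * x + s * x', (1 - s) * y + s * y') <=
  (1 - s) * f (x, y) + s * f (x', y').

(** For a convex function a quadratic bound on second differences along the two
axes is what differentiability is needed for; it can be checked term by term
on a series. *)
Definition semiconcave2 (f : R * R -> R) := forall x y, exists2 C, 0 <= C &
  forall h, `|h| <= 1 ->
  f (x + h, y) + f (x - h, y) <= 2 * f (x, y) + C * h ^+ 2 /\
  f (x, y + h) + f (x, y - h) <= 2 * f (x, y) + C * h ^+ 2.

(** A gradient, as a subgradient with quadratic error.  Both halves are
inequalities, so no derivative of a series has to be computed. *)
Definition grad_at (f : R * R -> R) x y p q :=
  (forall h k, f (x, y) + p * h + q * k <= f (x + h, y + k)) /\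
  exists2 C, 0 <= C & forall h k, `|h| <= 1 / 2 -> `|k| <= 1 / 2 ->
    f (x + h, y + k) <= f (x, y) + p * h + q * k + C * (h ^+ 2 + k ^+ 2).

(** The supremum of the left slopes at [x] is the left derivative. *)
Lemma convex1_subgradient (g : R -> R) x :
  (forall u v s, 0 <= s <= 1 ->
     g ((1 - s) * u + s * v) <= (1 - s) * g u + s * g v) ->
  exists p, forall h, g x + p * h <= g (x + h).
Proof.
move=> cvx.
(* Left slopes lie below right slopes. *)
have key s t : 0 < s -> 0 < t -> (g x - g (x - s)) / s <= (g (x + t) - g x) / t.
  move=> s0 t0; have st : 0 < s + t by rewrite addr_gt0.
  have s01 : 0 <= s / (s + t) <= 1.
    by rewrite divr_ge0 ?(ltW s0) ?(ltW st)// ler_pdivrMr// mul1r lerDl ltW.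
  have := cvx (x - s) (x + t) _ s01.
  have -> : (1 - s / (s + t)) * (x - s) + s / (s + t) * (x + t) = x.
    by field; rewrite gt_eqF.
  have -> : 1 - s / (s + t) = t / (s + t) by field; rewrite gt_eqF.
  rewrite mulrAC [X in _ + X]mulrAC -mulrDl ler_pdivlMr// => le.
  rewrite ler_pdivrMr//.
  have -> : (g (x + t) - g x) / t * s = ((g (x + t) - g x) * s) / t by ring.
  by rewrite ler_pdivlMr//; lra.
pose A := [set (g x - g (x - s)) / s | s in [set s | 0 < s]].
have A1 : A ((g x - g (x - 1)) / 1) by exists 1 => //; exact: ltr01.
have ubA t : 0 < t -> ubound A ((g (x + t) - g x) / t).
  by move=> t0 _ [s s0 <-]; apply: key.
have hA : has_sup A.
  by split; [exists ((g x - g (x - 1)) / 1)|exists ((g (x + 1) - g x) / 1); apply: ubA].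
exists (sup A) => h; have [h0|h0|<-] := ltgtP 0 h; last by rewrite mulr0 !addr0.
  have : sup A <= (g (x + h) - g x) / h.
    by apply: ge_sup; [exact: hA.1|exact: ubA].
  by rewrite ler_pdivlMr//; lra.
have nh0 : 0 < - h by rewrite oppr_gt0.
have : (g x - g (x - (- h))) / (- h) <= sup A.
  by apply: ub_le_sup; [exact: hA.2|exists (- h)].
by rewrite opprK ler_pdivrMr//; lra.
Qed.

Variable f : R * R -> R.
Hypothesis cvx : convex2 f.
Hypothesis smc : semiconcave2 f.

(** Partial subgradients give the upper bound at [(x + h, y + k)] by taking the
midpoint of [(x + 2h, y)] and [(x, y + 2k)]; the lower bound follows by
reflection through [(x, y)], and its quadratic error disappears on scaling
[(h, k)] down. *)
Lemma grad_exists x y : exists p q, grad_at f x y p q.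
Proof.
have [p Hp] : exists p, forall h, f (x, y) + p * h <= f (x + h, y).
  apply: (@convex1_subgradient (fun u => f (u, y))) => u v s s01.
  have := cvx u y v y s01.
  by have -> : (1 - s) * y + s * y = y by ring.
have [q Hq] : exists q, forall h, f (x, y) + q * h <= f (x, y + h).
  apply: (@convex1_subgradient (fun u => f (x, u))) => u v s s01.
  have := cvx x u x v s01.
  by have -> : (1 - s) * x + s * x = x by ring.
have [C C0 HC] := smc x y.
have up h k : `|h| <= 1 / 2 -> `|k| <= 1 / 2 ->
    f (x + h, y + k) <= f (x, y) + p * h + q * k + (2 * C) * (h ^+ 2 + k ^+ 2).
  move=> h1 k1.
  have := @cvx (x + 2 * h) y x (y + 2 * k) (1 / 2).
  have -> : (1 - 1 / 2) * (x + 2 * h) + 1 / 2 * x = x + h by field.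
  have -> : (1 - 1 / 2) * y + 1 / 2 * (y + 2 * k) = y + k by field.
  have half01 : 0 <= (1 / 2 : R) <= 1 by lra.
  move=> /(_ half01).
  have h2 : `|2 * h| <= 1 by rewrite normrM ger0_norm//; lra.
  have k2 : `|2 * k| <= 1 by rewrite normrM ger0_norm//; lra.
  have [A _] := HC _ h2; have [_ B] := HC _ k2.
  have := Hp (- (2 * h)); have := Hq (- (2 * k)).
  by nra.
exists p, q; split; last by exists (2 * C) => //; lra.
move=> h k.
(* Reflecting the upper bound through (x, y) gives a lower bound with a
   quadratic error. *)
have low a b : `|a| <= 1 / 2 -> `|b| <= 1 / 2 ->
    f (x, y) + p * a + q * b - (2 * C) * (a ^+ 2 + b ^+ 2) <= f (x + a, y + b).
  move=> a1 b1; have := up (- a) (- b); rewrite !normrN => /(_ a1 b1).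
  have half01 : 0 <= (1 / 2 : R) <= 1 by lra.
  have := cvx (x + a) (y + b) (x - a) (y - b) half01.
  have -> : (1 - 1 / 2) * (x + a) + 1 / 2 * (x - a) = x by field.
  have -> : (1 - 1 / 2) * (y + b) + 1 / 2 * (y - b) = y by field.
  by rewrite !sqrrN; lra.
apply/ler_addgt0Pr => e e0.
(* The error is quadratic, so by convexity it is divided by M when the
   increment is divided by 2 * M. *)
pose M := `|h| + `|k| + 1 + 2 * C * (h ^+ 2 + k ^+ 2) / e.
have hk0 : 0 <= h ^+ 2 + k ^+ 2 by rewrite addr_ge0// sqr_ge0.
have Me : 0 <= 2 * C * (h ^+ 2 + k ^+ 2) / e.
  by rewrite divr_ge0 ?(ltW e0)// mulr_ge0// mulr_ge0.
have nh := normr_ge0 h; have nk := normr_ge0 k.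
have M1 : 1 <= M by rewrite /M; lra.
pose s := (2 * M)^-1.
have s0 : 0 < s by rewrite invr_gt0; lra.
have sM : s * M = 1 / 2 by rewrite /s; field; lra.
have s1 : 0 <= s <= 1 by nra.
have sh : `|s * h| <= 1 / 2.
  by rewrite normrM (ger0_norm (ltW s0)) -sM ler_wpM2l ?ltW// /M; lra.
have sk : `|s * k| <= 1 / 2.
  by rewrite normrM (ger0_norm (ltW s0)) -sM ler_wpM2l ?ltW// /M; lra.
have := low _ _ sh sk.
have := cvx x y (x + h) (y + k) s1.
have -> : (1 - s) * x + s * (x + h) = x + s * h by ring.
have -> : (1 - s) * y + s * (y + k) = y + s * k by ring.
move=> A B.
have se : s * (2 * C * (h ^+ 2 + k ^+ 2)) <= e.
  have : s * (2 * C * (h ^+ 2 + k ^+ 2) / e) <= s * M.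
    by rewrite ler_wpM2l ?ltW// /M; lra.
  by rewrite sM mulrA ler_pdivrMr//; lra.
have : s * (f (x, y) + p * h + q * k) <= s * (f (x + h, y + k) + e).
  have := mulr_ge0 (ltW s0) hk0; nra.
by rewrite ler_pM2l.
Qed.

Lemma convex_continuous x y e : 0 < e -> exists2 d, 0 < d & forall h k,
  `|h| <= d -> `|k| <= d -> `|f (x + h, y + k) - f (x, y)| <= e.
Proof.
move=> e0; have [p [q [lo [C C0 up]]]] := grad_exists x y.
pose M := `|p| + `|q| + 2 * C + 1.
have np := normr_ge0 p; have nq := normr_ge0 q.
have M1 : 1 <= M by rewrite /M; lra.
pose d := Num.min (1 / 2) (e / M).
have M0 : 0 < M by lra.
have d0 : 0 < d by rewrite lt_min divr_gt0 ?ltr01//=; exact: divr_gt0.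
have dh : d <= 1 / 2 by rewrite ge_min lexx.
have dM : d * M <= e by rewrite -ler_pdivlMr// ge_min lexx orbT.
exists d => // h k hd kd.
have ph : `|p * h| <= `|p| * d by rewrite normrM ler_wpM2l.
have qk : `|q * k| <= `|q| * d by rewrite normrM ler_wpM2l.
have h2 : h ^+ 2 <= d.
  rewrite -(real_normK (num_real h)) expr2 -[leRHS]mulr1.
  by apply: ler_pM => //; lra.
have k2 : k ^+ 2 <= d.
  rewrite -(real_normK (num_real k)) expr2 -[leRHS]mulr1.
  by apply: ler_pM => //; lra.
have := lo h k; have := up h k (le_trans hd dh) (le_trans kd dh).
move: ph qk; rewrite !ler_norml => /andP[p1 p2] /andP[q1 q2] U L.
rewrite /M in dM; apply/andP; split; nra.
Qed.

End ConvexPlane.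

(** * Moment generating functions *)

Section Mgf.
Variable R : realType.

Definition dotp (a : R * R) (z : int * int) : R := a.1 * z.1%:~R + a.2 * z.2%:~R.

Variable mu : int * int -> R.
Hypothesis mu0 : forall z, 0 <= mu z.
Hypothesis fin : forall a, (emgf mu a < +oo)%E.

Lemma mgfE a : emgf mu a = (mgf mu a)%:E.
Proof.
rewrite /mgf fineK// ge0_fin_numE//; apply: esum_ge0 => z _.
by rewrite lee_fin mulr_ge0// expR_ge0.
Qed.

Lemma mgf_ge0 a : 0 <= mgf mu a.
Proof.
by rewrite -lee_fin -mgfE; apply: esum_ge0 => z _; rewrite lee_fin mulr_ge0// expR_ge0.
Qed.

(** Inequalities between values of a moment generating function at several
points reduce to pointwise inequalities between such combinations. *)
Definition expcomb (s : seq (R * (R * R))) (z : int * int) : R :=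
  \sum_(p <- s) p.1 * expR (dotp p.2 z).

Lemma expcomb_ge0 s z : all (fun p => 0 <= p.1) s -> 0 <= expcomb s z.
Proof.
move=> /allP s0; rewrite /expcomb big_seq; apply: sumr_ge0 => p ps.
by rewrite mulr_ge0 ?expR_ge0 ?s0.
Qed.

Lemma esum_expcomb s : all (fun p => 0 <= p.1) s ->
  (\S_ z (mu z * expcomb s z)%:E)%E = (\sum_(p <- s) p.1 * mgf mu p.2)%:E.
Proof.
elim: s => [|p s IH] /=.
  by move=> _; rewrite big_nil esum1// => z _; rewrite /expcomb big_nil mulr0.
move=> /andP[p0 s0]; rewrite big_cons EFinD -IH// EFinM -mgfE /emgf.
rewrite -esum_scale ?lee_fin//; last first.
  by move=> z; rewrite lee_fin mulr_ge0// expR_ge0.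
rewrite -esumD; last 2 first.
- by move=> z _; rewrite -EFinM lee_fin !mulr_ge0// expR_ge0.
- by move=> z _; rewrite lee_fin mulr_ge0// expcomb_ge0.
apply: eq_esumT => z; rewrite -EFinM -EFinD /expcomb big_cons mulrDr mulrCA.
by [].
Qed.

Lemma mgf_comb_le s s' : all (fun p => 0 <= p.1) s ->
  all (fun p => 0 <= p.1) s' ->
  (forall z, 0 < mu z -> expcomb s z <= expcomb s' z) ->
  \sum_(p <- s) p.1 * mgf mu p.2 <= \sum_(p <- s') p.1 * mgf mu p.2.
Proof.
move=> s0 s0' le; rewrite -lee_fin -!esum_expcomb//; apply: le_esum => z _.
rewrite lee_fin; have := mu0 z; rewrite le_eqVlt => /orP[/eqP<-|mz].
  by rewrite !mul0r.
by rewrite ler_pM2l// le.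
Qed.

Lemma mgf_comb_lt s s' z0 : all (fun p => 0 <= p.1) s ->
  all (fun p => 0 <= p.1) s' ->
  (forall z, 0 < mu z -> expcomb s z <= expcomb s' z) ->
  0 < mu z0 -> expcomb s z0 < expcomb s' z0 ->
  \sum_(p <- s) p.1 * mgf mu p.2 < \sum_(p <- s') p.1 * mgf mu p.2.
Proof.
move=> s0 s0' le mz lt.
pose d := mu z0 * (expcomb s' z0 - expcomb s z0).
have d0 : 0 < d by rewrite mulr_gt0// subr_gt0.
apply: (@lt_le_trans _ _ (\sum_(p <- s) p.1 * mgf mu p.2 + d)).
  by rewrite ltrDl.
rewrite -lee_fin EFinD -!esum_expcomb//.
have -> : d%:E = (\S_ z (if z == z0 then d else 0)%:E)%E.
  rewrite (@esum_single _ _ _ z0) ?eqxx ?lee_fin ?ltW// => j /negbTE ->//.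
rewrite -esumD; last 2 first.
- by move=> z _; rewrite lee_fin mulr_ge0// expcomb_ge0.
- by move=> z _; rewrite lee_fin; case: ifP => // _; exact: ltW.
apply: le_esum => z _; rewrite -EFinD lee_fin; case: eqVneq => [->|_].
  by rewrite /d -mulrDr addrC subrK.
rewrite addr0.
have := mu0 z; rewrite le_eqVlt => /orP[/eqP<-|mz']; first by rewrite !mul0r.
by rewrite ler_pM2l// le.
Qed.

Lemma expR_tangent (m u : R) : expR m * (1 + (u - m)) <= expR u.
Proof.
have := expR_ge1Dx (u - m); rewrite -(ler_pM2l (expR_gt0 m)) -expRD.
by have -> : m + (u - m) = u by ring.
Qed.

Lemma mgf_convex : convex2 (mgf mu).
Proof.
move=> x y x' y' s /andP[s0 s1].
have := @mgf_comb_le [:: (1, ((1 - s) * x + s * x', (1 - s) * y + s * y'))]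
  [:: (1 - s, (x, y)); (s, (x', y'))].
rewrite !big_cons !big_nil /= mul1r !addr0; apply; rewrite ?ler01 ?subr_ge0 ?s0 ?s1//.
move=> z _; rewrite /expcomb !big_cons !big_nil /= mul1r !addr0 /dotp /=.
set m := expR _; set a := x * _ + _; set b := x' * _ + _.
have := @expR_tangent ((1 - s) * a + s * b) a.
have := @expR_tangent ((1 - s) * a + s * b) b.
have <- : m = expR ((1 - s) * a + s * b) by rewrite /m/a/b; congr expR; ring.
set ea := expR a; set eb := expR b.
by nra.
Qed.

Lemma expR_second_difference (u : R) :
  expR u + expR (- u) - 2 <= u ^+ 2 * expR `|u|.
Proof.
wlog u0 : u / 0 <= u.
  move=> H; have [|/ltW] := leP 0 u; first exact: H.
  by rewrite -oppr_ge0 => /H; rewrite opprK normrN sqrrN (addrC (expR (- u))).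
rewrite ger0_norm//.
have e0 := expR_gt0 u; have e1 := expR_gt0 (- u).
have prod : expR u * expR (- u) = 1 by rewrite -expRD subrr expR0.
(* This makes the second difference, written as a square, at most
   u^2 * expR u. *)
have t : expR u - 1 <= u * expR u.
  by have := expR_ge1Dx (- u); rewrite -(ler_pM2l e0) prod; lra.
have t0 : 0 <= expR u - 1 by rewrite subr_ge0 -expR0 ler_expR.
have -> : expR u + expR (- u) - 2 = expR (- u) * (expR u - 1) ^+ 2.
  have -> : expR (- u) * (expR u - 1) ^+ 2 =
    (expR u * expR (- u)) * expR u - 2 * (expR u * expR (- u)) + expR (- u) by ring.
  by rewrite prod; ring.
have -> : u ^+ 2 * expR u = expR (- u) * (u * expR u) ^+ 2.
  have -> : expR (- u) * (u * expR u) ^+ 2 = u ^+ 2 * expR u * (expR u * expR (- u)) by ring.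
  by rewrite prod mulr1.
by rewrite ler_pM2l// lerXn2r// nnegrE ?mulr_ge0// ltW.
Qed.

Lemma sqr_le_expR (u : R) : u ^+ 2 <= 4 * expR `|u|.
Proof.
have := expR_ge1Dx (`|u| / 2).
have : expR `|u| = expR (`|u| / 2) ^+ 2.
  by rewrite -expRM_natl; congr expR; field.
move=> ->; rewrite -(real_normK (num_real u)); have := normr_ge0 u.
by set e := expR _; nra.
Qed.

Lemma expR_abs_le (u : R) : expR `|u| <= expR u + expR (- u).
Proof.
have := expR_ge0 u; have := expR_ge0 (- u).
by case: (ler0P u) => _; lra.
Qed.

(** The factor [k^2] produced by two derivatives is absorbed by exponentials at
the points shifted by [2 * k], so that the bound sums to values of the same
moment generating function. *)
Lemma expR_shift_second_difference (s h k : R) : `|h| <= 1 ->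
  expR (s + h * k) + expR (s - h * k) <=
  2 * expR s + 4 * h ^+ 2 * (expR (s + 2 * k) + expR (s - 2 * k)).
Proof.
move=> h1; rewrite !expRD.
have e0 := expR_gt0 s.
have A := expR_second_difference (h * k).
have hk : `|h * k| <= `|k| by rewrite normrM ler_piMl.
have B : expR `|h * k| <= expR `|k| by rewrite ler_expR.
have C := sqr_le_expR k.
have D := expR_abs_le (2 * k).
have E : expR `|2 * k| = expR `|k| ^+ 2.
  by rewrite normrM (ger0_norm (_ : 0 <= 2))// -expRM_natl.
have F : expR (h * k) + expR (- (h * k)) <=
    2 + 4 * h ^+ 2 * (expR (2 * k) + expR (- (2 * k))).
  have : (h * k) ^+ 2 * expR `|h * k| <= 4 * h ^+ 2 * expR `|2 * k|.
    rewrite E exprMn.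
    have -> : 4 * h ^+ 2 * expR `|k| ^+ 2 = h ^+ 2 * (4 * expR `|k|) * expR `|k|.
      by ring.
    have h20 : 0 <= h ^+ 2 by exact: sqr_ge0.
    have k20 : 0 <= k ^+ 2 by exact: sqr_ge0.
    apply: ler_pM B; [exact: mulr_ge0|exact: expR_ge0|].
    exact: ler_wpM2l.
  have : 4 * h ^+ 2 * expR `|2 * k| <= 4 * h ^+ 2 * (expR (2 * k) + expR (- (2 * k))).
    by rewrite ler_wpM2l// mulr_ge0// sqr_ge0.
  by lra.
rewrite -(ler_pM2l e0) in F; lra.
Qed.

Lemma mgf_semiconcave : semiconcave2 (mgf mu).
Proof.
move=> x y.
exists (4 * (mgf mu (x + 2, y) + mgf mu (x - 2, y) +
             (mgf mu (x, y + 2) + mgf mu (x, y - 2)))).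
  by rewrite mulr_ge0// !addr_ge0// mgf_ge0.
move=> h h1.
have h20 : 0 <= 4 * h ^+ 2 by rewrite mulr_ge0// sqr_ge0.
split.
- have := @mgf_comb_le [:: (1, (x + h, y)); (1, (x - h, y))]
    [:: (2, (x, y)); (4 * h ^+ 2, (x + 2, y)); (4 * h ^+ 2, (x - 2, y))].
  rewrite !big_cons !big_nil /= !mul1r !addr0 h20 !ler01 ler0n.
  move=> /(_ isT isT) H.
  have := mgf_ge0 (x, y + 2); have := mgf_ge0 (x, y - 2).
  suff : mgf mu (x + h, y) + mgf mu (x - h, y) <=
      2 * mgf mu (x, y) + (4 * h ^+ 2 * mgf mu (x + 2, y) + 4 * h ^+ 2 * mgf mu (x - 2, y)).
    by nra.
  apply: H => z _; rewrite /expcomb !big_cons !big_nil /= !mul1r !addr0 /dotp /=.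
  have := @expR_shift_second_difference (x * z.1%:~R + y * z.2%:~R) h z.1%:~R h1.
  rewrite mulrDr; set X := z.1%:~R; set Y := z.2%:~R.
  have D u : (x + u) * X + y * Y = (x * X + y * Y) + u * X by ring.
  by rewrite !D !mulNr.
- have := @mgf_comb_le [:: (1, (x, y + h)); (1, (x, y - h))]
    [:: (2, (x, y)); (4 * h ^+ 2, (x, y + 2)); (4 * h ^+ 2, (x, y - 2))].
  rewrite !big_cons !big_nil /= !mul1r !addr0 h20 !ler01 ler0n.
  move=> /(_ isT isT) H.
  have := mgf_ge0 (x + 2, y); have := mgf_ge0 (x - 2, y).
  suff : mgf mu (x, y + h) + mgf mu (x, y - h) <=
      2 * mgf mu (x, y) + (4 * h ^+ 2 * mgf mu (x, y + 2) + 4 * h ^+ 2 * mgf mu (x, y - 2)).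
    by nra.
  apply: H => z _; rewrite /expcomb !big_cons !big_nil /= !mul1r !addr0 /dotp /=.
  have := @expR_shift_second_difference (x * z.1%:~R + y * z.2%:~R) h z.2%:~R h1.
  rewrite mulrDr; set X := z.1%:~R; set Y := z.2%:~R.
  have D u : x * X + (y + u) * Y = (x * X + y * Y) + u * Y by ring.
  by rewrite !D !mulNr.
Qed.

Lemma mgf_strict_midpoint x y h k z : 0 < mu z ->
  h * z.1%:~R + k * z.2%:~R != 0 ->
  2 * mgf mu (x, y) < mgf mu (x + h, y + k) + mgf mu (x - h, y - k).
Proof.
move=> mz nz.
have pw (z' : int * int) : let s := x * z'.1%:~R + y * z'.2%:~R in
    let u := h * z'.1%:~R + k * z'.2%:~R in
    expcomb [:: (1, (x + h, y + k)); (1, (x - h, y - k))] z' -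
    expcomb [:: (2, (x, y))] z' = expR s * (expR (u / 2) - expR (- (u / 2))) ^+ 2.
  rewrite /= /expcomb !big_cons !big_nil /= !mul1r !addr0 /dotp /=.
  set s := x * _ + y * _; set u := h * _ + k * _.
  have -> : (x + h) * z'.1%:~R + (y + k) * z'.2%:~R = s + u by rewrite /s /u; ring.
  have -> : (x - h) * z'.1%:~R + (y - k) * z'.2%:~R = s - u by rewrite /s /u; ring.
  rewrite (expRD s u) (expRD s (- u)).
  have -> : expR u = expR (u / 2) ^+ 2 by rewrite -expRM_natl; congr expR; field.
  have -> : expR (- u) = expR (- (u / 2)) ^+ 2 by rewrite -expRM_natl; congr expR; field.
  have prod : expR (u / 2) * expR (- (u / 2)) = 1 by rewrite -expRD subrr expR0.
  set A := expR (u / 2) in prod *; set B := expR (- (u / 2)) in prod *.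
  have -> : (A - B) ^+ 2 = A ^+ 2 + B ^+ 2 - 2 * (A * B) by ring.
  by rewrite prod; ring.
have := @mgf_comb_lt [:: (2, (x, y))]
  [:: (1, (x + h, y + k)); (1, (x - h, y - k))] z.
rewrite !big_cons !big_nil /= !mul1r !addr0 ler0n ler01; apply => //.
- move=> z' _; rewrite -subr_ge0 pw mulr_ge0 ?expR_ge0 ?sqr_ge0//.
- rewrite -subr_gt0 pw mulr_gt0 ?expR_gt0//.
  rewrite lt_neqAle sqr_ge0 andbT eq_sym sqrf_eq0 subr_eq0.
  apply/negP => /eqP/expR_inj H; move/negP: nz; apply; apply/eqP; lra.
Qed.

Lemma mgf_lower a z : mu z * expR (dotp a z) <= mgf mu a.
Proof.
rewrite -lee_fin -mgfE.
apply: (@esum_ge_term _ _ (fun z => (mu z * expR (dotp a z))%:E)) => i.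
by rewrite lee_fin mulr_ge0// expR_ge0.
Qed.

Lemma mgf_unbounded x (M : R) i j : 0 < mu (i, j) -> (0 < j)%R ->
  exists2 y0, 0 <= y0 & forall y, y0 <= y -> M < mgf mu (x, y).
Proof.
move=> mz j0.
pose c := mu (i, j) * expR (x * i%:~R).
have c0 : 0 < c by rewrite mulr_gt0// expR_gt0.
exists (`|M| / c); first by rewrite divr_ge0// ltW.
move=> y yM; apply: lt_le_trans (mgf_lower _ (i, j)).
rewrite /dotp /= expRD mulrA -/c.
have y0 : 0 <= y by apply: le_trans yM; rewrite divr_ge0// ltW.
have j1 : 1 <= (j%:~R : R) by rewrite (ler_int _ 1 j).
have e1 : 1 + y <= expR (y * j%:~R).
  apply: le_trans (expR_ge1Dx _); rewrite lerD2l; nra.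
have : `|M| <= c * y by rewrite mulrC -ler_pdivrMr.
have := ler_norm M; nra.
Qed.

Lemma mgf_increasing x y y' i j : (forall i j, j < 0 -> mu (i, j) = 0)%R ->
  0 < mu (i, j) -> (0 < j)%R -> y < y' -> mgf mu (x, y) < mgf mu (x, y').
Proof.
move=> nn mz j0 yy'.
have := @mgf_comb_lt [:: (1, (x, y))] [:: (1, (x, y'))] (i, j).
rewrite !big_cons !big_nil /= !mul1r !addr0 ler01; apply => //.
- move=> [u v] muv; rewrite /expcomb !big_cons !big_nil /= !mul1r !addr0 /dotp /=.
  rewrite ler_expR lerD2l; apply: ler_wpM2r; last exact: ltW.
  rewrite ler0z; case: (leP 0%R v) => // /nn muv0; by rewrite muv0 ltxx in muv.
- rewrite /expcomb !big_cons !big_nil /= !mul1r !addr0 /dotp /=.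
  by rewrite ltr_expR ltrD2l ltr_pM2r// ltr0z.
Qed.

End Mgf.

(** * Kernels under injections and bijections *)

Section KernelMaps.
Variable R : realType.

Lemma nstep_inj_le (T T' : choiceType) (K : T -> T -> \bar R)
    (K' : T' -> T' -> \bar R) (e : T -> T') n z w :
  injective e -> (forall z w, 0 <= K z w)%E -> (forall z w, 0 <= K' z w)%E ->
  (forall z w, K z w <= K' (e z) (e w))%E ->
  (nstep K n z w <= nstep K' n (e z) (e w))%E.
Proof.
move=> ei K0 K'0 le; elim: n z => [|n IH] z.
  by rewrite /= (inj_eq ei).
rewrite /=; apply: le_trans (esum_inj_le (f := fun v => K' (e z) v * nstep K' n v (e w))%E ei _).
  by apply: le_esum => v _; apply: lee_pmul => //; exact: nstep_ge0.
by move=> v; rewrite mule_ge0//; exact: nstep_ge0.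
Qed.

Lemma nstep_bij (T T' : choiceType) (K : T -> T -> \bar R)
    (K' : T' -> T' -> \bar R) (e : T -> T') (e' : T' -> T) n z w :
  cancel e e' -> cancel e' e ->
  (forall z w, 0 <= K z w)%E -> (forall z w, K z w = K' (e z) (e w))%E ->
  nstep K n z w = nstep K' n (e z) (e w).
Proof.
move=> ee' e'e K0 eq.
have K'0 x y : (0 <= K' x y)%E by rewrite -(e'e x) -(e'e y) -eq.
apply/eqP; rewrite eq_le; apply/andP; split.
  by apply: nstep_inj_le => //; [exact: can_inj ee'|move=> x y; rewrite eq].
rewrite -{2}(ee' z) -{2}(ee' w); apply: nstep_inj_le => //; first exact: can_inj e'e.
by move=> x y; rewrite eq !e'e.
Qed.

End KernelMaps.

(** * Exponential functions of the reflected walk *)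

(** The standing assumptions, bundled so that the mirror image of a walk is again
such an object. *)
Record halfplane_walk (R : realType) := HalfplaneWalk {
  step_mass : int * int -> R;
  axis_mass : int * int -> R;
  step_mass_ge0 : forall z, 0 <= step_mass z;
  axis_mass_ge0 : forall z, 0 <= axis_mass z;
  step_mass_down : forall x y : int, y < -1 -> step_mass (x, y) = 0;
  axis_mass_down : forall x y : int, y < 0 -> axis_mass (x, y) = 0;
  step_mass_fin : forall a : R * R, (emgf step_mass a < +oo)%E;
  axis_mass_fin : forall a : R * R, (emgf axis_mass a < +oo)%E;
  walk_irr : irreducible_kernel (reflected_kernel step_mass axis_mass);
  interior_irr : irreducible_kernel (walk_kernel step_mass) }.
Arguments step_mass_ge0 {R} h z.
Arguments axis_mass_ge0 {R} h z.

Section Walk.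
Variable R : realType.
Variable W : halfplane_walk R.
Variable t : R.
Hypothesis t0 : 0 < t.

Local Notation mu := (step_mass W).
Local Notation mu0 := (axis_mass W).
Let mu_ge0 := step_mass_ge0 W.
Let mu0_ge0 := axis_mass_ge0 W.
Let fin := @step_mass_fin R W.
Let fin0 := @axis_mass_fin R W.
Let A0 := @step_mass_down R W.
Let A0' := @axis_mass_down R W.
Hint Resolve step_mass_ge0 axis_mass_ge0 : core.

Local Notation E := (int * nat)%type.
Local Notation phi := (mgf mu).
Local Notation phi0 := (mgf mu0).

Definition pexp (a : R * R) (z : E) : R := expR (a.1 * z.1%:~R + a.2 * z.2%:R).
Definition jump (z w : E) : int * int := (w.1 - z.1, w.2%:Z - z.2%:Z).
Definition jump_mass (z : E) (s : int * int) : R := if z.2 == 0%N then mu0 s else mu s.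
Definition Kt (z w : E) : \bar R := ((t^-1)%:E * reflected_kernel mu mu0 z w)%E.
(** Paths that neither start from, nor end on, nor visit the axis. *)
Definition Kkill (z w : E) : \bar R :=
  if (0 < z.2)%N && (0 < w.2)%N then Kt z w else 0%E.

Local Notation G := (gr Kt).

Lemma KtE z w : Kt z w = (t^-1 * jump_mass z (jump z w))%:E.
Proof. by rewrite /Kt /reflected_kernel /jump_mass. Qed.

Lemma jump_mass_ge0 z s : 0 <= jump_mass z s. Proof. by rewrite /jump_mass; case: ifP. Qed.

Lemma Kt_ge0 z w : (0 <= Kt z w)%E.
Proof. by rewrite KtE lee_fin mulr_ge0 ?invr_ge0 ?(ltW t0)// jump_mass_ge0. Qed.

Lemma Kkill_ge0 z w : (0 <= Kkill z w)%E.
Proof. by rewrite /Kkill; case: ifP => // _; exact: Kt_ge0. Qed.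

Lemma Kkill_le z w : (Kkill z w <= Kt z w)%E.
Proof. by rewrite /Kkill; case: ifP => // _; exact: Kt_ge0. Qed.

Hint Resolve Kt_ge0 Kkill_ge0 Kkill_le : core.

Lemma pexp_gt0 a z : 0 < pexp a z. Proof. exact: expR_gt0. Qed.
Lemma pexp_ge0 a z : 0 <= pexp a z. Proof. exact: expR_ge0. Qed.
Lemma pexp_neq0 a z : pexp a z != 0. Proof. by rewrite gt_eqF// pexp_gt0. Qed.

Lemma pexp_step a z w : pexp a w = pexp a z * expR (dotp a (jump z w)).
Proof.
rewrite /pexp -expRD; congr expR; rewrite /dotp /jump /= !intrB -!pmulrn.
by ring.
Qed.

Lemma jump_inj z : injective (jump z).
Proof.
move=> [x y] [x' y'] [/addIr -> /addIr [->]] //.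
Qed.

Lemma jump_injl w : injective (jump^~ w).
Proof.
by move=> [x y] [x' y'] [/addrI /oppr_inj -> /addrI /oppr_inj [->]].
Qed.

Lemma green_gr z w : green (reflected_kernel mu mu0) t z w = G z w.
Proof.
have eq n x : ((t ^- n)%:E * nstep (reflected_kernel mu mu0) n x w)%E = nstep Kt n x w.
  elim: n x => [|n IH] x /=; first by rewrite invr1 mul1e.
  have P0 x' w' : (0 <= reflected_kernel mu mu0 x' w')%E.
    by rewrite lee_fin; case: ifP.
  rewrite -esum_scale//; last 2 first.
  - by rewrite lee_fin invr_ge0 exprn_ge0// ltW.
  - by move=> v; rewrite mule_ge0//; exact: nstep_ge0.
  apply: eq_esumT => v; rewrite -IH /Kt exprS invfM EFinM.
  rewrite -!muleA; congr (_ * _)%E; rewrite !muleA; congr (_ * _)%E.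
  by rewrite muleC.
rewrite /green nneseries_esumT; last first.
  by move=> n; rewrite eq; exact: nstep_ge0.
by apply: eq_esumT => n; rewrite eq.
Qed.

Definition phiz (z : E) a : R := if z.2 == 0%N then phi0 a else phi a.

Lemma emgf_jump_mass a z : (\S_ s (jump_mass z s * expR (dotp a s))%:E)%E = (phiz z a)%:E.
Proof. by rewrite /jump_mass /phiz; case: ifP => _; rewrite -mgfE. Qed.

Lemma phiz_ge0 z a : 0 <= phiz z a.
Proof. by rewrite /phiz; case: ifP => _; exact: mgf_ge0. Qed.

(** Off the axis no jump leaves the half-plane, since jumps go down by at most
one; hence the full moment generating function appears. *)
Lemma app_pexp a z : app Kt (fun w => (pexp a w)%:E) z = (phiz z a / t * pexp a z)%:E.
Proof.
have -> : app Kt (fun w => (pexp a w)%:E) z = (\S_ w ((t^-1 * pexp a z)%:E *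
    (jump_mass z (jump z w) * expR (dotp a (jump z w)))%:E))%E.
  apply: eq_esumT => w; rewrite KtE -!EFinM (pexp_step a z w); congr EFin; ring.
rewrite esum_scale; last 2 first.
- by rewrite lee_fin mulr_ge0 ?invr_ge0 ?pexp_ge0// ltW.
- by move=> w; rewrite lee_fin mulr_ge0 ?jump_mass_ge0 ?expR_ge0.
rewrite (@esum_inj_eq _ _ _ (jump z) (fun s => (jump_mass z s * expR (dotp a s))%:E)).
- by rewrite emgf_jump_mass -EFinM; congr EFin; ring.
- exact: jump_inj.
- move=> [i j]; rewrite /jump_mass; case: z => x [|y] /=.
    have [j0|/A0' ->] := leP 0 j; last by rewrite mul0r eqxx.
    move=> _; exists (x + i, `|j|%N); rewrite /jump /= gez0_abs// subr0.
    by congr (_, _); ring.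
  have [j0|] := leP (- 1) j; last by move=> /A0 ->; rewrite mul0r eqxx.
  move=> _; exists (x + i, `|(y.+1%:Z + j)%R|%N).
  rewrite /jump /= gez0_abs; last by lia.
  by congr (_, _); lia.
Qed.

Lemma app_pexp_killed a z :
  (app Kkill (fun w => (pexp a w)%:E) z <= (phi a / t * pexp a z)%:E)%E.
Proof.
case: (boolP (0 < z.2)%N) => [z0|z0].
  have := app_pexp a z; rewrite /phiz gtn_eqF// => <-.
  by apply: app_leK => // w; rewrite lee_fin pexp_ge0.
rewrite /app esum1 ?lee_fin ?mulr_ge0 ?mgf_ge0 ?invr_ge0 ?pexp_ge0 ?(ltW t0)//.
by move=> w _; rewrite /Kkill (negbTE z0) mul0e.
Qed.

Lemma col_sum (c : int * int -> R) a w : (forall s, 0 <= c s) ->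
  (\S_ z ((t^-1 * c (jump z w))%:E * ((pexp a z)^-1)%:E) <=
   (t^-1)%:E * ((pexp a w)^-1)%:E * emgf c a)%E.
Proof.
move=> c0.
have ti0 : (0 <= (t^-1)%:E * ((pexp a w)^-1)%:E)%E.
  by rewrite -EFinM lee_fin mulr_ge0 ?invr_ge0 ?pexp_ge0// ltW.
rewrite /emgf -esum_scale; last 2 first.
- exact: ti0.
- by move=> s; rewrite lee_fin mulr_ge0// expR_ge0.
apply: le_trans (esum_inj_le (f := fun s => (t^-1)%:E * ((pexp a w)^-1)%:E *
  (c s * expR (dotp a s))%:E)%E (@jump_injl w) _); last first.
  by move=> s; apply: mule_ge0; rewrite ?ti0// lee_fin mulr_ge0 ?expR_ge0.
apply: le_esum => z _; rewrite -!EFinM lee_fin (pexp_step a z w).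
rewrite le_eqVlt; apply/orP; left; apply/eqP.
have e0 : expR (dotp a (jump z w)) != 0 by rewrite gt_eqF// expR_gt0.
by field; rewrite e0 pexp_neq0 (gt_eqF t0).
Qed.

(** The transposed kernel splits according to whether the source of the jump is
on the axis ([Kaxis]) or off it ([Kinter]); the first argument is the target. *)
Definition Kaxis (w v : E) : \bar R := if v.2 == 0%N then Kt v w else 0%E.
Definition Kinter (w v : E) : \bar R := if v.2 == 0%N then 0%E else Kt v w.

Lemma Kaxis_ge0 w v : (0 <= Kaxis w v)%E.
Proof. by rewrite /Kaxis; case: ifP. Qed.
Lemma Kinter_ge0 w v : (0 <= Kinter w v)%E.
Proof. by rewrite /Kinter; case: ifP. Qed.
Hint Resolve Kaxis_ge0 Kinter_ge0 : core.

Lemma app_transp_split u w : (forall v, 0 <= u v)%E ->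
  app (transp Kt) u w = (app Kaxis u w + app Kinter u w)%E.
Proof.
move=> u0; rewrite /app -esumD; last 2 first.
- by move=> v _; rewrite mule_ge0.
- by move=> v _; rewrite mule_ge0.
apply: eq_esumT => v; rewrite /Kaxis /Kinter /transp.
by case: ifP => _; rewrite mul0e ?adde0 ?add0e.
Qed.

Lemma app_Kinter_pexp a w :
  (app Kinter (fun v => ((pexp a v)^-1)%:E) w <= (phi a / t * (pexp a w)^-1)%:E)%E.
Proof.
apply: le_trans (_ : (\S_ z ((t^-1 * mu (jump z w))%:E * ((pexp a z)^-1)%:E) <= _)%E).
  apply: le_esum => v _; apply: lee_wpmul2r; first by rewrite lee_fin invr_ge0 pexp_ge0.
  rewrite /Kinter; case: ifPn => v0; first by rewrite lee_fin mulr_ge0 ?invr_ge0 ?(ltW t0).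
  by rewrite KtE /jump_mass (negbTE v0).
apply: le_trans (@col_sum mu a w mu_ge0) _.
by rewrite mgfE// -!EFinM lee_fin; nra.
Qed.

Lemma app_Kaxis_pexp a w :
  (app Kaxis (fun v => ((pexp a v)^-1)%:E) w <= (phi0 a / t * (pexp a w)^-1)%:E)%E.
Proof.
apply: le_trans (_ : (\S_ z ((t^-1 * mu0 (jump z w))%:E * ((pexp a z)^-1)%:E) <= _)%E).
  apply: le_esum => v _; apply: lee_wpmul2r; first by rewrite lee_fin invr_ge0 pexp_ge0.
  rewrite /Kaxis; case: ifPn => v0; last by rewrite lee_fin mulr_ge0 ?invr_ge0 ?(ltW t0).
  by rewrite KtE /jump_mass v0.
apply: le_trans (@col_sum mu0 a w mu0_ge0) _.
by rewrite mgfE// -!EFinM lee_fin; nra.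
Qed.

Lemma gr_bound a s : phi a <= s -> phi0 a <= s -> s < t ->
  forall z w, (G z w <= ((1 - s / t)^-1 * (pexp a z / pexp a w))%:E)%E.
Proof.
move=> ps p0s st z w.
have s0 : 0 <= s by apply: le_trans ps; exact: mgf_ge0.
have r1 : 0 <= s / t < 1.
  by rewrite divr_ge0 ?(ltW t0)//= ltr_pdivrMr ?mul1r.
have := @gr_le _ _ Kt Kt_ge0 (s / t) (fun w => (pexp a w)%:E) z w r1.
have e0 v : (0 <= (pexp a v)%:E)%E by rewrite lee_fin pexp_ge0.
move=> /(_ e0); rewrite -EFinM => H.
have {}H : (G z w * (pexp a w)%:E <= ((1 - s / t)^-1 * pexp a z)%:E)%E.
  apply: H => v; rewrite app_pexp -EFinM lee_fin ler_wpM2r ?pexp_ge0//.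
  by rewrite ler_wpM2r ?invr_ge0 ?(ltW t0)// /phiz; case: ifP.
by rewrite mulrA EFinM lee_pdivlMr ?pexp_gt0.
Qed.

Lemma gr_killed_bound a s : phi a <= s -> s < t ->
  forall z w, (gr Kkill z w <= ((1 - s / t)^-1 * (pexp a z / pexp a w))%:E)%E.
Proof.
move=> ps st z w.
have s0 : 0 <= s by apply: le_trans ps; exact: mgf_ge0.
have r1 : 0 <= s / t < 1.
  by rewrite divr_ge0 ?(ltW t0)//= ltr_pdivrMr ?mul1r.
have := @gr_le _ _ Kkill Kkill_ge0 (s / t) (fun w => (pexp a w)%:E) z w r1.
have e0 v : (0 <= (pexp a v)%:E)%E by rewrite lee_fin pexp_ge0.
move=> /(_ e0); rewrite -EFinM => H.
have {}H : (gr Kkill z w * (pexp a w)%:E <= ((1 - s / t)^-1 * pexp a z)%:E)%E.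
  apply: H => v; apply: (le_trans (app_pexp_killed a v)).
  by rewrite -EFinM lee_fin ler_wpM2r ?pexp_ge0// ler_wpM2r ?invr_ge0 ?(ltW t0).
by rewrite mulrA EFinM lee_pdivlMr ?pexp_gt0.
Qed.

Lemma gr_domination_pexp a z w : phi a <= t -> phi0 a <= t -> (G z w < +oo)%E ->
  (G z w <= G w w * (pexp a z / pexp a w)%:E)%E.
Proof.
move=> pt p0t goo.
have := @domination _ _ Kt (fun w => (pexp a w)%:E) z w Kt_ge0.
have e0 v : (0 <= (pexp a v)%:E)%E by rewrite lee_fin pexp_ge0.
have sup v : (app Kt (fun w => (pexp a w)%:E) v <= (pexp a v)%:E)%E.
  rewrite app_pexp lee_fin ger_pMl ?pexp_gt0// ler_pdivrMr// mul1r /phiz.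
  by case: ifP.
move=> /(_ e0 sup goo (ltry _)).
by rewrite [(pexp a z / _)%:E]EFinM muleA lee_pdivlMr ?pexp_gt0.
Qed.

(** Off the axis the function [1 / pexp (al, b)] is strictly superharmonic for the
transposed kernel when [phi (al, b) < t].  So an inequality between two Green
functions on the axis extends to the half-plane, the error and the starting
point being absorbed in a multiple of that function. *)
Lemma gr_compare_from_axis z z' al b (c C : R) : 0 <= c -> 0 <= C ->
  (forall v w, (G v w < +oo)%E) ->
  (forall x : int, (G z (x, 0%N) <=
     c%:E * G z' (x, 0%N) + (C * expR (- (al * x%:~R)))%:E)%E) ->
  phi (al, b) < t ->
  exists2 C', 0 <= C' & forall w,
    (G z w <= c%:E * G z' w + (C' / pexp (al, b) w)%:E)%E.
Proof.
move=> c0 C0 Goo Hax pt; set a := (al, b).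
pose r := phi a / t; pose r0 := phi0 a / t.
have r1 : r < 1 by rewrite /r ltr_pdivrMr// mul1r.
have r00 : 0 <= r0 by rewrite divr_ge0 ?mgf_ge0// ltW.
pose C' := (C * r0 + pexp a z) / (1 - r).
have num0 : 0 <= C * r0 + pexp a z by rewrite addr_ge0 ?pexp_ge0// mulr_ge0.
have C'0 : 0 <= C' by rewrite divr_ge0// subr_ge0 ltW.
have C'E : C' * (1 - r) = C * r0 + pexp a z.
  by rewrite /C' divfK// subr_eq0 eq_sym lt_eqF.
exists C' => // w0.
pose u w := G z w.
pose h w := ((pexp a w)^-1)%:E : \bar R.
pose f w := (c%:E * G z' w + C'%:E * h w)%E.
pose g w := (dirac_fun R z w + app Kaxis u w)%E.
have u0 w : (0 <= u w)%E by apply: gr_ge0.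
have h0 w : (0 <= h w)%E by rewrite lee_fin invr_ge0 pexp_ge0.
have F0 w : (0 <= G z' w)%E by apply: gr_ge0.
have f0 w : (0 <= f w)%E by rewrite adde_ge0// mule_ge0.
have d0 w : (0 <= dirac_fun R z w)%E by exact: dirac_fun_ge0.
have g0 w : (0 <= g w)%E by rewrite adde_ge0// app_ge0.
rewrite [X in (_ + X)%E]EFinM.
apply: (@comparison _ _ Kinter Kinter_ge0 u f g w0) => //.
- move=> w; rewrite /u gr_last// app_transp_split// /g addeA.
  by rewrite lexx.
- move=> w; rewrite /f appD//; last 2 first.
  + by move=> v; rewrite mule_ge0.
  + by move=> v; rewrite mule_ge0.
  rewrite !appZ//.
  have gle : (g w <= c%:E * app Kaxis (fun v => G z' v) w +
      (C * r0 + pexp a z)%:E * h w)%E.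
    have d1 : (dirac_fun R z w <= (pexp a z)%:E * h w)%E.
      rewrite /dirac_fun; case: eqVneq => [->|_]; last by rewrite mule_ge0// lee_fin pexp_ge0.
      by rewrite /h -EFinM mulfV// pexp_neq0.
    have d2 : (app Kaxis u w <= c%:E * app Kaxis (fun v => G z' v) w +
        (C * r0)%:E * h w)%E.
      have : (app Kaxis u w <= app Kaxis (fun v => c%:E * G z' v + C%:E * h v) w)%E.
        apply: le_esum => -[x [|y]] _; last by rewrite /Kaxis/= !mul0e.
        apply: lee_wpmul2l => //; rewrite /u; apply: (le_trans (Hax x)).
        by rewrite -EFinM /h /pexp /= mulr0 addr0 expRN.
      rewrite appD//; last 2 first.
      + by move=> v; rewrite mule_ge0.
      + by move=> v; rewrite mule_ge0.
      rewrite !appZ// => /le_trans; apply; apply: leeD2l.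
      rewrite [(C * r0)%:E]EFinM -muleA; apply: lee_wpmul2l => //.
      apply: (le_trans (app_Kaxis_pexp a w)).
      by rewrite -EFinM.
    apply: (le_trans (leeD d1 d2)).
    by rewrite addeCA leeD2l// -!EFinM -EFinD lee_fin; nra.
  have Bh : (app Kinter h w <= r%:E * h w)%E by rewrite -EFinM app_Kinter_pexp.
  have Fs : (app Kaxis (fun v => G z' v) w + app Kinter (fun v => G z' v) w <= G z' w)%E.
    by rewrite -app_transp_split// [leRHS]gr_last// leeDr// dirac_fun_ge0.
  move: Fs Bh gle (F0 w).
  set X := app Kaxis (fun v => G z' v) w; set Y := app Kinter (fun v => G z' v) w.
  set H := app Kinter h w; set Z := G z' w.
  have X0 : (0 <= X)%E by apply: app_ge0.
  have Y0 : (0 <= Y)%E by apply: app_ge0.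
  move=> Fs Bh gle Z0.
  have C'0E : (0 <= C'%:E)%E by rewrite lee_fin.
  apply: (le_trans (leeD gle (leeD2l _ (lee_wpmul2l C'0E Bh)))).
  rewrite addeACA -ge0_muleDr//; apply: leeD; first exact: lee_wpmul2l.
  rewrite -!EFinM -EFinD lee_fin -C'E.
  by rewrite le_eqVlt; apply/orP; left; apply/eqP; ring.
- move=> e e0.
  have Goo' : (gr (transp Kt) w0 z < +oo)%E by rewrite gr_transp.
  have [n Hn] := iter_app_gr_small (fun v w => Kt_ge0 w v) Goo' e0.
  exists n; apply: le_trans Hn.
  have -> : u = fun w => gr (transp Kt) w z by apply/funext => w; rewrite gr_transp.
  apply: iter_app_leK => // [w|v w].
    by rewrite gr_transp// gr_ge0.
  by rewrite /Kinter /transp; case: ifP.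
Qed.

End Walk.

(** * The walk killed on the axis *)

Section Summability.
Variable R : realType.

Lemma esum_geom_int (k : R) : 0 < k ->
  (\S_ x (expR (- (k * `|x%:~R|)))%:E < +oo :> \bar R)%E.
Proof.
move=> k0; pose r := expR (- k).
have r1 : 0 <= r < 1 by rewrite expR_ge0 expR_lt1 oppr_lt0.
have e0 (x : int) : (0 <= (expR (- (k * `|x%:~R|)))%:E :> \bar R)%E.
  by rewrite lee_fin expR_ge0.
have le (e : nat -> int) : injective e -> (forall n, n%:R <= `|(e n)%:~R : R|) ->
  (\esum_(x in range e) (expR (- (k * `|x%:~R|)))%:E < +oo :> \bar R)%E.
  move=> ei en; rewrite esum_image; last by move=> x y _ _; exact: ei.
  apply: (@le_lt_trans _ _ (\S_ n ((r ^+ n)%:E : \bar R))%E); last first.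
    by rewrite geometric_esum// ltry.
  apply: le_esum => n _; rewrite lee_fin -expRM_natl ler_expR mulrN lerN2.
  by rewrite mulrC ler_wpM2l// ltW.
rewrite (esumID (range Posz))// !setTI lte_add_pinfty//.
  by apply: le => // [x y [->]//|n]; rewrite -pmulrn ger0_norm.
have -> : ~` range Posz = range Negz.
  apply/seteqP; split => [[n|n]|x] /=; first by case; exists n.
    by move=> _; exists n.
  by move=> [n _ <-] [m _].
apply: le => // [x y [->]//|n].
by rewrite NegzE mulrNz normrN -pmulrn ger0_norm// ler_nat.
Qed.

Lemma esum_geom_halfplane (k : R) : 0 < k ->
  (\S_ z (expR (- (k * (`|z.1%:~R| + z.2%:R))))%:E < +oo :> \bar R)%E.
Proof.
move=> k0; pose r := expR (- k).
have r1 : 0 <= r < 1 by rewrite expR_ge0 expR_lt1 oppr_lt0.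
pose F (x : int) (y : nat) : \bar R := ((expR (- (k * `|x%:~R|)))%:E * (r ^+ y)%:E)%E.
have F0 x y : (0 <= F x y)%E by rewrite mule_ge0 ?lee_fin ?expR_ge0 ?exprn_ge0 ?expR_ge0.
have -> : (\S_ z (expR (- (k * (`|z.1%:~R| + z.2%:R))))%:E = \S_ z F z.1 z.2 :> \bar R)%E.
  apply: eq_esumT => -[x y]; rewrite /F /= -EFinM; congr EFin.
  by rewrite /r -expRM_natl -expRD; congr expR; ring.
have := @esum_esum R _ _ setT (fun=> setT) F (fun i j _ _ => F0 i j).
have -> : [set: int] `*`` (fun=> [set: nat]) = setT by apply/seteqP; split.
move=> <-.
have FE x : (\S_ y F x y = ((1 - r)^-1)%:E * (expR (- (k * `|x%:~R|)))%:E)%E.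
  rewrite /F esum_scale ?lee_fin ?expR_ge0//.
    by rewrite geometric_esum// muleC.
  by move=> n; rewrite lee_fin exprn_ge0// expR_ge0.
rewrite (eq_esumT FE).
rewrite esum_scale; last 2 first.
- by rewrite lee_fin invr_ge0 subr_ge0; case/andP: r1 => _ /ltW.
- by move=> x; rewrite lee_fin expR_ge0.
have h : (\S_ x (expR (- (k * `|x%:~R|)))%:E : \bar R)%E \is a fin_num.
  rewrite ge0_fin_numE ?esum_geom_int//; apply: esum_ge0 => x _.
  by rewrite lee_fin expR_ge0.
by rewrite -(fineK h) -EFinM ltry.
Qed.

Lemma esum_const_infty (c : R) : 0 < c -> (\esum_(n in [set: nat]) c%:E = +oo :> \bar R)%E.
Proof.
move=> c0; have s0 : (0 <= \esum_(n in [set: nat]) c%:E :> \bar R)%E.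
  by apply: esum_ge0 => n _; rewrite lee_fin ltW.
have := @esum_natS R (fun=> c%:E) (fun=> ltW (c0 : (0 < c%:E)%E)).
case: (\esum_(n in [set: nat]) c%:E)%E s0 => [s| |]// _ [] /eqP.
by rewrite -subr_eq subrr eq_sym gt_eqF.
Qed.

End Summability.

Lemma off_cone_decay (R : realType) (d eta M kap m X V : R) :
  0 < d -> 0 < eta -> 0 <= M -> `|m| <= M -> 0 <= V -> 0 <= kap ->
  kap * (eta + M + 1) <= d * eta -> (m + eta) * V <= X ->
  kap * (`|X| + V) <= d * (X - m * V).
Proof.
move=> d0 eta0 M0 mM V0 k0 kd hX; set D := X - m * V.
have DV : eta * V <= D by rewrite /D mulrDl in hX *; lra.
have D0 : 0 <= D by apply: le_trans DV; rewrite mulr_ge0// ltW.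
have XD : `|X| <= D + M * V.
  have -> : X = D + m * V by rewrite /D subrK.
  apply: (le_trans (ler_normD _ _)); rewrite (ger0_norm D0) lerD2l.
  by rewrite normrM (ger0_norm V0) ler_wpM2r.
have h1 : eta * (`|X| + V) <= (eta + M + 1) * D.
  have := ler_wpM2l (ltW eta0) XD; have := ler_wpM2l M0 DV.
  move: DV; clear; nra.
have h2 := ler_wpM2l k0 h1; have h3 := ler_wpM2r D0 kd.
by rewrite -(ler_pM2l eta0); move: h2 h3; clear; nra.
Qed.

Lemma in_cone_norm (R : realType) (eta M mm mp X V : R) : `|mp| <= M -> `|mm| <= M -> 0 <= V ->
  (mm - eta) * V <= X -> X <= (mp + eta) * V -> `|X| <= (M + eta) * V.
Proof.
rewrite !ler_norml => /andP[_ p1] /andP[m1 _] V0 hL hR.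
have h1 := ler_wpM2r V0 p1; have h2 := ler_wpM2r V0 m1.
by apply/andP; split; move: hL hR h1 h2; clear; lra.
Qed.

Lemma low_cone_exponent (R : realType) (d eta M kap mp X V Y : R) :
  0 < d -> 0 < eta -> 0 <= M -> `|mp| <= M -> 0 <= kap -> 0 <= V -> V <= Y ->
  `|X| <= (M + eta) * V ->
  - (d * (X - mp * V)) <=
    d * (2 * M + eta) * Y + kap * (M + eta + 1) * Y - kap * (`|X| + V).
Proof.
move=> d0 eta0 M0 mM k0 V0 VY XV.
have h1 : kap * (`|X| + V) <= kap * (M + eta + 1) * Y.
  rewrite -mulrA ler_wpM2l//.
  apply: (@le_trans _ _ ((M + eta + 1) * V)); first by move: XV; clear; lra.
  by rewrite ler_wpM2l//; move: M0 eta0; clear; lra.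
have h2 : - (X - mp * V) <= (2 * M + eta) * V.
  move: XV mM; rewrite !ler_norml => /andP[u1 _] /andP[_ u2].
  by have := ler_wpM2r V0 u2; move: u1; clear; lra.
have h3 : (2 * M + eta) * V <= (2 * M + eta) * Y.
  by rewrite ler_wpM2l//; move: M0 eta0; clear; lra.
have := ler_wpM2l (ltW d0) (le_trans h2 h3).
by move: h1; clear; lra.
Qed.

Section WalkTools.
Variable R : realType.
Variable W : halfplane_walk R.
Variable t : R.
Hypothesis t0 : 0 < t.
Local Notation E := (int * nat)%type.
Local Notation mu := (step_mass W).
Local Notation mu0 := (axis_mass W).
Local Notation phi := (mgf mu).
Local Notation phi0 := (mgf mu0).
Local Notation G := (gr (Kt W t)).
Local Notation Gk := (gr (Kkill W t)).
Let mu_ge0 := step_mass_ge0 W.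
Let mu0_ge0 := axis_mass_ge0 W.
Let K0 := Kt_ge0 W t0.
Let Kkill0 := Kkill_ge0 W t0.
Hint Resolve step_mass_ge0 axis_mass_ge0 K0 Kkill0 : core.

Definition hshift (k : int) (z : E) : E := (z.1 + k, z.2).
Definition pshift (s : int * nat) (z : E) : E := (z.1 + s.1, (z.2 + s.2)%N).

Lemma hshiftK k : cancel (hshift k) (hshift (- k)).
Proof. by move=> [x y]; rewrite /hshift /= addrK. Qed.

Lemma hshiftNK k : cancel (hshift (- k)) (hshift k).
Proof. by move=> [x y]; rewrite /hshift /= addrNK. Qed.

Lemma gr_hshift k z w : G (hshift k z) (hshift k w) = G z w.
Proof.
apply: eq_esumT => n; apply/esym/(@nstep_bij _ _ _ _ _ _ (hshift (- k))) => //.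
- exact: hshiftK.
- exact: hshiftNK.
- move=> x y; rewrite !KtE /jump_mass /jump /hshift /=.
  by have -> : y.1 + k - (x.1 + k) = y.1 - x.1 by ring.
Qed.

(** Moving a killed path to the right or upwards keeps it off the axis. *)
Lemma gr_killed_pshift s z w : (Gk z w <= Gk (pshift s z) (pshift s w))%E.
Proof.
apply: le_esum => n _; apply: nstep_inj_le => //.
- by case: s => i j [x y] [x' y'] [] /addIr -> /addIn ->.
- move=> [x y] [x' y']; rewrite {1}/Kkill /=; case: ifP => [/andP[y0 y'0]|_]; last exact: Kkill0.
  rewrite /Kkill /= !ltn_addr// !KtE /jump_mass /jump /= !gtn_eqF ?ltn_addr//.
  rewrite !PoszD; have -> : x' + s.1 - (x + s.1) = x' - x by ring.
  by have -> : y'%:Z + s.2%:Z - (y%:Z + s.2%:Z) = y'%:Z - y%:Z by ring.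
Qed.

Lemma gr_gt0 z w : (0 < G z w)%E.
Proof.
have [n npos] := walk_irr W z w.
have npos' : (0 < nstep (Kt W t) n z w)%E.
  rewrite lt_neqAle nstep_ge0// andbT eq_sym.
  move: npos; rewrite lt_neqAle => /andP[+ _]; rewrite eq_sym; apply: contra.
  suff -> : nstep (Kt W t) n z w =
      ((t ^- n)%:E * nstep (reflected_kernel mu mu0) n z w)%E.
    by rewrite mule_eq0 eqe invr_eq0 expf_eq0 (gt_eqF t0) andbF.
  elim: n z => [|n IH] z /=; first by rewrite invr1 mul1e.
  have P0 x' w' : (0 <= reflected_kernel mu mu0 x' w')%E.
    by rewrite lee_fin; case: ifP.
  rewrite -esum_scale//; last 2 first.
  - by rewrite lee_fin invr_ge0 exprn_ge0// ltW.
  - by move=> v; rewrite mule_ge0//; exact: nstep_ge0.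
  apply: eq_esumT => v; rewrite IH /Kt exprS invfM EFinM.
  rewrite -!muleA; congr (_ * _)%E; rewrite !muleA; congr (_ * _)%E.
  by rewrite muleC.
apply: lt_le_trans npos' _.
apply: (@esum_ge_term _ _ (fun n => nstep (Kt W t) n z w)) => m.
exact: nstep_ge0.
Qed.

Lemma gr_killed_le z w : (Gk z w <= G z w)%E.
Proof. by apply: gr_leK => // x y; exact: Kkill_le. Qed.

(** The difference of the two exponentials vanishes on the axis, hence is
subharmonic for the killed kernel, and the terms of its potential do not
decrease. *)
Lemma killed_sum_diverges al b0 b1 : phi (al, b1) = t -> phi (al, b0) <= t -> b0 < b1 ->
  (\S_ w (Gk (0%R, 1%N) w * (pexp (al, b1) w)%:E) = +oo)%E.
Proof.
move=> p1 p0 b01.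
pose f w := (pexp (al, b1) w - pexp (al, b0) w)%:E.
have f0 w : (0 <= f w)%E.
  rewrite lee_fin subr_ge0 ler_expR lerD2l ler_wpM2r//; exact: ltW.
have fax x : f (x, 0%N) = 0%E by rewrite /f /pexp /= !mulr0 subrr.
have sub z : (f z <= app (Kkill W t) f z)%E.
  case: z => x [|y]; first by rewrite fax app_ge0.
  set z := (x, y.+1).
  have -> : app (Kkill W t) f z = app (Kt W t) f z.
    apply: eq_esumT => -[x' [|y']]; first by rewrite fax !mule0.
    by rewrite /Kkill.
  have : (app (Kt W t) f z + app (Kt W t) (fun w => (pexp (al, b0) w)%:E) z =
    app (Kt W t) (fun w => (pexp (al, b1) w)%:E) z)%E.
    rewrite -appD//; last by move=> w; rewrite lee_fin pexp_ge0.
    by apply: eq_app => w; rewrite -EFinD subrK.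
  rewrite !app_pexp// /phiz /= p1 divff ?gt_eqF// mul1r.
  have : (0 <= app (Kt W t) f z)%E by apply: app_ge0.
  case: (app (Kt W t) f z) => [r| |]// _ [] H.
  rewrite lee_fin /f.
  have : phi (al, b0) / t * pexp (al, b0) z <= pexp (al, b0) z.
    by rewrite ger_pMl ?pexp_gt0// ler_pdivrMr// mul1r.
  by rewrite -H; lra.
have it n z : (f z <= iter n (app (Kkill W t)) f z)%E.
  elim: n z => // n IH z /=; apply: (le_trans (sub z)); exact: app_le.
apply/eqP; rewrite -leye_eq.
have f1 : 0 < fine (f (0%R, 1%N)).
  by rewrite /f /pexp /= subr_gt0 ltr_expR ltrD2l !mulr1.
rewrite -(esum_const_infty f1).
apply: le_trans (_ : (\S_ w (Gk (0%R, 1%N) w * f w) <= _)%E).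
  by rewrite gr_app//; apply: le_esum => n _; exact: it.
apply: le_esum => w _; apply: lee_wpmul2l; first exact: gr_ge0.
by rewrite lee_fin gerBl pexp_ge0.
Qed.

(** Tilting by [(d, - d * mp)] and [(- d, d * mm)] shows that the terms of the
diverging sum decay exponentially away from the cone between the slopes [mm]
and [mp].  If they also did inside the cone, the sum would converge. *)
Lemma killed_localization al b0 b1 mm mp d eta eps (Y : nat) :
  phi (al, b1) = t -> phi (al, b0) <= t -> b0 < b1 ->
  0 < d -> 0 < eta -> 0 < eps ->
  phi (al + d, b1 - d * mp) < t -> phi (al - d, b1 + d * mm) < t ->
  exists x : int, exists y : nat, [/\ (Y <= y)%N,
    (mm - eta) * y%:R <= x%:~R, x%:~R <= (mp + eta) * y%:R &
    ((expR (- (eps * y%:R)) / pexp (al, b1) (x, y))%:E <= Gk (0%R, 1%N) (x, y))%E].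
Proof.
move=> p1 p0 b01 d0 eta0 eps0 pp pm; apply: contrapT => H.
have cone (x : int) (y : nat) : (Y <= y)%N ->
    (mm - eta) * y%:R <= x%:~R -> x%:~R <= (mp + eta) * y%:R ->
    (Gk (0%R, 1%N) (x, y) * (pexp (al, b1) (x, y))%:E <= (expR (- (eps * y%:R)))%:E)%E.
  move=> yY h1 h2; rewrite -lee_pdivlMr ?pexp_gt0// -EFinM ltW// ltNge.
  by apply/negP => h3; apply: H; exists x, y.
pose z1 : E := (0%R, 1%N).
pose Cp := (1 - phi (al + d, b1 - d * mp) / t)^-1 * pexp (al + d, b1 - d * mp) z1.
pose Cm := (1 - phi (al - d, b1 + d * mm) / t)^-1 * pexp (al - d, b1 + d * mm) z1.
have inv0 s : s < t -> 0 <= (1 - s / t)^-1.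
  by move=> st; rewrite invr_ge0 subr_ge0 ler_pdivrMr// mul1r ltW.
have Cp0 : 0 <= Cp by rewrite mulr_ge0 ?pexp_ge0// inv0.
have Cm0 : 0 <= Cm by rewrite mulr_ge0 ?pexp_ge0// inv0.
have right (x : int) (y : nat) : (Gk z1 (x, y) * (pexp (al, b1) (x, y))%:E <=
    (Cp * expR (- (d * (x%:~R - mp * y%:R))))%:E)%E.
  apply: (@le_trans _ _ ((Cp / pexp (al + d, b1 - d * mp) (x, y))%:E *
     (pexp (al, b1) (x, y))%:E)%E).
    apply: lee_wpmul2r; first by rewrite lee_fin pexp_ge0.
    by rewrite -mulrA; exact: gr_killed_bound.
  rewrite -EFinM lee_fin -mulrA ler_wpM2l// /pexp -expRN -expRD ler_expR /=; lra.
have left (x : int) (y : nat) : (Gk z1 (x, y) * (pexp (al, b1) (x, y))%:E <=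
    (Cm * expR (d * (x%:~R - mm * y%:R)))%:E)%E.
  apply: (@le_trans _ _ ((Cm / pexp (al - d, b1 + d * mm) (x, y))%:E *
     (pexp (al, b1) (x, y))%:E)%E).
    apply: lee_wpmul2r; first by rewrite lee_fin pexp_ge0.
    by rewrite -mulrA; exact: gr_killed_bound.
  rewrite -EFinM lee_fin -mulrA ler_wpM2l// /pexp -expRN -expRD ler_expR /=; lra.
pose M := `|mp| + `|mm|.
have M0 : 0 <= M by rewrite addr_ge0.
have Mp : `|mp| <= M by rewrite lerDl.
have Mm : `|mm| <= M by rewrite lerDr.
pose kap := Num.min (d * eta / (eta + M + 1)) (eps / (M + eta + 1)).
have D1 : 0 < eta + M + 1 by lra.
have D2 : 0 < M + eta + 1 by lra.
have kap0 : 0 < kap by rewrite lt_min !divr_gt0// mulr_gt0.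
have kap1 : kap * (eta + M + 1) <= d * eta by rewrite -ler_pdivlMr// ge_min lexx.
have kap2 : kap * (M + eta + 1) <= eps by rewrite -ler_pdivlMr// ge_min lexx orbT.
pose Q := d * (2 * M + eta) * Y%:R + kap * (M + eta + 1) * Y%:R.
pose C := Cp + Cm + 1 + Cp * expR Q.
have CQ : 0 <= Cp * expR Q by rewrite mulr_ge0 ?expR_ge0.
have kap_ge0 : 0 <= kap by exact: ltW.
have C_ge k : 0 <= k -> k <= Cp + Cm + 1 + Cp * expR Q -> k <= C by [].
have CpC : Cp <= C by apply: C_ge => //; move: Cm0 CQ; lra.
have CmC : Cm <= C by apply: C_ge => //; move: Cp0 CQ; lra.
have C1 : 1 <= C by apply: C_ge => //; move: Cp0 Cm0 CQ; lra.
have CpQC : Cp * expR Q <= C by apply: C_ge => //; move: Cp0 Cm0; lra.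
have bound (x : int) (y : nat) : (Gk z1 (x, y) * (pexp (al, b1) (x, y))%:E <=
    (C * expR (- (kap * (`|x%:~R| + y%:R))))%:E)%E.
  have V0 : 0 <= y%:R :> R by [].
  have [hR|hR] := ltP ((mp + eta) * y%:R) (x%:~R).
    apply: (le_trans (right x y)); rewrite lee_fin.
    apply: ler_pM => //; rewrite ?expR_ge0// ler_expR lerN2.
    exact: (off_cone_decay d0 eta0 M0 Mp V0 kap_ge0 kap1 (ltW hR)).
  have [hL|hL] := ltP (x%:~R) ((mm - eta) * y%:R).
    apply: (le_trans (left x y)); rewrite lee_fin.
    apply: ler_pM => //; rewrite ?expR_ge0// ler_expR.
    have := @off_cone_decay R d eta M kap (- mm) (- x%:~R) y%:R d0 eta0 M0.
    rewrite !normrN => /(_ Mm V0 kap_ge0 kap1) h.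
    have hL' : (- mm + eta) * y%:R <= - x%:~R by move: hL; lra.
    by have := h hL'; lra.
  have XV := in_cone_norm Mp Mm V0 hL hR.
  have [yY|yY] := leqP Y y.
    apply: (le_trans (cone x y yY hL hR)); rewrite lee_fin -[leLHS]mul1r.
    apply: ler_pM; rewrite ?expR_ge0// ler_expR lerN2.
    apply: le_trans (_ : kap * (M + eta + 1) * y%:R <= _); last exact: ler_wpM2r.
    by rewrite -mulrA ler_wpM2l//; move: XV; lra.
  have VY : y%:R <= Y%:R :> R by rewrite ler_nat ltnW.
  apply: (le_trans (right x y)); rewrite lee_fin.
  apply: le_trans (_ : Cp * expR Q * expR (- (kap * (`|x%:~R| + y%:R))) <= _); last first.
    by apply: ler_wpM2r => //; exact: expR_ge0.
  rewrite -mulrA ler_wpM2l// -expRD ler_expR.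
  exact: (low_cone_exponent d0 eta0 M0 Mp kap_ge0 V0 VY XV).
have : (\S_ w (Gk z1 w * (pexp (al, b1) w)%:E) <=
    C%:E * \S_ w (expR (- (kap * (`|w.1%:~R| + w.2%:R))))%:E)%E.
  rewrite -esum_scale ?lee_fin; last 2 first.
  - by rewrite /C; lra.
  - by move=> w; rewrite lee_fin expR_ge0.
  by apply: le_esum => -[x y] _; rewrite -EFinM.
rewrite (killed_sum_diverges p1 p0 b01).
have := esum_geom_halfplane kap0.
set S := (\S_ w _)%E => Soo.
have Sfin : S \is a fin_num.
  by rewrite ge0_fin_numE//; apply: esum_ge0 => w _; rewrite lee_fin expR_ge0.
by rewrite -(fineK Sfin) -EFinM leNgt ltry.
Qed.

End WalkTools.

(** * Pointwise cluster points, potentials and dominated convergence *)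

Section ClusterPoint.
Variables (R : realType) (T : choiceType).

(** Tychonoff's theorem, through an ultrafilter.  The conclusion is stated by
approximation on finite sets, which is how cluster points are used. *)
Lemma pointwise_cluster (nu : nat -> T -> R) (M : T -> R) :
  (forall n z, 0 <= nu n z <= M z) ->
  exists h : T -> R, forall (F : set T) e N, finite_set F -> 0 < e ->
    exists2 n, (N <= n)%N & forall z, F z -> `|nu n z - h z| <= e.
Proof.
move=> nuM.
have [U [UU leU]] := @ultraFilterLemma _ (@nbhs nat _ \oo) _.
pose A z := [set r | U [set n | r <= nu n z]].
have A0 z : A z 0.
  by apply: filterS (filterT (F := U)) => n _; case/andP: (nuM n z).
have ubA z : ubound (A z) (M z).
  move=> r /filter_ex[n] /= rn; apply: le_trans rn _.
  by case/andP: (nuM n z).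
have hs z : has_sup (A z) by split; [exists 0|exists (M z)].
exists (fun z => sup (A z)) => F e N finF e0.
have close z : U [set n | `|nu n z - sup (A z)| <= e].
  (* The limit along U is the supremum of the r that are eventually below. *)
  have [r Ar rlt] := sup_adherent e0 (hs z).
  have B : U [set n | nu n z < sup (A z) + e].
    have [//|] := in_ultra_setVsetC [set n | nu n z < sup (A z) + e] UU.
    move=> C; suff : sup (A z) + e <= sup (A z) by lra.
    apply: ub_le_sup; first by exists (M z).
    by apply: filterS C => n /=; rewrite leNgt => /negP.
  apply: filterS2 Ar B => n /= h1 h2; rewrite ler_norml; apply/andP; split; lra.
have all : U [set n | forall z, F z -> `|nu n z - sup (A z)| <= e].
  have [X XF] := (finite_seqP F).1 finF; rewrite XF.
  elim: X {finF XF} => [|x X IH].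
    by apply: filterS (filterT (F := U)) => n _ z.
  apply: filterS2 (close x) IH => n /= h1 h2 z; rewrite inE => /orP[/eqP->//|].
  exact: h2.
have UN : U [set n | (N <= n)%N] by apply: leU; exact: nbhs_infty_ge.
have [n [h1 h2]] := filter_ex (filterI UN all).
by exists n.
Qed.

End ClusterPoint.

Section Potential.
Variables (R : realType) (T : choiceType).
Local Open Scope ereal_scope.

(** A function that decreases to zero under iteration is at most the potential
of its defect. *)
Lemma potential_le (K : T -> T -> \bar R) (f c : T -> \bar R) z :
  (forall z w, 0 <= K z w) -> (forall w, 0 <= f w) -> (forall w, 0 <= c w) ->
  (forall w, f w <= c w + app K f w) ->
  (forall e : R, (0 < e)%R -> exists n, iter n (app K) f z <= e%:E) ->
  f z <= \S_ w (gr K z w * c w).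
Proof.
move=> K0 f0 c0 le small.
have S0 w : 0 <= \S_ v (gr K w v * c v).
  by apply: esum_ge0 => v _; rewrite mule_ge0// gr_ge0.
apply: (@comparison _ _ K K0 f (fun z => \S_ w (gr K z w * c w)) c z) => // w.
rewrite [leRHS]gr_app// esum_natS; last by move=> n; exact: iter_app_ge0.
apply: leeD2l.
have -> : (fun z => \S_ w (gr K z w * c w)) = fun z => \S_ n iter n (app K) c z.
  by apply/funext => v; rewrite gr_app.
by rewrite app_esum// => n v; exact: iter_app_ge0.
Qed.

(** Dominated convergence in finite form: closeness on one finite set controls
the image under the kernel. *)
Lemma app_dominated (K : T -> T -> \bar R) (M : T -> R) z (k e : R) :
  (forall z w, 0 <= K z w) -> (forall w, 0 <= M w)%R ->
  app K (fun w => (M w)%:E) z < +oo -> app K (fun=> 1) z <= k%:E -> (0 < e)%R ->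
  exists2 F : set T, finite_set F & forall (f g : T -> R) (d : R), (0 <= d)%R ->
    (forall w, 0 <= f w <= M w)%R -> (forall w, 0 <= g w)%R ->
    (forall w, F w -> f w <= g w + d)%R ->
    app K (fun w => (f w)%:E) z <= app K (fun w => (g w)%:E) z + (d * k + e)%:E.
Proof.
move=> K0 M0 Moo K1 e0.
have km0 w : 0 <= K z w * (M w)%:E by rewrite mule_ge0// lee_fin.
have [F finF tail] := esum_finite_approx km0 Moo e0.
exists F => // f g d d0 fM g0 fg.
have f0 w : (0 <= f w)%R by case/andP: (fM w).
have kf0 w : 0 <= K z w * (f w)%:E by rewrite mule_ge0// lee_fin.
have kg0 w : 0 <= K z w * (g w + d)%:E by rewrite mule_ge0// lee_fin addr_ge0.
rewrite {1}/app (esumID F)// !setTI.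
apply: (@le_trans _ _ ((app K (fun w => (g w + d)%:E) z) + e%:E)).
  apply: leeD.
    apply: (@le_trans _ _ (\esum_(i in F) (K z i * (g i + d)%:E))).
      by apply: le_esum => i Fi; apply: lee_wpmul2l => //; rewrite lee_fin fg.
    rewrite /app [leRHS](esumID F)// !setTI leeDl//.
    by apply: esum_ge0 => i _.
  apply: le_trans tail; apply: le_esum => i _.
  by apply: lee_wpmul2l => //; rewrite lee_fin; case/andP: (fM i).
have -> : app K (fun w => (g w + d)%:E) z =
    app K (fun w => (g w)%:E) z + d%:E * app K (fun=> 1) z.
  rewrite -appZ ?lee_fin// -appD//.
  by apply: eq_app => w; rewrite mule1 EFinD.
  by move=> w; rewrite mule1 lee_fin.
rewrite EFinD -addeA; apply: leeD2l; apply: leeD2r.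
by rewrite EFinM; apply: lee_wpmul2l => //; rewrite lee_fin.
Qed.

End Potential.

(** * Two-sided bounds for the Green function on the axis *)

Section Transient.
Variable R : realType.
Variable W : halfplane_walk R.
Variable t : R.
Hypothesis t0 : 0 < t.
Local Notation E := (int * nat)%type.
Local Notation mu := (step_mass W).
Local Notation mu0 := (axis_mass W).
Local Notation phi := (mgf mu).
Local Notation phi0 := (mgf mu0).
Local Notation K := (Kt W t).
Local Notation G := (gr (Kt W t)).
Let K0 := Kt_ge0 W t0.
Hint Resolve step_mass_ge0 axis_mass_ge0 K0 : core.

Definition fgreen z w := fine (G z w).
Local Notation g := fgreen.

Section LensPoint.
Variables als bs : R.
Hypothesis phi_in : phi (als, bs) < t.
Hypothesis phi0_in : phi0 (als, bs) < t.

Lemma gr_bound_inner : exists2 C, 0 < C & forall z w,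
  (G z w <= (C * (pexp (als, bs) z / pexp (als, bs) w))%:E)%E.
Proof.
pose s := Num.max (phi (als, bs)) (phi0 (als, bs)).
have st : s < t by rewrite gt_max phi_in phi0_in.
exists (1 - s / t)^-1; first by rewrite invr_gt0 subr_gt0 ltr_pdivrMr// mul1r.
move=> z w; apply: (@gr_bound R W t t0 (als, bs) s) => //;
  by rewrite le_max lexx ?orbT.
Qed.

Lemma gr_finite_inner z w : (G z w < +oo)%E.
Proof.
have [C _ H] := gr_bound_inner; exact: le_lt_trans (H z w) (ltry _).
Qed.

Lemma gr_diag_bounded : exists2 C, 0 < C & forall z, (G z z <= C%:E)%E.
Proof.
have [C C0 H] := gr_bound_inner; exists C => // z.
by have := H z z; rewrite divff ?mulr1// pexp_neq0.
Qed.

End LensPoint.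

Hypothesis Goo : forall z w, (G z w < +oo)%E.

Lemma fgreenE z w : G z w = (g z w)%:E.
Proof. by rewrite /fgreen fineK// ge0_fin_numE ?Goo// gr_ge0. Qed.

Lemma fgreen_gt0 z w : 0 < g z w.
Proof. by rewrite -lte_fin -fgreenE; exact: gr_gt0. Qed.

Lemma fgreen_ge0 z w : 0 <= g z w. Proof. exact/ltW/fgreen_gt0. Qed.

Lemma fgreen_mul x y z : g x y * g y z <= g y y * g x z.
Proof.
have := @gr_mul R E K x y z K0 (Goo _ _) (Goo _ _).
by rewrite !fgreenE -!EFinM lee_fin.
Qed.

Lemma fgreen_hshift k z w : g (hshift k z) (hshift k w) = g z w.
Proof. by rewrite /fgreen gr_hshift. Qed.

End Transient.

(** [(al, b)] is the right end of the lens at level [t], [(als, bs)] an interior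
point of the lens to its left, and [(al, b2)] a point above the corner, where
[phi] is again below [t]. *)
Record lens_corner (R : realType) (W : halfplane_walk R) (t al b als bs b2 : R) : Prop :=
LensCorner {
  corner_phi : mgf (step_mass W) (al, b) = t;
  corner_phi0 : mgf (axis_mass W) (al, b) = t;
  inner_phi : mgf (step_mass W) (als, bs) < t;
  inner_phi0 : mgf (axis_mass W) (als, bs) < t;
  inner_lt : als < al;
  above_lt : b < b2;
  above_phi : mgf (step_mass W) (al, b2) < t }.

Section Renewal.
Variable R : realType.
Variable W : halfplane_walk R.
Variable t : R.
Hypothesis t0 : 0 < t.
Local Notation E := (int * nat)%type.
Local Notation mu := (step_mass W).
Local Notation mu0 := (axis_mass W).
Local Notation phi := (mgf mu).
Local Notation phi0 := (mgf mu0).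
Local Notation K := (Kt W t).
Local Notation G := (gr (Kt W t)).
Let K0 := Kt_ge0 W t0.
Hint Resolve step_mass_ge0 axis_mass_ge0 K0 : core.

Local Notation g := (fgreen W t).
Variables al b als bs b2 : R.
Hypothesis LC : lens_corner W t al b als bs b2.
Let phi_corner := corner_phi LC.
Let phi0_corner := corner_phi0 LC.
Let phi_in := inner_phi LC.
Let phi0_in := inner_phi0 LC.
Let als_lt := inner_lt LC.
Let b_lt := above_lt LC.
Let phi_b2 := above_phi LC.
Local Notation a := (al, b).
Local Notation org := ((0%R, 0%N) : E).

Lemma corner_gr_finite z w : (G z w < +oo)%E.
Proof. exact: (gr_finite_inner t0 phi_in phi0_in). Qed.
Let fgreenE := fgreenE t0 corner_gr_finite.
Let fgreen_gt0 := fgreen_gt0 t0 corner_gr_finite.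
Let fgreen_ge0 := fgreen_ge0 t0 corner_gr_finite.
Let gr_diag_bounded := gr_diag_bounded t0 phi_in phi0_in.

Lemma pexp_pair x y : pexp a (x, y) = expR (al * x%:~R) * expR (b * y%:R).
Proof. by rewrite /pexp expRD. Qed.

Lemma axis_green_upper : exists2 C, 0 < C & forall z (x : int),
  g z (x, 0%N) <= C * pexp a z * expR (- (al * x%:~R)).
Proof.
have [C C0 H] := gr_diag_bounded; exists C => // z x.
have := @gr_domination_pexp R W t t0 a z (x, 0%N).
rewrite phi_corner phi0_corner lexx => /(_ isT isT (corner_gr_finite _ _)) h.
rewrite -lee_fin -fgreenE; apply: (le_trans h).
have -> : (C * pexp a z * expR (- (al * x%:~R)))%:E =
    (C%:E * (pexp a z / pexp a (x, 0%N))%:E)%E.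
  by rewrite -EFinM pexp_pair mulr0 expR0 mulr1 expRN mulrA.
by apply: lee_wpmul2r => //; rewrite lee_fin divr_ge0 ?pexp_ge0.
Qed.

Lemma green_upper : exists2 C, 0 < C & forall w, (G org w <= (C / pexp (al, b2) w)%:E)%E.
Proof.
have [C C0 H] := axis_green_upper.
have := @gr_compare_from_axis R W t t0 org org al b2 0 C (lexx _) (ltW C0) corner_gr_finite.
have Hx (x : int) : (G org (x, 0%N) <=
    0%:E * G org (x, 0%N) + (C * expR (- (al * x%:~R)))%:E)%E.
  rewrite mul0e add0e fgreenE lee_fin; have := H org x.
  by rewrite /fgreen /pexp /= !mulr0 addr0 expR0 mulr1.
move=> /(_ Hx phi_b2)[C' C'0 H']; exists (C' + 1); first by lra.
move=> w; apply: (le_trans (H' w)); rewrite mul0e add0e lee_fin.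
by rewrite ler_wpM2r ?invr_ge0 ?pexp_ge0//; lra.
Qed.

(** A flux argument.  The function [f = min (pexp a, pexp astar)], rescaled to
switch near abscissa [0], is superharmonic and is the potential of its
defect.  The defect is of order [pexp a] near the vertical line through [0]
and decays exponentially on both sides of it, while the Green function decays
upwards faster than [1 / pexp a] by the choice of [b2].  Hence a fixed finite
set carries half of the potential, whatever the starting point on the left,
and from this set the walk reaches [org] with positive weight. *)
Lemma axis_green_lower : exists2 c, 0 < c & forall n : nat,
  c * expR (- (al * n%:R)) <= g org (n%:Z, 0%N).
Proof.
pose A := al - als; pose B := bs - b.
have A0 : 0 < A by rewrite subr_gt0.
pose U (z : E) := - A * z.1%:~R + B * z.2%:R : R.
pose f (z : E) := pexp a z * Num.min 1 (expR (U z)).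
have exU z : pexp a z * expR (U z) = pexp (als, bs) z.
  by rewrite /pexp -expRD; congr expR; rewrite /U /A /B /=; ring.
(* pexp a' is pexp a divided by the ratio of pexp (als, bs) to pexp a. *)
pose a' : R * R := (2 * al - als, 2 * b - bs).
have exU' z : pexp a z * expR (- U z) = pexp a' z.
  by rewrite /pexp -expRD; congr expR; rewrite /U /A /B /=; ring.
have f0 z : 0 <= f z.
  by rewrite mulr_ge0 ?pexp_ge0// le_min ler01 expR_ge0.
have fle1 z : f z <= pexp a z.
  by rewrite -[leRHS]mulr1 ler_wpM2l ?pexp_ge0// ge_min lexx.
have fle2 z : f z <= pexp (als, bs) z.
  by rewrite -exU ler_wpM2l ?pexp_ge0// ge_min lexx orbT.
pose fE z := (f z)%:E.
have fE0 z : (0 <= fE z)%E by rewrite lee_fin.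
have Kea z : app K (fun w => (pexp a w)%:E) z = (pexp a z)%:E.
  by rewrite app_pexp// /phiz phi_corner phi0_corner if_same divff ?mul1r// gt_eqF.
pose s := Num.max (phi (als, bs)) (phi0 (als, bs)).
have st : s < t by rewrite gt_max phi_in phi0_in.
have s0 : 0 <= s by rewrite le_max mgf_ge0//; exact: step_mass_fin.
have phizs z : phiz W z (als, bs) <= s.
  by rewrite /phiz; case: ifP => _; rewrite le_max lexx ?orbT.
have st1 : 0 <= s / t < 1 by rewrite divr_ge0 ?(ltW t0)//= ltr_pdivrMr// mul1r.
have Kes z : (app K (fun w => (pexp (als, bs) w)%:E) z <= (s / t)%:E * (pexp (als, bs) z)%:E)%E.
  by rewrite app_pexp// -EFinM lee_fin ler_wpM2r ?pexp_ge0// ler_wpM2r// invr_ge0 ltW.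
have Kf z : (app K fE z <= fE z)%E.
  have h1 : (app K fE z <= (pexp a z)%:E)%E.
    by rewrite -Kea; apply: app_le => // w; rewrite lee_fin.
  have h2 : (app K fE z <= (pexp (als, bs) z)%:E)%E.
    apply: le_trans (_ : app K (fun w => (pexp (als, bs) w)%:E) z <= _)%E.
      by apply: app_le => // w; rewrite lee_fin.
    apply: le_trans (Kes z) _; rewrite -EFinM lee_fin ger_pMl ?pexp_gt0//.
    by case/andP: st1 => _ /ltW.
  rewrite /fE /f; case: (leP 1 (expR (U z))) => _; first by rewrite mulr1.
  by rewrite exU.
have Kf0 z : (0 <= app K fE z)%E by exact: app_ge0.
have Kffin z : app K fE z \is a fin_num.
  by rewrite ge0_fin_numE//; apply: le_lt_trans (Kf z) (ltry _).
pose c z := f z - fine (app K fE z).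
have c0 z : 0 <= c z.
  by rewrite subr_ge0 -lee_fin fineK.
have cf z : fE z = ((c z)%:E + app K fE z)%E.
  by rewrite -(fineK (Kffin z)) -EFinD subrK.
have cle1 z : c z <= pexp a z.
  by apply: le_trans (fle1 z); rewrite gerBl fine_ge0.
have cle2 z : c z <= pexp (als, bs) z.
  by apply: le_trans (fle2 z); rewrite gerBl fine_ge0.
pose C1 := Num.max (phi a') (phi0 a') / t.
have C10 : 0 <= C1.
  by rewrite divr_ge0 ?(ltW t0)// le_max mgf_ge0//; exact: step_mass_fin.
have cle3 z : c z <= C1 * pexp a' z.
  have ea w : ((pexp a w)%:E <= fE w + (pexp a' w)%:E)%E.
    rewrite -EFinD lee_fin /f -exU'.
    have h1 := pexp_ge0 a w; have h2 : 0 <= pexp a w * expR (- U w).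
      by rewrite mulr_ge0 ?expR_ge0.
    have [h|h] := leP 1 (expR (U w)); first by rewrite mulr1; lra.
    have : 1 <= expR (- U w).
      by move: h; rewrite -expR0 ltr_expR ler_expR oppr_ge0 => /ltW.
    have h3 : 0 <= pexp a w * expR (U w) by rewrite mulr_ge0 ?expR_ge0.
    by move=> /(ler_wpM2l h1); rewrite mulr1; lra.
  have : ((pexp a z)%:E <= app K fE z + (C1 * pexp a' z)%:E)%E.
    rewrite -{1}Kea; apply: (le_trans (app_le K0 ea z)).
    rewrite appD//; last by move=> w; rewrite lee_fin pexp_ge0.
    apply: leeD2l; rewrite app_pexp// lee_fin ler_wpM2r ?pexp_ge0//.
    rewrite /C1 ler_wpM2r ?invr_ge0 ?(ltW t0)// /phiz.
    by case: ifP => _; rewrite le_max lexx ?orbT.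
  rewrite -(fineK (Kffin z)) -EFinD lee_fin => h.
  have := fle1 z; rewrite /c; lra.
pose D := b2 - b.
have D0 : 0 < D by rewrite subr_gt0.
(* A small power of the window profile, so that its growth in the height is
   beaten by the gap D. *)
pose theta := Num.min 1 (D / (2 * (`|B| + 1))).
have B0 := normr_ge0 B.
have B1 : 0 < 2 * (`|B| + 1) by lra.
have th0 : 0 < theta by rewrite lt_min ltr01 divr_gt0.
have th1 : theta <= 1 by rewrite ge_min lexx.
have th2 : theta * (2 * (`|B| + 1)) <= D by rewrite -ler_pdivlMr// ge_min lexx orbT.
pose k := Num.min (theta * A) (D / 2).
have k0 : 0 < k by rewrite lt_min mulr_gt0//= divr_gt0.
have k1 : k <= theta * A by rewrite ge_min lexx.
have k2 : k <= D / 2 by rewrite ge_min lexx orbT.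
have cbound z : c z <= (1 + C1) * (pexp a z * expR (- `|U z|)).
  have e1 : 0 <= pexp a z * expR (- `|U z|) by exact: mulr_ge0 (pexp_ge0 _ _) (expR_ge0 _).
  have [u|u] := leP 0 (U z).
    have := cle3 z; rewrite -exU'.
    by have := mulr_ge0 C10 e1; rewrite (ger0_norm u) in e1 *; lra.
  have := cle2 z; rewrite -exU.
  have := mulr_ge0 C10 e1; rewrite (ltr0_norm u) opprK in e1 *; lra.
have Ubound (z : E) : - (D * z.2%:R) - `|U z| <= - (k * (`|z.1%:~R| + z.2%:R)).
  have y0 : 0 <= z.2%:R :> R by [].
  set X : R := z.1%:~R; set V : R := z.2%:R in y0 *.
  have h1 : A * `|X| <= `|U z| + `|B| * V.
    have -> : A * `|X| = `|- A * X| by rewrite normrM normrN (gtr0_norm A0).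
    have -> : - A * X = U z - B * V by rewrite /U -/X -/V; ring.
    by apply: (le_trans (ler_normB _ _)); rewrite (normrM B) (ger0_norm y0).
  have h2 : theta * `|U z| <= `|U z| by rewrite ler_piMl.
  have h3 : theta * (A * `|X|) <= theta * (`|U z| + `|B| * V) by rewrite ler_wpM2l// ltW.
  have h4 : k * `|X| <= theta * A * `|X| by rewrite ler_wpM2r.
  have h5 : k * V <= D / 2 * V by rewrite ler_wpM2r.
  have h6 : theta * (2 * (`|B| + 1)) * V <= D * V by rewrite ler_wpM2r.
  have h7 : 0 <= theta * V by rewrite mulr_ge0 ?(ltW th0).
  by lra.
have [C2 C20 GU] := green_upper.
pose C3 := C2 * (1 + C1).
have C30 : 0 < C3 by rewrite mulr_gt0//; lra.
have eps0 : 0 < (2 * C3)^-1 by rewrite invr_gt0 mulr_gt0.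
have pos w : (0 <= (expR (- (k * (`|w.1%:~R| + w.2%:R))))%:E :> \bar R)%E.
  by move=> *; rewrite lee_fin expR_ge0.
have [F finF tail] := @esum_finite_approx R E _ _ pos (esum_geom_halfplane k0) eps0.
have [Cd Cd0 Hd] := gr_diag_bounded.
pose Q := (\esum_(z in F) (Cd * pexp a z / g z org)%:E)%E.
have q0 z : 0 <= Cd * pexp a z / g z org.
  by rewrite divr_ge0 ?fgreen_ge0// mulr_ge0 ?pexp_ge0// ltW.
have Q0 : (0 <= Q)%E by apply: esum_ge0 => z _; rewrite lee_fin.
have Qfin : Q \is a fin_num.
  rewrite /Q esum_fset//; last by move=> z _; rewrite lee_fin.
  by rewrite fsbig_finite//= sumEFin.
pose q := fine Q.
have q00 : 0 <= q by exact: fine_ge0.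
exists (2 * (q + 1))^-1; first by rewrite invr_gt0; lra.
move=> n.
pose zn : E := (- n%:Z, 0%N).
have zn1 : zn.1%:~R = - n%:R :> R by rewrite /zn /= mulrNz -pmulrn.
have GT w : G zn w = G org (hshift n%:Z w).
  by rewrite -(gr_hshift W t0 n%:Z) /hshift /= addNr.
pose L := expR (- (al * n%:R)).
have L0 : 0 < L by exact: expR_gt0.
have fzn : f zn = L.
  rewrite /f; have -> : pexp a zn = L by rewrite /pexp zn1 /= mulr0 addr0 mulrN.
  rewrite (_ : Num.min _ _ = 1) ?mulr1//; apply/min_idPl.
  rewrite -expR0 ler_expR /U zn1 /= mulr0 addr0 mulrNN mulr_ge0//.
  exact: ltW.
have small : forall e : R, 0 < e -> exists m, (iter m (app K) fE zn <= e%:E)%E.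
  move=> e e0; have [m Hm] := geo_small st1 (pexp_ge0 (als, bs) zn) e0.
  exists m; apply: le_trans (_ : iter m (app K) (fun w => (pexp (als, bs) w)%:E) zn <= _)%E.
    by apply: iter_app_le => // w; rewrite lee_fin.
  apply: le_trans (_ : ((s / t) ^+ m)%:E * (pexp (als, bs) zn)%:E <= _)%E.
    apply: iter_app_geo => //; first by case/andP: st1.
    by move=> w; rewrite lee_fin pexp_ge0.
  by rewrite -EFinM lee_fin.
have cE0 w : (0 <= (c w)%:E)%E by rewrite lee_fin.
have main := @potential_le R E K fE (fun w => (c w)%:E) zn K0 fE0 cE0
  (fun w => (eq_ind _ (fun x => (fE w <= x)%E) (lexx _) _ (cf w))) small.
have gc0 w : (0 <= G zn w * (c w)%:E)%E by rewrite mule_ge0// gr_ge0.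
move: main; rewrite (esumID F)// !setTI /fE fzn => main.
have tail' : (\esum_(w in ~` F) (G zn w * (c w)%:E) <= (L / 2)%:E)%E.
  apply: (@le_trans _ _ (\esum_(w in ~` F) ((C3 * L)%:E *
      (expR (- (k * (`|w.1%:~R| + w.2%:R))))%:E))%E).
    apply: le_esum => w _.
    apply: (@le_trans _ _ ((C2 / pexp (al, b2) (hshift n%:Z w))%:E * (c w)%:E)%E).
      by apply: lee_wpmul2r => //; rewrite GT.
    rewrite -!EFinM lee_fin.
    apply: (@le_trans _ _ (C2 / pexp (al, b2) (hshift n%:Z w) * ((1 + C1) * (pexp a w * expR (- `|U w|))))).
      by rewrite ler_wpM2l// mulr_ge0 ?invr_ge0 ?pexp_ge0// ltW.
    have -> : C2 / pexp (al, b2) (hshift n%:Z w) * ((1 + C1) * (pexp a w * expR (- `|U w|))) =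
      C3 * L * expR (- (D * w.2%:R) - `|U w|).
      have H : (pexp (al, b2) (hshift n%:Z w))^-1 * (pexp a w * expR (- `|U w|)) =
          L * expR (- (D * w.2%:R) - `|U w|).
        rewrite /L /pexp /hshift /= -expRN -!expRD; congr expR.
        by rewrite intrD -pmulrn /D; ring.
      by rewrite -[RHS]mulrA -H /C3; ring.
    by rewrite ler_wpM2l ?ler_expR ?Ubound// mulr_ge0 ?(ltW C30) ?(ltW L0).
  have esumZ : (\esum_(w in ~` F) ((C3 * L)%:E *
      (expR (- (k * (`|w.1%:~R| + w.2%:R))))%:E) =
    (C3 * L)%:E * \esum_(w in ~` F) (expR (- (k * (`|w.1%:~R| + w.2%:R))))%:E)%E.
    rewrite !(esum_mkcond (~` F)) -esum_scale; last 2 first.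
    - by rewrite lee_fin mulr_ge0// ltW.
    - by move=> w; case: ifP.
    by apply: eq_esumT => w; case: ifP; rewrite ?mule0.
  rewrite esumZ; apply: (@le_trans _ _ ((C3 * L)%:E * ((2 * C3)^-1)%:E)%E).
    by apply: lee_wpmul2l => //; rewrite lee_fin mulr_ge0// ltW.
  rewrite -EFinM lee_fin le_eqVlt; apply/orP; left; apply/eqP.
  by field; rewrite gt_eqF.
have head : (\esum_(w in F) (G zn w * (c w)%:E) <= (g zn org)%:E * Q)%E.
  have -> : ((g zn org)%:E * Q = \esum_(w in F) ((g zn org)%:E * (Cd * pexp a w / g w org)%:E))%E.
    rewrite /Q !(esum_mkcond F) -esum_scale; last 2 first.
    - by rewrite lee_fin fgreen_ge0.
    - by move=> w; case: ifP => _ //; rewrite lee_fin.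
    by apply: eq_esumT => w; case: ifP; rewrite ?mule0.
  apply: le_esum => w _; rewrite fgreenE -!EFinM lee_fin -/(g zn w).
  have h1 : g zn w * g w org <= Cd * g zn org.
    apply: le_trans (fgreen_mul t0 corner_gr_finite zn w org) _.
    by rewrite ler_wpM2r ?fgreen_ge0// -lee_fin -fgreenE.
  have h2 : g zn w <= Cd * g zn org / g w org by rewrite ler_pdivlMr ?fgreen_gt0.
  apply: (@le_trans _ _ (Cd * g zn org / g w org * pexp a w)).
    by apply: ler_pM => //; exact: fgreen_ge0.
  by rewrite le_eqVlt; apply/orP; left; apply/eqP; ring.
have : (L%:E <= (g zn org)%:E * Q + (L / 2)%:E)%E.
  by apply: (le_trans main); exact: leeD.
rewrite -(fineK Qfin) -/q -EFinM -EFinD lee_fin.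
have -> : g zn org = g org (n%:Z, 0%N) by rewrite /fgreen GT /hshift /= add0r.
move=> h; rewrite mulrC ler_pdivrMr; last by lra.
have := fgreen_ge0 org (n%:Z, 0%N); rewrite -/L; nra.
Qed.

End Renewal.

(** * The ratio limit along the axis *)

Section RealSequences.
Variable R : realType.

Lemma limsup_exists (v : nat -> R) (M : R) : (forall n, - M <= v n <= M) ->
  exists s : R, (forall e, 0 < e -> exists N, forall n, (N <= n)%N -> v n <= s + e) /\
    (forall e N, 0 < e -> exists2 n, (N <= n)%N & s - e <= v n).
Proof.
move=> vM; pose A := [set r | exists N, forall n, (N <= n)%N -> v n <= r].
have AM : A M by exists 0%N => n _; case/andP: (vM n).
have lb : lbound A (- M).
  by move=> r [N HN]; apply: le_trans (HN N (leqnn _)); case/andP: (vM N).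
have hA : has_inf A by split; [exists M|exists (- M)].
exists (inf A); split.
  move=> e e0; have [r [N HN] rlt] := inf_adherent e0 hA.
  by exists N => n /HN; move/le_trans; apply; exact: ltW.
move=> e N e0; apply: contrapT => H.
suff : inf A <= inf A - e by lra.
apply: ge_inf; first by exists (- M).
exists N => n Nn; rewrite leNgt; apply/negP => h; apply: H.
by exists n => //; exact: ltW.
Qed.

(** Two geometric sequences of bounded ratio have the same ratio. *)
Lemma geometric_squeeze (c C x y : R) : 0 < c -> 0 <= C -> 0 < x -> 0 < y ->
  (forall n, c * y ^+ n <= x ^+ n <= C * y ^+ n) -> x = y.
Proof.
move=> c0 C0 x0 y0 H.
have below u v (k : R) : 0 < u -> 0 < v -> 0 < k ->
    (forall n, k * v ^+ n <= u ^+ n) -> v <= u.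
  move=> u0 v0 k0 le; rewrite leNgt; apply/negP => uv.
  have r01 : 0 <= u / v < 1.
    by rewrite divr_ge0 ?(ltW u0) ?(ltW v0)//= ltr_pdivrMr// mul1r.
  have k20 : 0 < k / 2 by rewrite divr_gt0.
  have [n] := geo_small r01 ler01 k20; rewrite mulr1 expr_div_n => le2.
  have : k <= u ^+ n / v ^+ n by rewrite ler_pdivlMr ?exprn_gt0.
  by move=> h; have := le_trans h le2; lra.
apply/eqP; rewrite eq_le; apply/andP; split; last first.
  by apply: (below x y c) => // n; case/andP: (H n).
apply: (below y x (C + 1)^-1) => //; first by rewrite invr_gt0; lra.
move=> n; case/andP: (H n) => _ le.
rewrite mulrC ler_pdivrMr; last by lra.
by apply: (le_trans le); rewrite mulrC ler_wpM2l ?exprn_ge0 ?(ltW y0)//; lra.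
Qed.

Lemma le_addC_eps (x y k : R) : 0 <= k ->
  (forall e, 0 < e -> x <= y + k * e) -> x <= y.
Proof.
move=> k0 H; apply/ler_addgt0Pr => e e0.
have k1 : 0 < k + 1 by lra.
apply: (le_trans (H _ (divr_gt0 e0 k1))); rewrite lerD2l mulrA ler_pdivrMr//; nra.
Qed.

End RealSequences.

Lemma shift_index (n N : nat) (x : int) : (N + `|x| <= n)%N ->
  x <= n%:Z /\ (N <= `|n%:Z - x|)%N.
Proof. by lia. Qed.

Definition cluster_of (R : realType) (T : Type) (axratio : nat -> T -> R) (h : T -> R) :=
  forall (F : set T) e N, finite_set F -> 0 < e ->
    exists2 n, (N <= n)%N & forall z, F z -> `|axratio n z - h z| <= e.

Section RatioLimit.
Variable R : realType.
Variable W : halfplane_walk R.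
Variable t : R.
Hypothesis t0 : 0 < t.
Local Notation E := (int * nat)%type.
Local Notation mu := (step_mass W).
Local Notation mu0 := (axis_mass W).
Local Notation phi := (mgf mu).
Local Notation phi0 := (mgf mu0).
Local Notation K := (Kt W t).
Local Notation G := (gr (Kt W t)).
Let K0 := Kt_ge0 W t0.
Hint Resolve step_mass_ge0 axis_mass_ge0 K0 : core.
Local Notation g := (fgreen W t).
Variables al b als bs b2 : R.
Hypothesis LC : lens_corner W t al b als bs b2.
Let phi_corner := corner_phi LC.
Let phi0_corner := corner_phi0 LC.
Let b_lt := above_lt LC.
Let phi_b2 := above_phi LC.
Local Notation a := (al, b).
Local Notation org := ((0%R, 0%N) : E).
Let Goo := corner_gr_finite t0 LC.
Let fgreenE := fgreenE t0 Goo.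
Let fgreen_gt0 := fgreen_gt0 t0 Goo.
Let fgreen_ge0 := fgreen_ge0 t0 Goo.

Definition harmonic (u : E -> R) :=
  forall z, app K (fun w => (u w)%:E) z = (u z)%:E.

Lemma harmonic_pexp : harmonic (pexp a).
Proof.
by move=> z; rewrite app_pexp// /phiz phi_corner phi0_corner if_same divff ?mul1r// gt_eqF.
Qed.

Lemma harmonicZ c u : 0 <= c -> (forall z, 0 <= u z) -> harmonic u ->
  harmonic (fun z => c * u z).
Proof.
move=> c0 u0 hu z.
have cE : (0 <= c%:E)%E by rewrite lee_fin.
have uE w : (0 <= (u w)%:E)%E by rewrite lee_fin.
rewrite EFinM -hu -(appZ K0 z cE uE).
by apply: eq_app => w; rewrite EFinM.
Qed.

Lemma harmonic_hshift k u : harmonic u -> harmonic (fun z => u (hshift k z)).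
Proof.
move=> hu z; rewrite -(hu (hshift k z)) /app.
have := @esum_inj_eq R _ _ (hshift k) (fun w => K (hshift k z) w * (u w)%:E)%E
  (can_inj (hshiftK k)).
move=> <-; last by move=> w _; exists (hshift (- k) w); rewrite hshiftNK.
apply: eq_esumT => w; congr (_ * _)%E.
rewrite !KtE /jump_mass /jump /hshift /=.
by have -> : w.1 + k - (z.1 + k) = w.1 - z.1 by ring.
Qed.

(** Off the axis [pexp (al, b2)] is strictly superharmonic and dominates
[pexp a], so functions of order [pexp a] are determined by their values on
the axis. *)
Lemma axis_comparison (u f : E -> R) C : 0 <= C ->
  (forall z, 0 <= u z <= C * pexp a z) -> (forall z, 0 <= f z) ->
  harmonic u -> harmonic f ->
  (forall x, u (x, 0%N) <= f (x, 0%N)) -> forall z, u z <= f z.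
Proof.
move=> C0 uC f0 hu hf ax z; rewrite -lee_fin.
have u0 w : 0 <= u w by case/andP: (uC w).
pose K' (x w : E) := if x.2 == 0%N then 0%E else K x w.
have K'0 x w : (0 <= K' x w)%E by rewrite /K'; case: ifP.
have K'K x w : (K' x w <= K x w)%E by rewrite /K'; case: ifP.
have uE0 w : (0 <= (u w)%:E)%E by rewrite lee_fin.
have fE0 w : (0 <= (f w)%:E)%E by rewrite lee_fin.
have off (v : E -> R) x y : app K' (fun w => (v w)%:E) (x, y.+1) =
    app K (fun w => (v w)%:E) (x, y.+1) by apply: eq_esumT.
apply: (@comparison _ _ K' K'0 (fun w => (u w)%:E) (fun w => (f w)%:E)
  (fun w => if w.2 == 0%N then (u w)%:E else 0%E)) => //.
- by move=> w; case: ifP.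
- move=> [x [|y]] /=; first by rewrite leeDl// app_ge0.
  by rewrite add0e off hu.
- move=> [x [|y]] /=.
    by rewrite /app esum1 ?adde0 ?lee_fin// => w _; rewrite /K' /= mul0e.
  by rewrite add0e off hf.
- move=> e e0; pose r := phi (al, b2) / t.
  have r01 : 0 <= r < 1.
    rewrite divr_ge0 ?(ltW t0) ?mgf_ge0//; last exact: step_mass_fin.
    by rewrite /r ltr_pdivrMr// mul1r.
  pose V w := C * pexp (al, b2) w.
  have V0 w : 0 <= V w by rewrite mulr_ge0 ?pexp_ge0.
  have VE0 w : (0 <= (V w)%:E)%E by rewrite lee_fin.
  have [n Hn] := geo_small r01 (V0 z) e0.
  exists n; apply: le_trans (_ : iter n (app K') (fun w => (V w)%:E) z <= _)%E.
    apply: iter_app_le => // w; rewrite lee_fin.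
    case/andP: (uC w) => _ /le_trans; apply; rewrite ler_wpM2l// ler_expR.
    by rewrite lerD2l ler_wpM2r// ltW.
  apply: le_trans (_ : (r ^+ n)%:E * (V z)%:E <= _)%E; last first.
    by rewrite -EFinM lee_fin.
  apply: iter_app_geo => //; first by case/andP: r01.
  move=> [x [|y]].
    rewrite /app esum1 ?mule_ge0 ?lee_fin//; first by case/andP: r01.
    by move=> w _; rewrite /K' /= mul0e.
  rewrite off.
  have -> : app K (fun w => (V w)%:E) (x, y.+1) =
      (C%:E * app K (fun w => (pexp (al, b2) w)%:E) (x, y.+1))%E.
    have eE w : (0 <= (pexp (al, b2) w)%:E)%E by rewrite lee_fin pexp_ge0.
    have CE : (0 <= C%:E)%E by rewrite lee_fin.
    by rewrite -(appZ K0 _ CE eE); apply: eq_app => w; rewrite EFinM.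
  rewrite app_pexp// /phiz /= -!EFinM lee_fin /V -/r; lra.
Qed.

(** The strong maximum principle: the nonnegative harmonic function [f - u]
vanishes at a point, and the walk is irreducible. *)
Lemma harmonic_touch (u f : E -> R) C : 0 <= C ->
  (forall z, 0 <= u z <= C * pexp a z) -> (forall z, 0 <= f z) ->
  harmonic u -> harmonic f ->
  (forall x, u (x, 0%N) <= f (x, 0%N)) -> u org = f org -> forall z, u z = f z.
Proof.
move=> C0 uC f0 hu hf ax uf.
have uf_le := axis_comparison C0 uC f0 hu hf ax.
pose d z := f z - u z.
have d0 z : 0 <= d z by rewrite subr_ge0.
have dE0 z : (0 <= (d z)%:E)%E by rewrite lee_fin.
have u0 w : 0 <= u w by case/andP: (uC w).
have Kd z : app K (fun w => (d w)%:E) z = (d z)%:E.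
  have : (app K (fun w => (u w)%:E) z + app K (fun w => (d w)%:E) z = (f z)%:E)%E.
    have uE w : (0 <= (u w)%:E)%E by rewrite lee_fin.
    rewrite -hf -(appD K0 z uE dE0).
    by apply: eq_app => w; rewrite -EFinD /d addrC subrK.
  rewrite hu.
  have : (0 <= app K (fun w => (d w)%:E) z)%E by exact: app_ge0.
  case: (app K _ z) => [r| |]// _ [] H; congr EFin.
  by rewrite /d -H; ring.
have it n z : iter n (app K) (fun w => (d w)%:E) z = (d z)%:E.
  by elim: n z => // n IH z /=; rewrite -[RHS]Kd; apply: eq_app.
move=> z; apply/esym/eqP; rewrite -subr_eq0 -/(d z).
have := gr_gt0 W t0 org z.
have [//|nz] := eqVneq (d z) 0.
have dz : 0 < d z by rewrite lt_neqAle eq_sym nz d0.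
move=> Gpos; exfalso.
have [n nn] : exists n, nstep K n org z != 0%E.
  apply: contrapT => /forallNP h; move: Gpos; rewrite /gr esum1 ?ltxx// => i _.
  by apply/eqP; have /negP := h i; rewrite negbK.
have nn0 : (0 < nstep K n org z)%E by rewrite lt_neqAle eq_sym nn nstep_ge0.
have : (nstep K n org z * (d z)%:E <= (d org)%:E)%E.
  rewrite -(it n org) iter_app_nstep//.
  apply: (@esum_ge_term _ _ (fun w => nstep K n org w * (d w)%:E)%E) => w.
  by rewrite mule_ge0// nstep_ge0.
by rewrite /d uf subrr leNgt mule_gt0.
Qed.

Definition axratio (n : nat) (z : E) := g z (n%:Z, 0%N) / g org (n%:Z, 0%N).

Lemma axratio_ge0 n z : 0 <= axratio n z. Proof. by rewrite divr_ge0. Qed.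

Lemma axratio_upper : exists2 C, 0 < C & forall n z, axratio n z <= C * pexp a z.
Proof.
have [C C0 HC] := axis_green_upper t0 LC.
have [c c0 Hc] := axis_green_lower t0 LC.
exists (C / c); first by rewrite divr_gt0.
move=> n z; rewrite /axratio ler_pdivrMr//.
have := HC z n%:Z; rewrite -pmulrn => /le_trans; apply.
have -> : C / c * pexp a z * g org (n%:Z, 0%N) = C * pexp a z * (c^-1 * g org (n%:Z, 0%N)) by ring.
rewrite ler_wpM2l//; first by rewrite mulr_ge0 ?pexp_ge0// ltW.
by rewrite ler_pdivlMl.
Qed.

Lemma axratio_lower : exists2 c, 0 < c & forall n m, (m <= n)%N ->
  c * expR (al * m%:R) <= axratio n (m%:Z, 0%N).
Proof.
have [C C0 HC] := axis_green_upper t0 LC.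
have [c c0 Hc] := axis_green_lower t0 LC.
exists (c / C); first by rewrite divr_gt0.
move=> n m mn; rewrite /axratio ler_pdivlMr//.
have -> : g (m%:Z, 0%N) (n%:Z, 0%N) = g org ((n - m)%N%:Z, 0%N).
  by rewrite -(fgreen_hshift W t0 m%:Z org) /hshift /= add0r -PoszD subnK.
apply: le_trans (Hc (n - m)%N).
have := HC org n%:Z; rewrite -pmulrn /pexp /= !mulr0 addr0 expR0 mulr1 => h.
have -> : expR (- (al * (n - m)%:R)) = expR (al * m%:R) * expR (- (al * n%:R)).
  by rewrite -expRD natrB//; congr expR; ring.
have -> : c / C * expR (al * m%:R) * g org (n%:Z, 0%N) =
   c * expR (al * m%:R) * (g org (n%:Z, 0%N) / C) by ring.
rewrite [leRHS]mulrA ler_wpM2l ?mulr_ge0 ?expR_ge0 ?(ltW c0)//.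
by rewrite ler_pdivrMr// mulrC.
Qed.

Lemma axratio_org n : axratio n org = 1.
Proof. by rewrite /axratio divff// gt_eqF. Qed.

Lemma axratio_step n (x : int) : x <= n%:Z ->
  axratio n (x + 1, 0%N) = axratio `|n%:Z - x|%N (1, 0%N) * axratio n (x, 0%N).
Proof.
move=> xn; rewrite /axratio.
have nx : (`|n%:Z - x|%N)%:Z = n%:Z - x by rewrite gez0_abs// subr_ge0.
rewrite nx -(fgreen_hshift W t0 x (1, 0%N)) -(fgreen_hshift W t0 x org (n%:Z - x, 0%N)).
rewrite /hshift /= subrK add0r (addrC 1).
by field; rewrite !gt_eqF.
Qed.

Lemma axratio_harmonic n z : (`|z.1| < n)%N ->
  app K (fun w => (axratio n w)%:E) z = (axratio n z)%:E.
Proof.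
move=> zn; have ne : z != (n%:Z, 0%N).
  by apply/negP => /eqP ze; move: zn; rewrite ze /= ltnn.
have i0 : 0 <= (g org (n%:Z, 0%N))^-1 by rewrite invr_ge0.
have -> : (axratio n z)%:E = ((g org (n%:Z, 0%N))^-1%:E * G z (n%:Z, 0%N))%E.
  by rewrite fgreenE -EFinM mulrC.
rewrite gr_first// /dirac_fun (negbTE ne) add0e -appZ ?lee_fin//; last first.
  by move=> w; exact: gr_ge0.
by apply: eq_app => w; rewrite fgreenE -EFinM mulrC.
Qed.

Section Cluster.
Variables (n_ : nat -> nat) (h : E -> R).
Hypothesis n_ge : forall k, (k <= n_ k)%N.
Hypothesis hC : cluster_of (fun k => axratio (n_ k)) h.

Lemma cluster_near (z : E) e N : 0 < e ->
  exists2 n, (N <= n)%N & `|axratio n z - h z| <= e.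
Proof.
move=> e0; have [k kN H] := @hC [set z] e N (finite_set1 z) e0.
by exists (n_ k); [exact: leq_trans kN (n_ge k)|exact: H].
Qed.

Lemma cluster_near2 (z w : E) e N : 0 < e ->
  exists2 n, (N <= n)%N & `|axratio n z - h z| <= e /\ `|axratio n w - h w| <= e.
Proof.
move=> e0; have [k kN H] := @hC [set z; w] e N (finite_set2 z w) e0.
by exists (n_ k); [exact: leq_trans kN (n_ge k)|split; apply: H; [left|right]].
Qed.

Lemma cluster_ge0 z : 0 <= h z.
Proof.
apply: (@le_addC_eps _ _ _ 1) => // e e0.
have [n _] := cluster_near z 0 e0; rewrite ler_norml => /andP[_ h2].
by have := axratio_ge0 n z; lra.
Qed.

Lemma cluster_org : h org = 1.
Proof.
apply/eqP; rewrite -subr_eq0 -normr_le0; apply: (@le_addC_eps _ _ _ 1) => // e e0.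
have [n _] := cluster_near org 0 e0.
by rewrite axratio_org distrC; lra.
Qed.

Lemma cluster_upper : exists2 C, 0 < C & forall z, h z <= C * pexp a z.
Proof.
have [C C0 HC] := axratio_upper; exists C => // z.
apply: (@le_addC_eps _ _ _ 1) => // e e0.
have [n _] := cluster_near z 0 e0; rewrite ler_norml => /andP[h1 _].
by have := HC n z; lra.
Qed.

Lemma cluster_lower : exists2 c, 0 < c & forall m : nat,
  c * expR (al * m%:R) <= h (m%:Z, 0%N).
Proof.
have [c c0 Hc] := axratio_lower; exists c => // m.
apply: (@le_addC_eps _ _ _ 1) => // e e0.
have [n mn] := cluster_near (m%:Z, 0%N) m e0; rewrite ler_norml => /andP[_ h2].
by have := Hc n m mn; lra.
Qed.

Lemma cluster_harmonic : harmonic h.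
Proof.
move=> z.
have [C C0 nuC] := axratio_upper.
have [C' C'0 hC'] := cluster_upper.
pose M w := (C + C') * pexp a w.
have exg := pexp_ge0 a.
have M0 w : 0 <= M w by rewrite mulr_ge0//; lra.
have nuM n w : 0 <= axratio n w <= M w.
  by rewrite axratio_ge0 /M mulrDl ler_wpDr ?nuC// mulr_ge0// ltW.
have hM w : 0 <= h w <= M w.
  by rewrite cluster_ge0 /M mulrDl ler_wpDl ?hC'// mulr_ge0// ltW.
have Moo : (app K (fun w => (M w)%:E) z < +oo)%E.
  have := harmonicZ (addr_ge0 (ltW C0) (ltW C'0)) exg harmonic_pexp.
  by rewrite -/M => ->; exact: ltry.
pose k := phiz W z (0, 0) / t.
have k0 : 0 <= k by rewrite divr_ge0 ?phiz_ge0// ltW.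
have K1 : (app K (fun=> 1%E) z <= k%:E)%E.
  have := app_pexp W t0 (0, 0) z.
  have e1 w : pexp (0, 0) w = 1 :> R by rewrite /pexp /= !mul0r addr0 expR0.
  rewrite e1 mulr1 -/k => <-; apply: app_le => // w.
  by rewrite e1.
have k2 : 0 <= k + 2 by lra.
have step1 e : 0 < e -> (app K (fun w => (h w)%:E) z <= (h z + (k + 2) * e)%:E)%E /\
   ((h z)%:E <= app K (fun w => (h w)%:E) z + ((k + 2) * e)%:E)%E.
  move=> e0.
  have [F finF HF] := app_dominated K0 M0 Moo K1 e0.
  have finFz : finite_set (F `|` [set z]) by rewrite finite_setU; split => //; exact: finite_set1.
  have [j jN Hj] := hC (`|z.1|.+1) finFz e0.
  have nj : (`|z.1| < n_ j)%N by apply: leq_trans (n_ge j).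
  have hz : `|axratio (n_ j) z - h z| <= e by apply: Hj; right.
  have A := HF h (axratio (n_ j)) e (ltW e0) hM (axratio_ge0 _).
  have B := HF (axratio (n_ j)) h e (ltW e0) (nuM _) cluster_ge0.
  move: A B; rewrite axratio_harmonic// => A B.
  move: hz; rewrite ler_norml => /andP[hz1 hz2].
  split.
    apply: le_trans (A _) _.
      move=> w Fw; have : `|axratio (n_ j) w - h w| <= e by apply: Hj; left.
      by rewrite ler_norml => /andP[]; lra.
    by rewrite -EFinD lee_fin; lra.
  have /B : forall w, F w -> axratio (n_ j) w <= h w + e.
    move=> w Fw; have : `|axratio (n_ j) w - h w| <= e by apply: Hj; left.
    by rewrite ler_norml => /andP[]; lra.
  move=> {}B; apply: (@le_trans _ _ ((axratio (n_ j) z)%:E + e%:E)%E).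
    by rewrite -EFinD lee_fin; lra.
  apply: (le_trans (leeD2r e%:E B)); rewrite -addeA -EFinD; apply: leeD2l.
  by rewrite lee_fin; lra.
have hE0 w : (0 <= (h w)%:E)%E by rewrite lee_fin cluster_ge0.
have fin : app K (fun w => (h w)%:E) z \is a fin_num.
  rewrite ge0_fin_numE; last exact: app_ge0.
  by have [h1 _] := step1 1 ltr01; apply: le_lt_trans h1 (ltry _).
rewrite -(fineK fin); congr EFin; apply/eqP; rewrite eq_le; apply/andP; split.
  apply: (le_addC_eps k2) => e /step1[h1 _]; rewrite -lee_fin fineK//.
apply: (le_addC_eps k2) => e /step1[_ h1]; move: h1.
by rewrite -(fineK fin) -EFinD lee_fin.
Qed.

(** A Choquet-Deny argument.  The ratio [s] is attained at [org] as an extremal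
value, so [h (hshift 1 z) = s * h z] everywhere by [harmonic_touch]; then [h]
is geometric along the axis, and the two-sided bounds leave only one possible
rate. *)
Lemma cluster_rigid s : 0 <= s -> h (1, 0%N) = s ->
  (forall x, h (x + 1, 0%N) <= s * h (x, 0%N)) \/
  (forall x, s * h (x, 0%N) <= h (x + 1, 0%N)) -> s = expR al.
Proof.
move=> s0 h1 ax.
have [C C0 HC] := cluster_upper; have [c c0 Hc] := cluster_lower.
have hh := cluster_harmonic.
have hsh := harmonic_hshift 1 hh.
have hsc := harmonicZ s0 cluster_ge0 hh.
have touch : forall z, h (hshift 1 z) = s * h z.
  have org1 : h (hshift 1 org) = s * h org by rewrite cluster_org mulr1 /hshift /= add0r.
  case: ax => ax.
    apply: (@harmonic_touch _ _ (C * expR al)) => //.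
    - by rewrite mulr_ge0 ?expR_ge0// ltW.
    - move=> z; rewrite cluster_ge0 /=; apply: (le_trans (HC _)).
      rewrite -mulrA ler_wpM2l ?(ltW C0)// /pexp -expRD ler_expR /hshift /=.
      by rewrite intrD; lra.
    - by move=> z; rewrite mulr_ge0// cluster_ge0.
  move=> z; apply/esym; move: z.
  apply: (@harmonic_touch _ _ (s * C)) => //.
  - by rewrite mulr_ge0// ltW.
  - move=> z; rewrite mulr_ge0 ?cluster_ge0//=.
    by rewrite -mulrA ler_wpM2l.
  - by move=> z; exact: cluster_ge0.
have hn (n : nat) : h (n%:Z, 0%N) = s ^+ n.
  elim: n => [|n IH]; first exact: cluster_org.
  by rewrite exprS -IH -touch /hshift /= -PoszD addn1.
have s_gt0 : 0 < s.
  have := Hc 1%N; rewrite hn expr1; apply: lt_le_trans.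
  by rewrite mulr_gt0// expR_gt0.
apply: (geometric_squeeze c0 (ltW C0) s_gt0 (expR_gt0 al)) => n.
rewrite -hn -expRM_natl (mulrC n%:R) Hc /=.
by have := HC (n%:Z, 0%N); rewrite /pexp /= mulr0 addr0 -pmulrn.
Qed.

End Cluster.

Lemma exists_cluster (n_ : nat -> nat) :
  exists h, cluster_of (fun k => axratio (n_ k)) h.
Proof.
have [C C0 HC] := axratio_upper.
have := @pointwise_cluster R E (fun k => axratio (n_ k)) (fun z => C * pexp a z).
by apply => n z; rewrite axratio_ge0 HC.
Qed.

(** The upper and the lower limit of the ratio of consecutive values on the axis
are both extremal in the sense of [cluster_rigid]. *)
Lemma axratio_e1_cvg e : 0 < e -> exists N, forall n, (N <= n)%N ->
  `|axratio n (1, 0%N) - expR al| <= e.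
Proof.
have [C C0 HC] := axratio_upper.
pose v n := axratio n (1, 0%N).
pose B := C * pexp a (1, 0%N).
have B0 : 0 <= B by rewrite mulr_ge0 ?pexp_ge0// ltW.
have vB n : - B <= v n <= B by have := HC n (1, 0%N); have := axratio_ge0 n (1, 0%N); rewrite /v /B; lra.
have vB' n : - B <= - v n <= B by have := vB n; lra.
(* Any limit value of the ratio v that bounds v asymptotically on one side is
   the corner rate. *)
have extremal s (n_ : nat -> nat) : (forall k, (k <= n_ k)%N) ->
    (forall e, 0 < e -> exists N, forall k, (N <= k)%N -> `|v (n_ k) - s| <= e) ->
    (forall e, 0 < e -> exists N, forall n, (N <= n)%N -> v n <= s + e) \/
    (forall e, 0 < e -> exists N, forall n, (N <= n)%N -> s - e <= v n) ->
    s = expR al.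
  move=> nge vs ext; have [h hC] := exists_cluster n_.
  have h1 : h (1, 0%N) = s.
    apply/eqP; rewrite -subr_eq0 -normr_le0; apply: (@le_addC_eps _ _ _ 2) => // e0 e00.
    have [N HN] := vs _ e00; have [k kN Hk] := @hC [set (1, 0%N)] e0 N (finite_set1 _) e00.
    have := HN k kN; have := Hk _ (erefl _); rewrite /v !ler_norml => /andP[u1 u2] /andP[u3 u4].
    by apply/andP; split; lra.
  have s0 : 0 <= s by rewrite -h1; exact: (cluster_ge0 nge hC).
  apply: (cluster_rigid nge hC s0 h1).
  have approx x e0 N : 0 < e0 -> exists n m, [/\ (N <= m)%N,
      axratio n (x + 1, 0%N) = v m * axratio n (x, 0%N),
      `|axratio n (x + 1, 0%N) - h (x + 1, 0%N)| <= e0 & `|axratio n (x, 0%N) - h (x, 0%N)| <= e0].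
    move=> e00.
    have [n nN [H1 H2]] := cluster_near2 nge hC (x + 1, 0%N) (x, 0%N) (N + `|x|) e00.
    have [xn mN] := shift_index nN.
    by exists n, `|n%:Z - x|%N; split => //; exact: axratio_step.
  have hx0 x : 0 <= h (x, 0%N) := cluster_ge0 nge hC (x, 0%N).
  case: ext => ext; [left|right] => x.
    apply: (@le_addC_eps _ _ _ (s + h (x, 0%N) + 2)); first by have := hx0 x; lra.
    move=> e0 e00; pose e1 := Num.min e0 1.
    have e10 : 0 < e1 by rewrite lt_min e00 ltr01.
    have e11 : e1 <= 1 by rewrite ge_min lexx orbT.
    have e1e : e1 <= e0 by rewrite ge_min lexx.
    have [N HN] := ext _ e10.
    have [n [m [mN eq]]] := approx x e1 N e10.
    rewrite eq !ler_norml => /andP[u1 u2] /andP[u3 u4].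
    have vm := HN m mN.
    have := axratio_ge0 n (x, 0%N) => q0.
    have : v m * axratio n (x, 0%N) <= (s + e1) * (h (x, 0%N) + e1).
      by apply: ler_pM => //; [exact: axratio_ge0|lra].
    have := hx0 x; nra.
  apply: (@le_addC_eps _ _ _ (s + h (x, 0%N) + 2)); first by have := hx0 x; lra.
  move=> e0 e00; pose e1 := Num.min e0 1.
  have e10 : 0 < e1 by rewrite lt_min e00 ltr01.
  have e11 : e1 <= 1 by rewrite ge_min lexx orbT.
  have e1e : e1 <= e0 by rewrite ge_min lexx.
  have [N HN] := ext _ e10.
  have [n [m [mN eq]]] := approx x e1 N e10.
  rewrite eq !ler_norml => /andP[u1 u2] /andP[u3 u4].
  have vm := HN m mN.
  have := axratio_ge0 n (x, 0%N) => q0.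
  have vnn : 0 <= v m by exact: axratio_ge0.
  have : (s - e1) * axratio n (x, 0%N) <= v m * axratio n (x, 0%N) by rewrite ler_wpM2r.
  have : s * (h (x, 0%N) - e1) <= s * axratio n (x, 0%N) by rewrite ler_wpM2l//; lra.
  have := hx0 x; nra.
have pick s (w : nat -> R) : (forall e N, 0 < e -> exists2 n, (N <= n)%N & s - e <= w n) ->
    (forall e, 0 < e -> exists N, forall n, (N <= n)%N -> w n <= s + e) ->
    exists n_ : nat -> nat, (forall k, (k <= n_ k)%N) /\
    (forall e, 0 < e -> exists N, forall k, (N <= k)%N -> `|w (n_ k) - s| <= e).
  move=> fr ev.
  have ex_n k : exists n, (k <= n)%N /\ s - k.+1%:R^-1 <= w n.
    have [|n h1 h2] := fr k.+1%:R^-1 k; first by rewrite invr_gt0.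
    by exists n.
  have [n_ Hn] := choice ex_n.
  exists n_; split; first by move=> k; case: (Hn k).
  move=> e0 e00; have [N HN] := ev _ e00.
  have [N' HN'] : exists N', forall k, (N' <= k)%N -> k.+1%:R^-1 <= e0.
    exists (Num.truncn e0^-1) => k kN'; rewrite invf_ple ?posrE//.
    by apply: ltW; apply: lt_le_trans (truncnS_gt _) _; rewrite ler_nat ltnS.
  exists (maxn N N') => k; rewrite geq_max => /andP[kN kN'].
  case: (Hn k) => h1 h2; have := HN (n_ k) (leq_trans kN h1); have := HN' k kN'.
  move: h2; set q := _^-1; set wk := w _ => h2 h3 h4.
  by rewrite ler_norml; apply/andP; split; lra.
have [s [ev fr]] := limsup_exists vB; have [s' [ev' fr']] := limsup_exists vB'.
have sE : s = expR al.
  have [n_ [nge vs]] := pick _ _ fr ev.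
  by apply: (extremal s n_ nge vs); left.
have sE' : - s' = expR al.
  have [n_ [nge vs]] := pick _ _ fr' ev'.
  apply: (extremal (- s') n_ nge).
    move=> e0 /vs[N HN]; exists N => k /HN.
    by rewrite -normrN opprD !opprK.
  by right=> e0 /ev'[N HN]; exists N => n /HN; lra.
move=> e0; have [N HN] := ev _ e0; have [N' HN'] := ev' _ e0.
exists (maxn N N') => n; rewrite geq_max => /andP[/HN h1 /HN' h2].
by rewrite -/(v n) ler_norml; apply/andP; split; lra.
Qed.

(** Every cluster point equals [pexp a] on the axis by [axratio_e1_cvg], hence
everywhere by [axis_comparison]. *)
Lemma renewal z e : 0 < e -> exists N, forall n, (N <= n)%N ->
  `|axratio n z - pexp a z| <= e.
Proof.
move=> e0; apply: contrapT => H.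
have ex_n k : exists n, (k <= n)%N /\ e < `|axratio n z - pexp a z|.
  apply: contrapT => h; apply: H; exists k => n kn.
  by rewrite leNgt; apply/negP => lt; apply: h; exists n.
have [n_ Hn] := choice ex_n.
have nge k : (k <= n_ k)%N by case: (Hn k).
have [h hC] := exists_cluster n_.
have hstep x : h (x + 1, 0%N) = expR al * h (x, 0%N).
  apply/eqP; rewrite -subr_eq0 -normr_le0.
  have hx0 : 0 <= h (x, 0%N) := cluster_ge0 nge hC (x, 0%N).
  have E0 := expR_gt0 al.
  apply: (@le_addC_eps _ _ _ (expR al + h (x, 0%N) + 2)); first by lra.
  move=> d d0; pose d1 := Num.min d 1.
  have d10 : 0 < d1 by rewrite lt_min d0 ltr01.
  have d11 : d1 <= 1 by rewrite ge_min lexx orbT.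
  have d1e : d1 <= d by rewrite ge_min lexx.
  have [N HN] := axratio_e1_cvg d10.
  have [n nN [H1 H2]] := cluster_near2 nge hC (x + 1, 0%N) (x, 0%N) (N + `|x|) d10.
  have [xn mN] := shift_index nN.
  move: (HN _ mN) H1 H2; rewrite axratio_step//.
  set v := axratio `|_|%N _; set q := axratio n _.
  have q0 : 0 <= q by exact: axratio_ge0.
  rewrite !ler_norml => /andP[a1 a2] /andP[b1 b2'] /andP[c1 c2].
  have : (v - expR al) * q <= d1 * (h (x, 0%N) + d1).
    by apply: (@le_trans _ _ (d1 * q)); [rewrite ler_wpM2r|rewrite ler_wpM2l ?(ltW d10)//; lra].
  have : - (d1 * (h (x, 0%N) + d1)) <= (v - expR al) * q.
    apply: (@le_trans _ _ (- d1 * q)); last by rewrite ler_wpM2r.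
    by rewrite mulNr lerN2 ler_wpM2l ?(ltW d10)//; lra.
  have : expR al * (q - h (x, 0%N)) <= expR al * d1 by rewrite ler_wpM2l ?(ltW E0)//; lra.
  have : expR al * - d1 <= expR al * (q - h (x, 0%N)) by rewrite ler_wpM2l ?(ltW E0)//; lra.
  have : d1 * d1 <= d1 * 1 by rewrite ler_wpM2l ?(ltW d10).
  have : d1 * h (x, 0%N) <= d * h (x, 0%N) by rewrite ler_wpM2r.
  have : d1 * expR al <= d * expR al by rewrite ler_wpM2r ?(ltW E0).
  move=> r1 r2 r3 r4 r5 r6 r7.
  by apply/andP; split; lra.
have hax (x : int) : h (x, 0%N) = pexp a (x, 0%N).
  have pos (n : nat) : h (n%:Z, 0%N) = pexp a (n%:Z, 0%N).
    elim: n => [|n IH].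
      by rewrite (cluster_org nge hC) /pexp /= !mulr0 addr0 expR0.
    have := hstep n%:Z; rewrite -PoszD addn1 => ->.
    by rewrite IH /pexp -expRD /= -!pmulrn -addn1 natrD; congr expR; ring.
  case: x => n; first exact: pos.
  rewrite NegzE; elim: n => [|n IH].
    have := hstep (- 1); rewrite addNr (cluster_org nge hC) => h1.
    have : expR (- al) * 1 = expR (- al) * (expR al * h (- 1, 0%N)) by rewrite -h1.
    rewrite mulr1 mulrA -expRD addNr expR0 mul1r => <-.
    by rewrite /pexp /= mulr0 addr0 mulrN1.
  have := hstep (- n.+2%:Z).
  have -> : - n.+2%:Z + 1 = - n.+1%:Z by lia.
  rewrite IH => h1.
  have : expR (- al) * pexp a (- n.+1%:Z, 0%N) = expR (- al) * (expR al * h (- n.+2%:Z, 0%N)).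
    by rewrite -h1.
  rewrite mulrA -expRD addNr expR0 mul1r => <-.
  rewrite /pexp -expRD /= !mulrNz -!pmulrn -[n.+2]addn1 natrD; congr expR; ring.
have [C C0 HC] := cluster_upper nge hC.
have hz : h z = pexp a z.
  apply/eqP; rewrite eq_le; apply/andP; split.
    apply: (axis_comparison (ltW C0)) => //.
    - by move=> w; rewrite (cluster_ge0 nge hC) HC.
    - exact: pexp_ge0.
    - exact: (cluster_harmonic nge hC).
    - exact: harmonic_pexp.
    - by move=> x; rewrite hax.
  apply: (axis_comparison ler01) => //.
  - by move=> w; rewrite pexp_ge0 mul1r /=.
  - by move=> w; exact: (cluster_ge0 nge hC).
  - exact: harmonic_pexp.
  - exact: (cluster_harmonic nge hC).
  - by move=> x; rewrite hax.
have [k _ Hk] := @hC [set z] e 0 (finite_set1 z) e0.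
have := Hk z (erefl _); rewrite hz leNgt => /negP; apply.
by case: (Hn k).
Qed.

End RatioLimit.

(** * The same limit in a cone of directions *)

Section ConeLimit.
Variable R : realType.
Variable W : halfplane_walk R.
Variable t : R.
Hypothesis t0 : 0 < t.
Local Notation E := (int * nat)%type.
Local Notation mu := (step_mass W).
Local Notation mu0 := (axis_mass W).
Local Notation phi := (mgf mu).
Local Notation phi0 := (mgf mu0).
Local Notation K := (Kt W t).
Local Notation G := (gr (Kt W t)).
Local Notation Gk := (gr (Kkill W t)).
Let K0 := Kt_ge0 W t0.
Hint Resolve step_mass_ge0 axis_mass_ge0 K0 : core.
Local Notation g := (fgreen W t).
Variables al b als bs b2 : R.
Hypothesis LC : lens_corner W t al b als bs b2.
Local Notation a := (al, b).
Local Notation org := ((0%R, 0%N) : E).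
Let Goo := corner_gr_finite t0 LC.
Let fgreenE := fgreenE t0 Goo.
Let fgreen_gt0 := fgreen_gt0 t0 Goo.
Let fgreen_ge0 := fgreen_ge0 t0 Goo.

Variables b1 mm mp m1 d : R.
Hypothesis phi_b1 : phi (al, b1) = t.
Hypothesis b_b1 : b < b1.
Hypothesis d0 : 0 < d.
Hypothesis phi_right : phi (al + d, b1 - d * mp) < t.
Hypothesis phi_left : phi (al - d, b1 + d * mm) < t.
Hypothesis mp_m1 : mp < m1.

Lemma positive_min (v : nat -> R) N : (forall n, 0 < v n) ->
  exists2 c, 0 < c & forall n, (n < N)%N -> c <= v n.
Proof.
move=> v0; elim: N => [|N [c c0 Hc]]; first by exists 1.
exists (Num.min c (v N)); first by rewrite lt_min c0 v0.
move=> n; rewrite ltnS leq_eqVlt => /orP[/eqP->|/Hc].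
  by rewrite ge_min lexx orbT.
by move=> h; rewrite ge_min h.
Qed.

Lemma expR_large (c k : R) : 0 < k -> exists N : nat, forall y : nat, (N <= y)%N ->
  c <= expR (k * y%:R).
Proof.
move=> k0; exists (Num.truncn (`|c| / k)).+1 => y Ny.
apply: le_trans (expR_ge1Dx _).
have : `|c| / k <= y%:R.
  by apply: ltW; apply: lt_le_trans (truncnS_gt _) _; rewrite ler_nat.
rewrite ler_pdivrMr// mulrC => h; have := ler_norm c; lra.
Qed.

(** Go along the axis to [(w, 0)], climb to a height below [ys + 1], then repeat
[k] times the displacement [(xs, ys)] provided by [killed_localization].  Its
slope is less than [m1], so that [w] is nonnegative for targets in the cone.
The loss per displacement is subexponential once [ys] is large. *)
Lemma cone_lower eps : 0 < eps -> exists2 c, 0 < c & exists Y : nat,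
  forall (x : int) (y : nat), (Y <= y)%N -> m1 * y%:R <= x%:~R ->
  c * expR (- (eps * y%:R)) / pexp (al, b1) (x, y) <= g org (x, y).
Proof.
move=> eps0.
have [C0 C00 HC0] := gr_diag_bounded t0 (inner_phi LC) (inner_phi0 LC).
have diag z : g z z <= C0 by rewrite -lee_fin -fgreenE.
pose eta := (m1 - mp) / 2.
have eta0 : 0 < eta by rewrite divr_gt0// subr_gt0.
pose m4 := mp + eta + eta / 2.
have m41 : 0 < m1 - m4 by have := mp_m1; rewrite /m4 /eta; lra.
pose e1 := eps / 2.
have e10 : 0 < e1 by rewrite divr_gt0.
have [N1 HN1] := expR_large (C0 * expR (`|b1| + e1)) e10.
have h20 : 0 < eta / 2 by rewrite divr_gt0.
pose N2 := (Num.truncn (`|mp + eta| / (eta / 2))).+1.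
have HN2 (y : nat) : (N2 <= y)%N -> `|mp + eta| <= eta / 2 * y%:R.
  move=> Ny; have : `|mp + eta| / (eta / 2) <= y%:R.
    by apply: ltW; apply: lt_le_trans (truncnS_gt _) _; rewrite ler_nat.
  by rewrite ler_pdivrMr// mulrC.
have [xs [ys' [hY _ slope hA]]] := killed_localization t0 (maxn N1 N2 + 2)%N phi_b1
  (eq_ind_r (fun v => v <= t) (lexx t) (corner_phi LC)) b_b1 d0 eta0 e10 phi_right phi_left.
have [ys ysE] : exists ys, ys' = ys.+1.
  by exists ys'.-1; rewrite prednK//; apply: leq_trans hY; rewrite addn2.
have ysN1 : (N1 <= ys)%N by move: hY; rewrite ysE; clear; lia.
have ysN2 : (N2 <= ys)%N by move: hY; rewrite ysE; clear; lia.
have ys0 : (0 < ys)%N by move: hY; rewrite ysE; clear; lia.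
pose V : R := ys%:R.
have V0 : 0 < V by rewrite ltr0n.
pose X : R := xs%:~R.
have slope' : X <= m4 * V.
  have h1 := HN2 _ ysN2; have h2 := ler_norm (mp + eta).
  move: slope h1 h2; rewrite ysE -addn1 natrD -/X -/V /m4 => h h1 h2; lra.
pose L := al * X + b1 * V.
have Agk : ((expR (- (2 * e1 * V) - L) * C0)%:E <= Gk (0%R, 1%N) (xs, ys'))%E.
  apply: le_trans hA; rewrite lee_fin.
  have h := HN1 _ ysN1.
  have -> : expR (- (e1 * ys'%:R)) / pexp (al, b1) (xs, ys') =
    expR (- (2 * e1 * V) - L) * (expR (e1 * V) * expR (- (e1 + b1))).
    rewrite /pexp -expRN -!expRD ysE /= -/X -addn1 natrD -/V /L; congr expR; ring.
  rewrite ler_wpM2l ?expR_ge0//.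
  apply: le_trans (_ : C0 * expR (`|b1| + e1) * expR (- (e1 + b1)) <= _); last first.
    by rewrite ler_wpM2r ?expR_ge0.
  rewrite -mulrA -expRD ler_peMr ?(ltW C00)// -expR0 ler_expR.
  have := ler_norm b1; lra.
(* Each displacement multiplies the Green function by at least this factor. *)
have chain z : (0 < z.2)%N -> expR (- (2 * e1 * V) - L) * g org z <= g org (pshift (xs, ys) z).
  move=> z0; rewrite -(ler_pM2l C00).
  have h1 : expR (- (2 * e1 * V) - L) * C0 <= g z (pshift (xs, ys) z).
    rewrite -lee_fin -fgreenE; apply: (le_trans Agk).
    apply: le_trans (gr_killed_le W t0 _ _).
    have := gr_killed_pshift W t0 (z.1, z.2.-1) (0%R, 1%N) (xs, ys').
    congr (_ <= gr _ _ _)%E.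
      by case: z z0 => x [|y] // _; rewrite /pshift /= add0r add1n.
    case: z z0 => x [|y] // _; rewrite /pshift /= ysE addrC; congr (_, _); clear; lia.
  have h2 := fgreen_mul t0 Goo org z (pshift (xs, ys) z).
  have h3 : g z z * g org (pshift (xs, ys) z) <= C0 * g org (pshift (xs, ys) z).
    by rewrite ler_wpM2r.
  apply: le_trans h3; apply: le_trans h2.
  rewrite mulrA mulrC (mulrC C0); exact: ler_wpM2l.
pose pt (w : int) (r k : nat) : E := (w + xs * k%:Z, (1 + r + k * ys)%N).
have ladder w r k : expR (- (2 * e1 * V) - L) ^+ k * g org (pt w r 0) <= g org (pt w r k).
  elim: k => [|k IH]; first by rewrite expr0 mul1r.
  have -> : pt w r k.+1 = pshift (xs, ys) (pt w r k).
    by rewrite /pt /pshift /=; congr (_, _); [rewrite -addn1 PoszD; ring|clear; lia].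
  apply: le_trans (chain (pt w r k) _); last by rewrite /pt /=; clear; lia.
  by rewrite exprS -mulrA ler_wpM2l ?expR_ge0.
have [cr cr0 Hcr] := @positive_min (fun r => g org (0%R, (1 + r)%N)) ys (fun r => fgreen_gt0 _ _).
have [c c0 Hc] := axis_green_lower t0 LC.
pose Q := expR (- (`|b1| * V)).
exists (c * cr / C0 * Q); first by rewrite mulr_gt0 ?expR_gt0// divr_gt0// mulr_gt0.
pose Y := (Num.truncn (`|m4| * V / (m1 - m4))).+1.
exists (Y + 1)%N => x y Yy hx.
(* The height y is 1 + r + k * ys with r < ys. *)
pose k := (y.-1 %/ ys)%N; pose r := (y.-1 %% ys)%N.
have yE : y = (1 + r + k * ys)%N.
  by rewrite /k /r -addnA (addnC (_ %% _)%N) -divn_eq add1n prednK//; move: Yy; clear; lia.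
have rys : (r < ys)%N by rewrite ltn_mod.
pose w := x - xs * k%:Z.
have ptE : pt w r k = (x, y) by rewrite /pt /w subrK -yE.
have wr : w%:~R = x%:~R - X * k%:R :> R by rewrite /w intrB intrM.
have yr : y%:R = 1 + r%:R + k%:R * V :> R by rewrite {1}yE !natrD natrM.
have k00 : 0 <= k%:R :> R by [].
have r00 : 0 <= r%:R :> R by [].
have rV : 1 + r%:R <= V by rewrite /V addrC natr1 ler_nat.
have hy : `|m4| * V <= (m1 - m4) * y%:R.
  have : `|m4| * V / (m1 - m4) <= y%:R.
    apply: ltW; apply: lt_le_trans (truncnS_gt _) _; rewrite ler_nat -/Y; move: Yy; clear; lia.
  by rewrite ler_pdivrMr// => h; rewrite [leRHS]mulrC.
have w0 : 0 <= w.
  rewrite -(ler0z R) wr.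
  have h1 : X * k%:R <= m4 * V * k%:R by rewrite ler_wpM2r.
  have h2 : - m4 * (1 + r%:R) <= `|m4| * V.
    apply: (@le_trans _ _ (`|m4| * (1 + r%:R))); last by rewrite ler_wpM2l.
    by rewrite ler_wpM2r ?addr_ge0// -normrN ler_norm.
  have h3 : m4 * y%:R = m4 * (1 + r%:R) + m4 * V * k%:R by rewrite yr; ring.
  lra.
have [n nE] : exists n : nat, w = n%:Z by exists `|w|%N; rewrite gez0_abs.
have base : c * expR (- (al * w%:~R)) * cr / C0 <= g org (pt w r 0).
  rewrite ler_pdivrMr//.
  have h1 := fgreen_mul t0 Goo org (w, 0%N) (w, (1 + r)%N).
  have h2 : g (w, 0%N) (w, (1 + r)%N) = g org (0%R, (1 + r)%N).
    by rewrite -(fgreen_hshift W t0 w org) /hshift /= add0r.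
  have -> : pt w r 0 = (w, (1 + r)%N) by rewrite /pt mulr0 addr0 mul0n addn0.
  apply: le_trans (_ : g (w, 0%N) (w, 0%N) * g org (w, (1 + r)%N) <= _); last first.
    by rewrite mulrC ler_wpM2l.
  apply: le_trans h1; rewrite h2; apply: ler_pM => //.
  - by rewrite mulr_ge0 ?expR_ge0// ltW.
  - exact: ltW.
  - by have := Hc n; rewrite nE -pmulrn.
  - exact: Hcr.
rewrite -ptE; apply: le_trans (ladder w r k).
apply: le_trans (_ : expR (- (2 * e1 * V) - L) ^+ k * (c * expR (- (al * w%:~R)) * cr / C0) <= _); last first.
  by rewrite ler_wpM2l// exprn_ge0// expR_ge0.
rewrite -expRM_natl ptE /pexp -expRN.
have -> : c * cr / C0 * Q * expR (- (eps * y%:R)) * expR (- (al * x%:~R + b1 * y%:R)) =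
  (c * cr / C0) * expR (- (`|b1| * V) - eps * y%:R - (al * x%:~R + b1 * y%:R)).
  by rewrite !expRD /Q; ring.
have -> : expR (k%:R * (- (2 * e1 * V) - L)) * (c * expR (- (al * w%:~R)) * cr / C0) =
  (c * cr / C0) * expR (k%:R * (- (2 * e1 * V) - L) - al * w%:~R).
  by rewrite expRD; ring.
rewrite ler_wpM2l//; first by rewrite divr_ge0 ?(ltW C00)// mulr_ge0 ?ltW.
rewrite ler_expR wr.
have h1 : - b1 * (1 + r%:R) <= `|b1| * V.
  apply: (@le_trans _ _ (`|b1| * (1 + r%:R))); last by rewrite ler_wpM2l.
  by rewrite ler_wpM2r ?addr_ge0// -normrN ler_norm.
have h2 : 0 <= eps * (1 + r%:R) by rewrite mulr_ge0 ?(ltW eps0)// addr_ge0.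
have -> : k%:R * (- (2 * e1 * V) - L) - al * (x%:~R - X * k%:R) =
  - (eps * (k%:R * V)) - al * x%:~R - b1 * (k%:R * V) by rewrite /L /e1; field.
rewrite yr; lra.
Qed.

Lemma axis_limit z z' e : 0 < e -> exists N : nat, forall n : nat, (N <= n)%N ->
  g z (n%:Z, 0%N) <= (pexp a z / pexp a z' + e) * g z' (n%:Z, 0%N).
Proof.
move=> e0.
have z'0 := pexp_gt0 a z'.
pose c := pexp a z / pexp a z' + e.
have c0 : 0 <= c by rewrite addr_ge0 ?divr_ge0 ?pexp_ge0 ?(ltW e0).
pose del := e * pexp a z' / (1 + c).
have c1 : 0 < 1 + c by lra.
have del0 : 0 < del by rewrite divr_gt0// mulr_gt0.
have delE : del * (1 + c) = e * pexp a z' by rewrite /del divfK// gt_eqF.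
have [N HN] := renewal t0 LC z del0.
have [N' HN'] := renewal t0 LC z' del0.
exists (maxn N N') => n; rewrite geq_max => /andP[/HN h1 /HN' h2].
move: h1 h2; rewrite !ler_norml => /andP[_ h1] /andP[h2 _].
have : axratio W t n z <= c * axratio W t n z'.
  have h3 : c * (pexp a z' - del) <= c * axratio W t n z' by rewrite ler_wpM2l//; lra.
  apply: le_trans h3.
  have : c * pexp a z' = pexp a z + e * pexp a z' by rewrite /c mulrDl divfK// gt_eqF.
  move: delE; rewrite mulrDr; lra.
by rewrite /axratio mulrA ler_pM2r// invr_gt0.
Qed.

(** On the axis the inequality holds at large abscissae by [axis_limit], and at
the other ones the decay rate [als < al + d] makes up for an error at rate
[al + d].  [gr_compare_from_axis] extends it to the half-plane with an error
which, in the cone, is negligible against [cone_lower]. *)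
Lemma cone_limit z z' e : 0 < e -> exists Y : nat, forall (x : int) (y : nat),
  (Y <= y)%N -> m1 * y%:R <= x%:~R ->
  g z (x, y) <= (pexp a z / pexp a z' + e) * g z' (x, y).
Proof.
move=> e0.
have z'0 := pexp_gt0 a z'.
have e20 : 0 < e / 2 by rewrite divr_gt0.
pose c := pexp a z / pexp a z' + e / 2.
have c0 : 0 <= c by rewrite addr_ge0 ?(ltW e20)// divr_ge0 ?pexp_ge0.
have [M near] := axis_limit z z' e20.
rewrite -/c in near.
have [Ci Ci0 HCi] := gr_bound_inner t0 (inner_phi LC) (inner_phi0 LC).
pose D := al + d - als.
have D0 : 0 < D by rewrite /D; have := inner_lt LC; have := d0; lra.
pose C := Ci * pexp (als, bs) z * expR (D * M%:R).
have C0 : 0 <= C by rewrite !mulr_ge0 ?expR_ge0 ?pexp_ge0// ltW.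
have Hax (x : int) : (G z (x, 0%N) <=
    c%:E * G z' (x, 0%N) + (C * expR (- ((al + d) * x%:~R)))%:E)%E.
  rewrite !fgreenE -EFinM -EFinD lee_fin.
  have [Mx|xM] := leP M%:Z x.
    have [n xn] : exists n : nat, x = n%:Z by exists `|x|%N; rewrite gez0_abs//; move: Mx; clear; lia.
    rewrite xn; apply: le_trans (near n _) _; first by move: Mx; rewrite xn; clear; lia.
    by rewrite lerDl mulr_ge0 ?expR_ge0.
  have h1 := HCi z (x, 0%N); move: h1; rewrite fgreenE lee_fin => h1.
  apply: le_trans (_ : C * expR (- ((al + d) * x%:~R)) <= _); last first.
    by rewrite lerDr mulr_ge0.
  apply: (le_trans h1).
  rewrite mulrA /C -!mulrA ler_wpM2l ?(ltW Ci0)// ler_wpM2l ?pexp_ge0//.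
  rewrite /pexp -expRN -expRD ler_expR /= mulr0 addr0.
  have : D * x%:~R <= D * M%:R.
    by rewrite ler_wpM2l ?(ltW D0)// pmulrn ler_int ltW.
  rewrite /D; lra.
have [C' C'0 HC'] := @gr_compare_from_axis R W t t0 z z' (al + d) (b1 - d * mp) c C c0 C0 Goo Hax phi_right.
pose eps := d * (m1 - mp) / 2.
have eps0 : 0 < eps by rewrite divr_gt0// mulr_gt0// subr_gt0.
have [cl cl0 [Y HY]] := cone_lower eps0.
have [Cd Cd0 HCd] := gr_diag_bounded t0 (inner_phi LC) (inner_phi0 LC).
pose kap := g z' org / Cd.
have kap0 : 0 < kap by rewrite divr_gt0.
have lowz' w : kap * g org w <= g z' w.
  rewrite /kap mulrAC ler_pdivrMr// mulrC (mulrC _ Cd).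
  rewrite [g org w * _]mulrC; apply: le_trans (fgreen_mul t0 Goo z' org w) _.
  by rewrite ler_wpM2r// -lee_fin -fgreenE.
have [N3 HN3] := expR_large (C' / (e / 2 * (kap * cl))) eps0.
exists (maxn Y N3) => x y; rewrite geq_max => /andP[yY yN] hx.
have := HC' (x, y); rewrite !fgreenE -EFinM -EFinD lee_fin => h.
have -> : pexp a z / pexp a z' + e = c + e / 2 by rewrite /c; field; rewrite gt_eqF.
rewrite mulrDl; apply: (le_trans h); rewrite lerD2l.
apply: le_trans (_ : e / 2 * (kap * (cl * expR (- (eps * y%:R)) / pexp (al, b1) (x, y))) <= _); last first.
  rewrite ler_wpM2l ?(ltW e20)//; apply: le_trans (lowz' (x, y)).
  by rewrite ler_wpM2l ?(ltW kap0)//; exact: HY.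
have h1 := HN3 y yN.
rewrite ler_pdivrMr ?pexp_gt0//.
have -> : e / 2 * (kap * (cl * expR (- (eps * y%:R)) / pexp (al, b1) (x, y))) *
    pexp (al + d, b1 - d * mp) (x, y) =
  (e / 2 * (kap * cl)) * expR (d * x%:~R - d * mp * y%:R - eps * y%:R).
  have -> : expR (d * x%:~R - d * mp * y%:R - eps * y%:R) =
    expR (- (eps * y%:R)) / pexp (al, b1) (x, y) * pexp (al + d, b1 - d * mp) (x, y).
    rewrite /pexp -expRN -!expRD /=; congr expR; ring.
  ring.
have P0 : 0 < e / 2 * (kap * cl) by rewrite mulr_gt0// mulr_gt0.
rewrite mulrC -ler_pdivrMr//; apply: (le_trans h1).
rewrite ler_expR.
have : d * (m1 * y%:R) <= d * x%:~R by rewrite ler_wpM2l// ltW.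
rewrite /eps; lra.
Qed.

End ConeLimit.

(** * Slower decay in a cone at a higher level *)

Section Spread.
Variable R : realType.
Variable W : halfplane_walk R.
Variable t : R.
Hypothesis t0 : 0 < t.
Local Notation E := (int * nat)%type.
Local Notation mu := (step_mass W).
Local Notation mu0 := (axis_mass W).
Local Notation phi := (mgf mu).
Local Notation phi0 := (mgf mu0).
Local Notation K := (Kt W t).
Local Notation G := (gr (Kt W t)).
Local Notation Gk := (gr (Kkill W t)).
Let K0 := Kt_ge0 W t0.
Hint Resolve step_mass_ge0 axis_mass_ge0 K0 : core.
Local Notation g := (fgreen W t).
Variable z0 : E.

(** A smaller ratio would make the Green function decay along the axis more
slowly than the exponential upper bound allows. *)
Lemma axis_ratio_ge al b r : phi (al, b) < t -> phi0 (al, b) < t ->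
  0 < r -> r < expR al ->
  ~ exists N : nat, forall n : nat, (N <= n)%N ->
      g (hshift 1 z0) (n%:Z, 0%N) <= r * g z0 (n%:Z, 0%N).
Proof.
move=> p p0 r0 ral [N HN].
have Goo := gr_finite_inner t0 p p0.
pose F n := g z0 (n%:Z, 0%N).
have F0 n : 0 < F n by exact: fgreen_gt0.
have jump n : (N <= n)%N -> F n <= r * F n.+1.
  move=> Nn; have := HN n.+1 (leqW Nn).
  have -> : g (hshift 1 z0) (n.+1%:Z, 0%N) = F n.
    rewrite /F -(fgreen_hshift W t0 1 z0) /hshift /=.
    by rewrite -PoszD addn1.
  by [].
have it k : F N <= r ^+ k * F (N + k)%N.
  elim: k => [|k IH]; first by rewrite expr0 mul1r addn0.
  apply: (le_trans IH); rewrite exprSr -mulrA ler_wpM2l ?exprn_ge0 ?(ltW r0)//.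
  by rewrite addnS; apply: jump; rewrite leq_addr.
have [C C0 HC] := gr_bound_inner t0 p p0.
pose q := r / expR al.
have q01 : 0 <= q < 1.
  by rewrite divr_ge0 ?(ltW r0) ?expR_ge0//= ltr_pdivrMr ?expR_gt0// mul1r.
pose c := C * pexp (al, b) z0 * expR (- (al * N%:R)).
have c0 : 0 < c by rewrite !mulr_gt0 ?expR_gt0 ?pexp_gt0.
have bound k : F (N + k)%N <= c * (expR al ^+ k)^-1.
  rewrite -lee_fin -(fgreenE t0 Goo); apply: (le_trans (HC _ _)); rewrite lee_fin.
  rewrite /c -!mulrA ler_wpM2l ?(ltW C0)// ler_wpM2l ?pexp_ge0//.
  rewrite /pexp -expRM_natl -!expRN -expRD ler_expR /= mulr0 addr0 -pmulrn natrD.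
  by rewrite le_eqVlt; apply/orP; left; apply/eqP; ring.
have F2 : 0 < F N / 2 by rewrite divr_gt0.
have [n Hn] := geo_small q01 (ltW c0) F2.
have : F N <= q ^+ n * c.
  apply: (le_trans (it n)); rewrite /q expr_div_n -mulrA ler_wpM2l ?exprn_ge0 ?(ltW r0)//.
  by rewrite mulrC.
by move=> h; have := le_trans h Hn; have := F0 N; lra.
Qed.

Variables al0 bl b0 al2 bl2 mm mp m1 d : R.
Hypothesis phi_l : phi (al0, bl) < t.
Hypothesis phi0_l : phi0 (al0, bl) < t.
Hypothesis phi_b0 : phi (al0, b0) = t.
Hypothesis bl_b0 : bl < b0.
Hypothesis d0 : 0 < d.
Hypothesis phi_right : phi (al0 + d, b0 - d * mp) < t.
Hypothesis phi_left : phi (al0 - d, b0 + d * mm) < t.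
Hypothesis m1_mm : m1 < mm.

Let Goo := gr_finite_inner t0 phi_l phi0_l.
Let fgreenE := fgreenE t0 Goo.
Let fgreen_gt0 := fgreen_gt0 t0 Goo.
Let fgreen_ge0 := fgreen_ge0 t0 Goo.

Lemma telescope (F : nat -> R) (c : R) n :
  (forall i, (i < n)%N -> expR c * F i.+1 <= F i) -> expR (c * n%:R) * F n <= F 0%N.
Proof.
elim: n => [|n IH] H; first by rewrite mulr0 expR0 mul1r.
apply: le_trans (IH _); last by move=> i iln; apply: H; exact: ltnW.
rewrite -addn1 natrD mulrDr mulr1 expRD -mulrA ler_wpM2l ?expR_ge0//.
by rewrite addn1; exact: H.
Qed.

(** By [killed_localization] some high point of the cone has a Green function of
order almost [1 / pexp (al0, b0)], which is also an upper bound (up to a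
subexponential factor) further to the left at the same height.  Telescoping
between the two points, some one-jump ratio is at most the average one. *)
Lemma cone_ratio_le del (Y : nat) : 0 < del -> exists x : int, exists y : nat,
  [/\ (Y <= y)%N, m1 * y%:R <= x%:~R &
   g (hshift 1 z0) (x, y) <= expR (al0 + del) * g z0 (x, y)].
Proof.
move=> del0.
pose eta := (mm - m1) / 2.
have eta0 : 0 < eta by rewrite divr_gt0// subr_gt0.
pose eps := del * eta / 4.
have eps0 : 0 < eps by rewrite divr_gt0// mulr_gt0.
pose e' := Num.min eps (b0 - bl).
have e'0 : 0 < e' by rewrite lt_min eps0 subr_gt0.
have e'eps : e' <= eps by rewrite ge_min lexx.
have e'b : e' <= b0 - bl by rewrite ge_min lexx orbT.
have phi_e' : phi (al0, b0 - e') < t.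
  pose s := e' / (b0 - bl).
  have bb0 : 0 < b0 - bl by rewrite subr_gt0.
  have s01 : 0 <= s <= 1 by rewrite divr_ge0 ?(ltW e'0) ?(ltW bb0)//= ler_pdivrMr// mul1r.
  have s0 : 0 < s by rewrite divr_gt0.
  have sE : s * (b0 - bl) = e' by rewrite /s divfK// gt_eqF.
  have := @mgf_convex R mu (step_mass_ge0 W) (@step_mass_fin R W) al0 b0 al0 bl s s01.
  have -> : (1 - s) * al0 + s * al0 = al0 by ring.
  have -> : (1 - s) * b0 + s * bl = b0 - e' by rewrite -sE; ring.
  rewrite phi_b0 => /le_lt_trans; apply.
  have : s * phi (al0, bl) < s * t by rewrite ltr_pM2l.
  lra.
have [Ci Ci0 HCi] := gr_bound_inner t0 phi_l phi0_l.
pose Ca := Ci * pexp (al0, bl) z0.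
have Ca0 : 0 <= Ca by rewrite mulr_ge0 ?pexp_ge0// ltW.
have Hax (x : int) : (G z0 (x, 0%N) <=
    0%:E * G z0 (x, 0%N) + (Ca * expR (- (al0 * x%:~R)))%:E)%E.
  rewrite mul0e add0e; apply: (le_trans (HCi _ _)).
  by rewrite lee_fin /Ca {2}/pexp /= mulr0 addr0 expRN mulrA.
have [C' C'0 HC'] := @gr_compare_from_axis R W t t0 z0 z0 al0 (b0 - e') 0 Ca (lexx _) Ca0 Goo Hax phi_e'.
have upper w : g z0 w <= C' / pexp (al0, b0 - e') w.
  by have := HC' w; rewrite mul0e add0e fgreenE lee_fin.
have [Cd Cd0 HCd] := gr_diag_bounded t0 phi_l phi0_l.
pose kap := g z0 (0%R, 1%N) / Cd.
have kap0 : 0 < kap by rewrite divr_gt0.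
have lower w : (kap%:E * Gk (0%R, 1%N) w <= (g z0 w)%:E)%E.
  apply: (@le_trans _ _ (kap * g (0%R, 1%N) w)%:E).
    by rewrite EFinM; apply: lee_wpmul2l; rewrite ?lee_fin ?(ltW kap0)// -fgreenE gr_killed_le.
  rewrite lee_fin /kap mulrAC ler_pdivrMr//.
  apply: le_trans (fgreen_mul t0 Goo z0 (0%R, 1%N) w) _.
  by rewrite mulrC ler_wpM2l// -lee_fin -fgreenE.
have k0 : 0 < del * eta / 2 by rewrite divr_gt0// mulr_gt0.
have [N1 HN1] := expR_large ((C' + 1) / kap * expR del) k0.
pose N2 := (Num.truncn eta^-1).+1.
have [xk [y [hY slope _ hA]]] := killed_localization t0 (maxn Y (maxn N1 N2)) phi_b0
  (ltW phi_l) bl_b0 d0 eta0 eps0 phi_right phi_left.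
move: hY; rewrite !geq_max => /and3P[yY yN1 yN2].
pose V : R := y%:R.
have V0 : 0 <= V by [].
have etaV : 1 <= eta * V.
  have : eta^-1 <= V by apply: ltW; apply: lt_le_trans (truncnS_gt _) _; rewrite ler_nat.
  by rewrite -ler_pdivrMl ?mulr1// mulrC.
(* The leftmost integer abscissa of the cone at height y, up to one. *)
pose x' : int := Num.floor (m1 * V) + 1.
have x'1 : m1 * V <= x'%:~R by rewrite /x' ltW// lt_succ_floor.
have x'2 : x'%:~R <= m1 * V + 1 by rewrite /x' intrD lerD2r floor_le.
have xk' : eta * V <= xk%:~R - m1 * V.
  by move: slope; rewrite -/V /eta; lra.
have x'xk : x' <= xk by rewrite -(ler_int R); lra.
pose n := `|xk - x'|%N.
have nE : xk = x' + n%:Z by rewrite /n gez0_abs ?subr_ge0//; ring.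
have nR : n%:R = xk%:~R - x'%:~R :> R by rewrite nE intrD -pmulrn; ring.
apply: contrapT => H.
pose F i := g z0 (x' + i%:Z, y).
have Hstep i : (i < n)%N -> expR (al0 + del) * F i.+1 <= F i.
  move=> iln; rewrite leNgt; apply/negP => lt; apply: H.
  exists (x' + i.+1%:Z), y; split => //.
    by apply: (le_trans x'1); rewrite ler_int lerDl.
  have -> : g (hshift 1 z0) (x' + i.+1%:Z, y) = F i.
    rewrite /F -(fgreen_hshift W t0 1 z0) /hshift /=.
    have -> : x' + i.+1%:Z = x' + i%:Z + 1 by rewrite -addn1 PoszD addrA.
    by [].
  exact: ltW.
have tel := telescope Hstep.
have := upper (x', y).
have -> : g z0 (x', y) = F 0%N by rewrite /F addr0.
move=> up.
have lo : kap * (expR (- (eps * V)) / pexp (al0, b0) (xk, y)) <= F n.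
  rewrite /F -nE -lee_fin; apply: le_trans (lower _).
  by rewrite EFinM; apply: lee_wpmul2l => //; rewrite lee_fin ltW.
have : expR ((al0 + del) * n%:R) * (kap * (expR (- (eps * V)) / pexp (al0, b0) (xk, y))) <=
    C' / pexp (al0, b0 - e') (x', y).
  apply: le_trans up; apply: le_trans tel; rewrite ler_wpM2l ?expR_ge0//.
rewrite ler_pdivlMr ?pexp_gt0//.
have -> : expR ((al0 + del) * n%:R) * (kap * (expR (- (eps * V)) / pexp (al0, b0) (xk, y))) *
    pexp (al0, b0 - e') (x', y) =
  kap * expR (del * n%:R - eps * V - e' * V).
  have -> : expR (del * n%:R - eps * V - e' * V) = expR ((al0 + del) * n%:R) *
     (expR (- (eps * V)) / pexp (al0, b0) (xk, y)) * pexp (al0, b0 - e') (x', y).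
    by rewrite /pexp -expRN -!expRD nR /= -/V; congr expR; ring.
  by ring.
have h1 := HN1 y yN1.
have h2 : expR (del * eta / 2 * y%:R) * expR (- del) <= expR (del * n%:R - eps * V - e' * V).
  rewrite -expRD ler_expR -/V nR.
  have : e' * V <= eps * V by rewrite ler_wpM2r.
  have : del * (eta * V - 1) <= del * (xk%:~R - x'%:~R).
    by rewrite ler_wpM2l ?(ltW del0)//; lra.
  rewrite /eps; lra.
have h3 : kap * ((C' + 1) / kap * expR del * expR (- del)) <=
    kap * expR (del * n%:R - eps * V - e' * V).
  rewrite ler_wpM2l ?(ltW kap0)//; apply: le_trans h2.
  by rewrite ler_wpM2r ?expR_ge0.
have h4 : kap * ((C' + 1) / kap * expR del * expR (- del)) = C' + 1.
  by rewrite -mulrA -expRD subrr expR0 mulr1 mulrCA divff ?mulr1// gt_eqF.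
by move=> h5; have := le_trans h3 h5; rewrite h4; lra.
Qed.

End Spread.

(** * Convex geometry of the level sets *)

Section Geometry.
Variable R : realType.

Lemma continuous_eps (f : R -> R) :
  (forall x e, 0 < e -> exists2 d, 0 < d & forall h, `|h| <= d -> `|f (x + h) - f x| <= e) ->
  continuous f.
Proof.
move=> H x; apply/cvgrPdist_le => e e0.
have [d d0 Hd] := H x e e0.
near=> y.
have -> : y = x + (y - x) by rewrite addrC subrK.
rewrite distrC; apply: Hd.
rewrite distrC; near: y; apply: cvgr_dist_le d0; exact: cvg_id.
Unshelve. all: by end_near.
Qed.

Lemma convex1_continuous (g : R -> R) :
  (forall u v s, 0 <= s <= 1 -> g ((1 - s) * u + s * v) <= (1 - s) * g u + s * g v) ->
  continuous g.
Proof.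
move=> cvx; apply: continuous_eps => x e e0.
have [p Hp] := convex1_subgradient x cvx.
pose C := `|p| + `|g (x + 1) - g x| + `|g (x - 1) - g x| + 1.
have n1 := normr_ge0 p; have n2 := normr_ge0 (g (x + 1) - g x).
have n3 := normr_ge0 (g (x - 1) - g x).
have C1 : 1 <= C by rewrite /C; lra.
have C0 : 0 < C by lra.
exists (Num.min 1 (e / C)); first by rewrite lt_min ltr01 divr_gt0.
move=> h; rewrite le_min => /andP[h1]; rewrite ler_pdivlMr// => he.
have hh := normr_ge0 h.
have up : g (x + h) - g x <= `|h| * C.
  have s01 : 0 <= `|h| <= 1 by rewrite hh h1.
  have [hp|hn] := leP 0 h.
    have := cvx x (x + 1) _ s01; rewrite (ger0_norm hp) in h1 hh s01 *.
    have -> : (1 - h) * x + h * (x + 1) = x + h by ring.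
    have := ler_norm (g (x + 1) - g x) => m1 m2.
    have : h * (g (x + 1) - g x) <= h * C by rewrite ler_wpM2l// /C; lra.
    lra.
  have := cvx x (x - 1) _ s01; rewrite (ltr0_norm hn) in h1 hh s01 *.
  have -> : (1 - - h) * x + - h * (x - 1) = x + h by ring.
  have := ler_norm (g (x - 1) - g x) => m1 m2.
  have : - h * (g (x - 1) - g x) <= - h * C by rewrite ler_wpM2l// /C; lra.
  lra.
have lo : - (`|h| * C) <= g (x + h) - g x.
  have := Hp h; have : `|p * h| <= `|h| * C.
    by rewrite normrM mulrC ler_wpM2l// /C; lra.
  by rewrite ler_norml => /andP[]; lra.
rewrite ler_norml; apply/andP; split; lra.
Qed.

Variable W : halfplane_walk R.
Local Notation mu := (step_mass W).
Local Notation mu0 := (axis_mass W).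
Local Notation phi := (mgf mu).
Local Notation phi0 := (mgf mu0).
Hint Resolve step_mass_ge0 axis_mass_ge0 : core.

Lemma phi_convex : convex2 phi. Proof. exact: mgf_convex (@step_mass_fin R W). Qed.
Lemma phi0_convex : convex2 phi0. Proof. exact: mgf_convex (@axis_mass_fin R W). Qed.
Lemma phi_semiconcave : semiconcave2 phi.
Proof. exact: mgf_semiconcave (@step_mass_fin R W). Qed.
Lemma phi0_semiconcave : semiconcave2 phi0.
Proof. exact: mgf_semiconcave (@axis_mass_fin R W). Qed.

Let phi_cont := convex_continuous phi_convex phi_semiconcave.
Let phi0_cont := convex_continuous phi0_convex phi0_semiconcave.

(** Otherwise the interior walk would never leave a line. *)
Lemma jump_direction h k : (h != 0) || (k != 0) ->
  exists2 z, 0 < mu z & h * z.1%:~R + k * z.2%:~R != 0 :> R.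
Proof.
move=> hk; apply: contrapT => H.
have line z : 0 < mu z -> h * z.1%:~R + k * z.2%:~R = 0 :> R.
  move=> mz; apply/eqP; apply: contrapT => /negP nz; apply: H; by exists z.
pose Q (z : int * int) : Prop := h * z.1%:~R + k * z.2%:~R = 0 :> R.
have reach z : Q z.
  have [n pos] := interior_irr W (0, 0) z.
  apply: (nstep_invariant (Q := Q) _ _ pos).
  - by move=> x y; rewrite lee_fin; exact: step_mass_ge0.
  - move=> x y; rewrite /walk_kernel lte_fin => /line /= + Qx.
    by rewrite /Q !intrB => e; rewrite -[RHS]e; move: Qx; rewrite /Q => Qx; lra.
  - by rewrite /Q /= !mulr0 addr0.
have := reach (1, 0); have := reach (0, 1).
rewrite /Q /= !mulr0 !mulr1 addr0 add0r => k0 h0.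
by move: hk; rewrite k0 h0 eqxx.
Qed.

Lemma jump_up : exists i j, 0 < mu (i, j) /\ (0 < j)%R.
Proof.
apply: contrapT => H.
have down z : 0 < mu z -> (z.2 <= 0)%R.
  move=> mz; rewrite leNgt; apply/negP => z2; apply: H; exists z.1, z.2.
  by rewrite -surjective_pairing.
have [n pos] := interior_irr W (0, 0) (0, 1).
suff : ((0 : int, 1 : int).2 <= 0)%R by [].
apply: (nstep_invariant (Q := fun z : int * int => (z.2 <= 0)%R) _ _ pos) => //.
- by move=> x y; rewrite lee_fin; exact: step_mass_ge0.
- move=> x y; rewrite /walk_kernel lte_fin => /down /=; lia.
Qed.

Lemma jump0_up : exists i j, 0 < mu0 (i, j) /\ (0 < j)%R.
Proof.
apply: contrapT => H.
have down z : 0 < mu0 z -> (z.2 <= 0)%R.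
  move=> mz; rewrite leNgt; apply/negP => z2; apply: H; exists z.1, z.2.
  by rewrite -surjective_pairing.
have [n pos] := walk_irr W (0, 0%N) (0, 1%N).
suff : (0 : int, 1%N).2 = 0%N by [].
apply: (nstep_invariant (Q := fun z : int * nat => z.2 = 0%N) _ _ pos) => //.
- by move=> x y; rewrite lee_fin; case: ifP => _; [exact: axis_mass_ge0|exact: step_mass_ge0].
- move=> x y; rewrite /reflected_kernel lte_fin => + x0.
  by rewrite x0 /= => /down /=; lia.
Qed.

Lemma phi_midpoint x y h k : (h != 0) || (k != 0) ->
  2 * phi (x, y) < phi (x + h, y + k) + phi (x - h, y - k).
Proof.
move=> /jump_direction[z mz nz].
exact: (mgf_strict_midpoint (step_mass_ge0 W) (@step_mass_fin R W) x y mz nz).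
Qed.

Lemma phi0_increasing x y y' : y < y' -> phi0 (x, y) < phi0 (x, y').
Proof.
have [i [j [mz j0]]] := jump0_up.
exact: (mgf_increasing (axis_mass_ge0 W) (@axis_mass_fin R W) x (@axis_mass_down R W) mz j0).
Qed.

Lemma phi_large x M y : exists2 y', y <= y' & M < phi (x, y').
Proof.
have [i [j [mz j0]]] := jump_up.
have [y0 _ H] := mgf_unbounded (step_mass_ge0 W) (@step_mass_fin R W) x M mz j0.
exists (Num.max y y0); first by rewrite le_max lexx.
by apply: H; rewrite le_max lexx orbT.
Qed.

Lemma phi_ivt x y1 y2 v : y1 <= y2 -> phi (x, y1) <= v -> v <= phi (x, y2) ->
  exists2 y, y1 <= y <= y2 & phi (x, y) = v.
Proof.
move=> y12 v1 v2.
have cont : continuous (fun y => phi (x, y)).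
  apply: continuous_eps => y e e0; have [d d0 Hd] := phi_cont x y e0.
  exists d => // h hd; have := Hd 0 h; rewrite normr0 addr0; apply => //.
  exact: ltW.
have v12 : Num.min (phi (x, y1)) (phi (x, y2)) <= v <= Num.max (phi (x, y1)) (phi (x, y2)).
  by rewrite ge_min v1 le_max v2 orbT.
have [c cin cv] := IVT y12 (continuous_subspaceT cont) v12.
by exists c => //; move: cin; rewrite in_itv.
Qed.

(** Moving by [d] along [(1, - m')] or [(- 1, m)] changes [phi] to first order by
a negative multiple of [d]. *)
Lemma grad_descent x y p q m m' : grad_at phi x y p q -> 0 < q ->
  m * q < p -> p < m' * q ->
  exists2 d0, 0 < d0 & forall d, 0 < d -> d <= d0 ->
    phi (x + d, y - d * m') < phi (x, y) /\ phi (x - d, y + d * m) < phi (x, y).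
Proof.
move=> [_ [C C0 up]] q0 mq mq'.
have one A M : 0 < A -> exists2 d0, 0 < d0 & forall d, 0 < d -> d <= d0 ->
    d <= 1 / 2 /\ `|d * M| <= 1 / 2 /\ C * (d ^+ 2 + (d * M) ^+ 2) < d * A.
  move=> A0; pose B := 2 + 2 * `|M| + (C * (1 + M ^+ 2) + 1) / A.
  have M0 := normr_ge0 M; have M2 := sqr_ge0 M.
  have CM : 0 <= C * (1 + M ^+ 2) by rewrite mulr_ge0//; lra.
  have Q0 : 0 <= (C * (1 + M ^+ 2) + 1) / A by rewrite divr_ge0 ?(ltW A0)//; lra.
  have B2 : 2 <= B by rewrite /B; lra.
  have B0 : 0 < B by lra.
  exists B^-1; first by rewrite invr_gt0.
  move=> d d0; rewrite -[B^-1]mul1r ler_pdivlMr// => dB.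
  have h1 : d * 2 <= d * B by rewrite ler_wpM2l// ltW.
  have h2 : d * (2 * `|M|) <= d * B by rewrite ler_wpM2l ?(ltW d0)// /B; lra.
  have h3 : d * ((C * (1 + M ^+ 2) + 1) / A) <= d * B by rewrite ler_wpM2l ?(ltW d0)// /B; lra.
  split; first by lra.
  split; first by rewrite normrM (gtr0_norm d0); lra.
  have h4 : d * (C * (1 + M ^+ 2) + 1) <= A.
    have : d * ((C * (1 + M ^+ 2) + 1) / A) <= 1 by lra.
    by rewrite mulrA ler_pdivrMr// mul1r.
  have -> : C * (d ^+ 2 + (d * M) ^+ 2) = d * (d * (C * (1 + M ^+ 2))) by ring.
  rewrite ltr_pM2l//; lra.
have A1 : 0 < m' * q - p by rewrite subr_gt0.
have A2 : 0 < p - m * q by rewrite subr_gt0.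
have [d1 d10 H1] := one _ m' A1; have [d2 d20 H2] := one _ m A2.
exists (Num.min d1 d2); first by rewrite lt_min d10.
move=> d d0; rewrite le_min => /andP[/(H1 d d0)[e1 [e2 e3]] /(H2 d d0)[f1 [f2 f3]]].
have dn : `|d| <= 1 / 2 by rewrite gtr0_norm.
split.
  have := up d (- (d * m')) dn; rewrite normrN => /(_ e2).
  rewrite sqrrN; lra.
have := up (- d) (d * m); rewrite normrN => /(_ dn f2).
rewrite sqrrN; lra.
Qed.

Lemma grad_pos x y y' p q : grad_at phi x y p q -> y' < y ->
  phi (x, y') < phi (x, y) -> 0 < q.
Proof.
move=> [lo _] yy' lt.
have := lo 0 (y' - y); rewrite !addr0 mulr0 addr0 [y + _]addrC subrK => h.
have : q * (y' - y) < 0 by lra.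
by rewrite nmulr_llt0 ?subr_lt0.
Qed.

Lemma grad_derive1 x y p q : grad_at phi x y p q ->
  derive1 (fun v : R => phi (x, v)) y = q.
Proof.
move=> [lo [C C0 up]]; rewrite /derive1; apply: cvg_lim => //.
apply/cvgrPdist_le => e e0.
have C1 : 0 < C + 1 by lra.
pose d := Num.min (1 / 2) (e / (C + 1)).
have d0 : 0 < d by rewrite lt_min divr_gt0 ?ltr01//= divr_gt0.
have d1 : d <= 1 / 2 by rewrite ge_min lexx.
have d2 : d * (C + 1) <= e by rewrite -ler_pdivlMr// ge_min lexx orbT.
near=> h.
have h0 : h != 0 by near: h; exact: nbhs_dnbhs_neq.
have hd : `|h| <= d by near: h; exact: dnbhs0_le.
have nz : `|(0 : R)| <= 1 / 2 by rewrite normr0; lra.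
have A := lo 0 h; have B := up 0 h nz (le_trans hd d1).
move: A B; rewrite !addr0 mulr0 addr0 expr0n /= add0r => A B.
have hp : 0 < `|h| by rewrite normr_gt0.
have eq : `|q - h^-1 * (phi (x, y + h) - phi (x, y))| * `|h| =
    `|phi (x, y + h) - phi (x, y) - q * h|.
  by rewrite -normrM -normrN; congr `|_|; field.
have -> : h + y = y + h by ring.
rewrite -(ler_pM2r hp) [X in X <= _]eq ger0_norm; last by lra.
apply: (@le_trans _ _ (C * h ^+ 2)); first by lra.
rewrite -(real_normK (num_real h)) expr2 mulrA ler_wpM2r//.
have : C * `|h| <= C * d by rewrite ler_wpM2l.
lra.
Unshelve. all: by end_near.
Qed.

Variables als bs : R.
Hypothesis astar_min : forall a, Num.max (phi (als, bs)) (phi0 (als, bs)) <=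
  Num.max (phi a) (phi0 a).
Hypothesis astar_unique : forall b,
  (forall a, Num.max (phi b) (phi0 b) <= Num.max (phi a) (phi0 a)) -> b = (als, bs).
Hypothesis dphi_lt0 : derive1 (fun v : R => phi (als, v)) bs < 0.

(** The minimal level; an upper bound for the convergence norm. *)
Definition rho := Num.max (phi (als, bs)) (phi0 (als, bs)).

Lemma phi_below : exists2 b1, bs < b1 & phi (als, b1) < phi (als, bs).
Proof.
have [p [q gr]] := grad_exists phi_convex phi_semiconcave als bs.
have := dphi_lt0; rewrite (grad_derive1 gr) => q0.
have [_ [C C0 up]] := gr.
pose B := 2 + (C + 1) / (- q).
have nq : 0 < - q by rewrite oppr_gt0.
have Cq : 0 <= (C + 1) / (- q) by rewrite divr_ge0 ?(ltW nq)//; lra.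
have B0 : 0 < B by rewrite /B; lra.
pose d := B^-1.
have d0 : 0 < d by rewrite invr_gt0.
have dB : d * B = 1 by rewrite mulVf// gt_eqF.
have d2 : d * 2 <= d * B by rewrite ler_wpM2l ?(ltW d0)// /B; lra.
have d3 : d * ((C + 1) / (- q)) <= d * B by rewrite ler_wpM2l ?(ltW d0)// /B; lra.
have d4 : d * (C + 1) <= - q.
  have : d * ((C + 1) / (- q)) <= 1 by lra.
  by rewrite mulrA ler_pdivrMr// mul1r.
exists (bs + d); first by rewrite ltrDl.
have nz : `|(0 : R)| <= 1 / 2 by rewrite normr0; lra.
have nd : `|d| <= 1 / 2 by rewrite gtr0_norm//; lra.
have := up 0 d nz nd; rewrite addr0 mulr0 addr0 expr0n /= add0r => h.
have : d * (d * (C + 1)) <= d * (- q) by rewrite ler_wpM2l// ltW.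
have : 0 < d * d by rewrite mulr_gt0.
lra.
Qed.

Lemma phi_eq_phi0 : phi (als, bs) = rho /\ phi0 (als, bs) = rho.
Proof.
suff e : phi (als, bs) = phi0 (als, bs) by rewrite /rho -e maxxx.
have [lt|gt|//] := ltgtP (phi (als, bs)) (phi0 (als, bs)).
  have e0 : 0 < phi0 (als, bs) - phi (als, bs) by rewrite subr_gt0.
  have [d d0 Hd] := phi_cont als bs (divr_gt0 e0 (ltr0n _ 2)).
  have := Hd 0 (- d); rewrite normr0 normrN addr0 (gtr0_norm d0) => /(_ (ltW d0) (lexx _)).
  rewrite ler_norml => /andP[_ h1].
  have h2 : phi0 (als, bs - d) < phi0 (als, bs) by apply: phi0_increasing; rewrite gtrBl.
  have := astar_min (als, bs - d); rewrite (max_r (ltW lt)) le_max => /orP[h3|h3].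
    exfalso; lra.
  by have := le_lt_trans h3 h2; rewrite ltxx.
have [b1 bsb1 pb1] := phi_below.
have e0 : 0 < phi (als, bs) - phi0 (als, bs) by rewrite subr_gt0.
have [d d0 Hd] := phi0_cont als bs (divr_gt0 e0 (ltr0n _ 2)).
pose s := Num.min 1 (d / (b1 - bs)).
have bb : 0 < b1 - bs by rewrite subr_gt0.
have s0 : 0 < s by rewrite lt_min ltr01 divr_gt0.
have s1 : s <= 1 by rewrite ge_min lexx.
have sd : s * (b1 - bs) <= d by rewrite -ler_pdivlMr// ge_min lexx orbT.
have s01 : 0 <= s <= 1 by rewrite (ltW s0).
have := phi_convex als bs als b1 s01.
have -> : (1 - s) * als + s * als = als by ring.
have -> : (1 - s) * bs + s * b1 = bs + s * (b1 - bs) by ring.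
move=> h1.
have h2 : s * phi (als, b1) < s * phi (als, bs) by rewrite ltr_pM2l.
have sp : 0 <= s * (b1 - bs) by rewrite mulr_ge0// ltW.
have := Hd 0 (s * (b1 - bs)); rewrite normr0 addr0 (ger0_norm sp) => /(_ (ltW d0) sd).
rewrite ler_norml => /andP[_ h3].
have := astar_min (als, bs + s * (b1 - bs)); rewrite (max_l (ltW gt)) le_max.
by move=> /orP[h4|h4]; exfalso; lra.
Qed.

(** [phi] is convex and tends to infinity along the vertical line above the
minimizer, where it starts by decreasing. *)
Lemma upper_root : exists2 bU, bs < bU & phi (als, bU) = rho /\
  forall b, bs < b -> b < bU -> phi (als, b) < rho.
Proof.
have [e1 _] := phi_eq_phi0.
have [b1 bsb1] := phi_below; rewrite e1 => pb1.
have [y' y'b1 py'] := phi_large als rho b1.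
have [bU /andP[h1 h2] pU] := phi_ivt y'b1 (ltW pb1) (ltW py').
have b1U : b1 < bU.
  rewrite lt_neqAle h1 andbT; by apply/eqP => e; move: pb1; rewrite e pU ltxx.
exists bU; first exact: (lt_trans bsb1 b1U).
split => // b bb bbU.
have seg x y z : x < y -> y < z -> phi (als, y) * (z - x) <=
    phi (als, x) * (z - y) + phi (als, z) * (y - x).
  move=> xy yz; have zx : 0 < z - x by lra.
  pose s := (y - x) / (z - x).
  have s01 : 0 <= s <= 1 by rewrite divr_ge0 ?ler_pdivrMr// ?mul1r; lra.
  have sE : s * (z - x) = y - x by rewrite /s divfK// gt_eqF.
  have := phi_convex als x als z s01.
  have -> : (1 - s) * als + s * als = als by ring.
  have -> : (1 - s) * x + s * z = y.
    have -> : (1 - s) * x + s * z = x + s * (z - x) by ring.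
    by rewrite sE addrC subrK.
  rewrite -(ler_pM2r zx) => /le_trans; apply.
  rewrite le_eqVlt; apply/orP; left; apply/eqP.
  have -> : ((1 - s) * phi (als, x) + s * phi (als, z)) * (z - x) =
    phi (als, x) * ((z - x) - s * (z - x)) + phi (als, z) * (s * (z - x)) by ring.
  by rewrite sE; ring.
have [lt|gt|->//] := ltgtP b b1.
  have := seg bs b b1 bb lt; rewrite e1 => h.
  have bb1 : 0 < b1 - bs by lra.
  rewrite -(ltr_pM2r bb1); apply: (le_lt_trans h).
  have : phi (als, b1) * (b - bs) < rho * (b - bs) by rewrite ltr_pM2r// subr_gt0.
  lra.
have := seg b1 b bU gt bbU; rewrite pU => h.
have bb1 : 0 < bU - b1 by lra.
rewrite -(ltr_pM2r bb1); apply: (le_lt_trans h).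
have : phi (als, b1) * (bU - b) < rho * (bU - b) by rewrite ltr_pM2r// subr_gt0.
lra.
Qed.

Definition maxphi (a : R * R) := Num.max (phi a) (phi0 a).

Lemma maxphi_convex : convex2 maxphi.
Proof.
move=> x y x' y' s s01; rewrite /maxphi ge_max; have /andP[s0 s1] := s01.
have s1' : 0 <= 1 - s by lra.
apply/andP; split.
  apply: (le_trans (phi_convex x y x' y' s01)); apply: lerD; rewrite ler_wpM2l//;
    by rewrite le_max lexx.
apply: (le_trans (phi0_convex x y x' y' s01)); apply: lerD; rewrite ler_wpM2l//;
  by rewrite le_max lexx orbT.
Qed.

Lemma maxphi_ge a : rho <= maxphi a. Proof. exact: astar_min. Qed.

Lemma maxphi_gt a : a <> (als, bs) -> rho < maxphi a.
Proof.
move=> ne; rewrite lt_neqAle maxphi_ge andbT; apply/eqP => e; apply: ne.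
by apply: astar_unique => c; rewrite -/(maxphi a) -e maxphi_ge.
Qed.

Lemma maxphi_cont_y x : continuous (fun y => maxphi (x, y)).
Proof.
apply: convex1_continuous => u v s s01; have := maxphi_convex x u x v s01.
by have -> : (1 - s) * x + s * x = x by ring.
Qed.

Lemma maxphi_cont_x y : continuous (fun x => maxphi (x, y)).
Proof.
apply: convex1_continuous => u v s s01; have := maxphi_convex u y v y s01.
by have -> : (1 - s) * y + s * y = y by ring.
Qed.

(** The minimum of [maxphi] over the vertical sides [bs - r <= y <= bs + r] is a
convex, hence continuous, function of the abscissa, equal to [rho] at [als]
and larger than [rho] to the right, so it takes values just above [rho].  At
a minimizer both functions equal this value: [phi0] decreases when [y]
decreases, and [phi] decreases when [y] moves towards [v], so neither of them
can be strictly below the other. *)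
Lemma corner_exists r v kap : 0 < r -> bs + r < v -> 0 < kap ->
  (forall h, `|h| <= r -> phi (als + h, v) < rho) ->
  exists t al b, [/\ rho < t, t <= rho + kap, als < al, al <= als + r &
    [/\ bs - r <= b, b <= bs + r, phi (al, b) = t & phi0 (al, b) = t]].
Proof.
move=> r0 bv kap0 below.
have bb : bs - r <= bs + r by lra.
have [bet Hbet] : exists bet : R -> R, forall x, [/\ bs - r <= bet x, bet x <= bs + r &
    forall y, bs - r <= y -> y <= bs + r -> maxphi (x, bet x) <= maxphi (x, y)].
  suff H (x : R) : exists c : R, [/\ bs - r <= c, c <= bs + r &
      forall y, bs - r <= y -> y <= bs + r -> maxphi (x, c) <= maxphi (x, y)] by have [f Hf] := choice H; exists f.
  have [c] := EVT_min bb (continuous_subspaceT (maxphi_cont_y (x := x))).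
  rewrite in_itv /= => /andP[c1 c2] H; exists c; split => // y y1 y2.
  by apply: H; rewrite in_itv /= y1.
pose M x := maxphi (x, bet x).
have Mcont : continuous M.
  apply: convex1_continuous => u w s s01.
  have [u1 u2 _] := Hbet u; have [w1 w2 _] := Hbet w; have /andP[s0 s1] := s01.
  have := maxphi_convex u (bet u) w (bet w) s01; apply: le_trans.
  have [_ _ H] := Hbet ((1 - s) * u + s * w); apply: H.
    have : (1 - s) * (bs - r) <= (1 - s) * bet u by rewrite ler_wpM2l//; lra.
    have : s * (bs - r) <= s * bet w by rewrite ler_wpM2l.
    lra.
  have : (1 - s) * bet u <= (1 - s) * (bs + r) by rewrite ler_wpM2l//; lra.
  have : s * bet w <= s * (bs + r) by rewrite ler_wpM2l.
  lra.
have M0 : M als = rho.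
  apply/eqP; rewrite eq_le maxphi_ge andbT.
  by have [_ _ H] := Hbet als; apply: H; lra.
have side (y : R) : y <> bs -> exists2 c, rho < c &
    forall x, als <= x -> x <= als + r -> c <= maxphi (x, y).
  move=> ybs; have aa : als <= als + r by lra.
  have [c cin H] := EVT_min aa (continuous_subspaceT (maxphi_cont_x (y := y))).
  exists (maxphi (c, y)); first by apply: maxphi_gt => -[_ /ybs].
  by move=> x x1 x2; apply: H; rewrite in_itv /= x1.
have [c1 c10 H1] : exists2 c, rho < c &
    forall x, als <= x -> x <= als + r -> c <= maxphi (x, bs - r) by apply: side; lra.
have [c2 c20 H2] : exists2 c, rho < c &
    forall x, als <= x -> x <= als + r -> c <= maxphi (x, bs + r) by apply: side; lra.
have Mr : rho < M (als + r).
  apply: maxphi_gt => -[e _]; lra.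
pose t := Num.min ((rho + Num.min (Num.min c1 c2) (M (als + r))) / 2) (rho + kap).
have cM : rho < Num.min (Num.min c1 c2) (M (als + r)) by rewrite !lt_min c10 c20.
have t1 : rho < t by rewrite lt_min; apply/andP; split; lra.
have t2 : t < Num.min (Num.min c1 c2) (M (als + r)).
  rewrite gt_min; apply/orP; left; lra.
have [t2c t2c' t2M] : [/\ t < c1, t < c2 & t < M (als + r)].
  by move: t2; rewrite !lt_min => /andP[/andP[]].
have tk : t <= rho + kap by rewrite ge_min lexx orbT.
have aa : als <= als + r by lra.
have tin : Num.min (M als) (M (als + r)) <= t <= Num.max (M als) (M (als + r)).
  by rewrite ge_min le_max M0 (ltW t1) (ltW t2M) orbT.
have [al] := IVT aa (continuous_subspaceT Mcont) tin.
rewrite in_itv /= => /andP[al1 al2] Mal.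
have als_al : als < al.
  rewrite lt_neqAle al1 andbT; apply/eqP => e; by move: t1; rewrite -Mal -e M0 ltxx.
have [b1 b2 Hb] := Hbet al; set b := bet al in b1 b2 Hb.
have mxb : maxphi (al, b) = t by [].
have pb : phi (al, b) <= t by rewrite -mxb le_max lexx.
have p0b : phi0 (al, b) <= t by rewrite -mxb le_max lexx orbT.
have b1' : bs - r < b.
  rewrite lt_neqAle b1 andbT; apply/eqP => e.
  have := H1 al al1 al2; rewrite e mxb => h; have := le_lt_trans h t2c; by rewrite ltxx.
have pt : phi (al, b) = t.
  apply/eqP; rewrite eq_le pb /= leNgt; apply/negP => lt.
  have e0 : 0 < t - phi (al, b) by rewrite subr_gt0.
  have [d d0 Hd] := phi_cont al b (divr_gt0 e0 (ltr0n _ 2)).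
  pose k := Num.min d (b - (bs - r)).
  have k0 : 0 < k by rewrite lt_min d0 subr_gt0.
  have kd : k <= d by rewrite ge_min lexx.
  have kb : k <= b - (bs - r) by rewrite ge_min lexx orbT.
  have := Hd 0 (- k); rewrite normr0 normrN addr0 (gtr0_norm k0) => /(_ (ltW d0) kd).
  rewrite ler_norml => /andP[_ h1].
  have h2 : phi0 (al, b - k) < phi0 (al, b) by apply: phi0_increasing; rewrite gtrBl.
  have k1 : bs - r <= b - k by lra.
  have k2 : b - k <= bs + r by lra.
  have := Hb (b - k) k1 k2; rewrite mxb leNgt => /negP; apply.
  by rewrite gt_max; apply/andP; split; lra.
exists t, al, b; split => //; split => //.
apply/eqP; rewrite eq_le p0b /= leNgt; apply/negP => lt.
have h0 : `|al - als| <= r by rewrite ger0_norm; lra.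
have := below _ h0; rewrite (addrC als) subrK => pv.
have e0 : 0 < t - phi0 (al, b) by rewrite subr_gt0.
have [d d0 Hd] := phi0_cont al b (divr_gt0 e0 (ltr0n _ 2)).
have b2' : b < bs + r.
  rewrite lt_neqAle b2 andbT; apply/eqP => e.
  by have := H2 al al1 al2; rewrite -e mxb => h; have := le_lt_trans h t2c'; rewrite ltxx.
have bv0 : 0 < v - b by lra.
pose k := Num.min d (bs + r - b).
have k0 : 0 < k by rewrite lt_min d0 subr_gt0.
have kd : k <= d by rewrite ge_min lexx.
have kb : k <= bs + r - b by rewrite ge_min lexx orbT.
have := Hd 0 k; rewrite normr0 addr0 (gtr0_norm k0) => /(_ (ltW d0) kd).
rewrite ler_norml => /andP[_ h1].
pose s := k / (v - b).
have s0 : 0 < s by rewrite divr_gt0.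
have sE : s * (v - b) = k by rewrite /s divfK// gt_eqF.
have s01 : 0 <= s <= 1 by rewrite (ltW s0)/= ler_pdivrMr// mul1r; lra.
have := phi_convex al b al v s01.
have -> : (1 - s) * al + s * al = al by ring.
have -> : (1 - s) * b + s * v = b + k by rewrite -sE; ring.
rewrite pt => h2.
have : s * phi (al, v) < s * t by rewrite ltr_pM2l//; lra.
move=> h3.
have k1 : bs - r <= b + k by lra.
have k2 : b + k <= bs + r by lra.
have := Hb (b + k) k1 k2; rewrite mxb leNgt => /negP; apply.
by rewrite gt_max; apply/andP; split; lra.
Qed.

End Geometry.

(** * The mirror image of a walk *)

Section Reflection.
Variable R : realType.

Lemma green_bij (T : choiceType) (P P' : T -> T -> \bar R) (e e' : T -> T) t z w :
  cancel e e' -> cancel e' e -> (forall z w, 0 <= P z w)%E ->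
  (forall z w, P z w = P' (e z) (e w)) ->
  green P t z w = green P' t (e z) (e w).
Proof.
move=> ee' e'e P0 eq; apply: congr_lim; apply/funext => n.
by apply: eq_bigr => i _; rewrite (nstep_bij i z w ee' e'e P0 eq).
Qed.

(** Stability only depends on the kernel up to a bijection of the state space. *)
Lemma martin_stable_bij (T : choiceType) (P P' : T -> T -> \bar R) (e : T -> T) z0 :
  cancel e e -> (forall z w, 0 <= P z w)%E ->
  (forall z w, P z w = P' (e z) (e w)) ->
  martin_stable P z0 -> martin_stable P' (e z0).
Proof.
move=> ee P0 eq st u lu.
have gE t z w : green P' t z w = green P t (e z) (e w).
  by rewrite (green_bij t (e z) (e w) ee ee P0 eq) !ee.
have cE z w : convergence_norm P' z w = convergence_norm P (e z) (e w).
  rewrite /convergence_norm; congr inf; apply/seteqP.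
  by split => t /=; rewrite gE.
have mE z1 t z w : martin_kernel P' z1 t z w = martin_kernel P (e z1) t (e z) (e w).
  by rewrite /martin_kernel !gE.
rewrite cE !ee.
have lu' : leaves_finite_sets (e \o u).
  move=> V finV; have [N HN] := lu (e @` V) (finite_image _ finV).
  by exists N => n /HN h Ve; apply: h; exists (e (u n)) => //=; rewrite ee.
move=> [t [ct [_ cvt]]] t' ct'.
have H : cvg_to_martin_boundary P z0 t' (e \o u).
  apply: (st _ lu' _ _ ct'); exists t; split; first exact: ct.
  split; [exact: lu'|move=> z].
  have := cvt (e z); rewrite (_ : (fun n => _) =
    fun n => martin_kernel P z0 t z ((e \o u) n))//.
  by apply/funext => n; rewrite mE !ee.
split; [exact: lu|move=> z]; have := H.2 (e z).
rewrite (_ : (fun n => _) = fun n => martin_kernel P' (e z0) t' z (u n))//.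
by apply/funext => n; rewrite mE !ee.
Qed.

Definition mirror (z : int * nat) : int * nat := (- z.1, z.2).

Lemma mirrorK : cancel mirror mirror.
Proof. by move=> [x y]; rewrite /mirror /= opprK. Qed.

Definition mirrorZ (z : int * int) : int * int := (- z.1, z.2).

Lemma mirrorZK : cancel mirrorZ mirrorZ.
Proof. by move=> [x y]; rewrite /mirrorZ /= opprK. Qed.

Lemma emgf_mirror (mu : int * int -> R) a :
  emgf (mu \o mirrorZ) a = emgf mu (- a.1, a.2).
Proof.
rewrite /emgf -[RHS](@esum_inj_eq _ _ _ mirrorZ).
- apply: eq_esumT => z; rewrite /= intrN; congr ((_ * expR _)%:E); ring.
- exact: can_inj mirrorZK.
- by move=> z _; exists (mirrorZ z); rewrite mirrorZK.
Qed.

Lemma reflected_kernel_mirror (mu mu0 : int * int -> R) z w :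
  reflected_kernel mu mu0 z w =
  reflected_kernel (mu \o mirrorZ) (mu0 \o mirrorZ) (mirror z) (mirror w).
Proof.
rewrite /reflected_kernel /mirror /= /mirrorZ /=.
by have -> : - (- w.1 - - z.1) = w.1 - z.1 by ring.
Qed.

Program Definition mirror_walk (W : halfplane_walk R) : halfplane_walk R :=
  @HalfplaneWalk R (step_mass W \o mirrorZ) (axis_mass W \o mirrorZ) _ _ _ _ _ _ _ _.
Next Obligation. by move=> W z; exact: step_mass_ge0. Qed.
Next Obligation. by move=> W z; exact: axis_mass_ge0. Qed.
Next Obligation. by move=> W x y y0; exact: step_mass_down. Qed.
Next Obligation. by move=> W x y y0; exact: axis_mass_down. Qed.
Next Obligation. by move=> W a; rewrite emgf_mirror; exact: step_mass_fin. Qed.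
Next Obligation. by move=> W a; rewrite emgf_mirror; exact: axis_mass_fin. Qed.
Next Obligation.
move=> W z w; have [n pos] := walk_irr W (mirror z) (mirror w); exists n.
rewrite -(mirrorK z) -(mirrorK w); apply: lt_le_trans pos _.
apply: nstep_inj_le; first exact: can_inj mirrorK.
- by move=> x y; rewrite lee_fin; case: ifP => _; [exact: axis_mass_ge0|exact: step_mass_ge0].
- by move=> x y; rewrite lee_fin; case: ifP => _; [exact: axis_mass_ge0|exact: step_mass_ge0].
- by move=> x y; rewrite -reflected_kernel_mirror.
Qed.
Next Obligation.
move=> W z w; have [n pos] := interior_irr W (mirrorZ z) (mirrorZ w); exists n.
rewrite -(mirrorZK z) -(mirrorZK w); apply: lt_le_trans pos _.
apply: nstep_inj_le; first exact: can_inj mirrorZK.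
- by move=> x y; rewrite lee_fin; exact: step_mass_ge0.
- by move=> x y; rewrite lee_fin; exact: step_mass_ge0.
- move=> x y; rewrite /walk_kernel /= /mirrorZ /= lee_fin.
  by have -> : - (- y.1 - - x.1) = y.1 - x.1 by ring.
Qed.

Lemma mgf_mirror (W : halfplane_walk R) a :
  mgf (step_mass (mirror_walk W)) a = mgf (step_mass W) (- a.1, a.2).
Proof. by rewrite /mgf emgf_mirror. Qed.

Lemma mgf0_mirror (W : halfplane_walk R) a :
  mgf (axis_mass (mirror_walk W)) a = mgf (axis_mass W) (- a.1, a.2).
Proof. by rewrite /mgf emgf_mirror. Qed.

Lemma grad_mirror (W : halfplane_walk R) x y p q :
  grad_at (mgf (step_mass W)) x y p q -> grad_at (mgf (step_mass (mirror_walk W))) (- x) y (- p) q.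
Proof.
move=> [lo [C C0 up]]; split.
  move=> h k; rewrite !mgf_mirror /= opprK.
  have := lo (- h) k; rewrite (_ : - (- x + h) = x - h); last by ring.
  by rewrite mulrN mulNr.
exists C => // h k h1 k1; rewrite !mgf_mirror /= opprK.
have := up (- h) k; rewrite normrN => /(_ h1 k1).
rewrite (_ : - (- x + h) = x - h); last by ring.
by rewrite mulrN mulNr sqrrN.
Qed.

End Reflection.

(** * Instability *)

Section Core.
Variable R : realType.
Variable W : halfplane_walk R.
Local Notation E := (int * nat)%type.
Local Notation mu := (step_mass W).
Local Notation mu0 := (axis_mass W).
Local Notation phi := (mgf mu).
Local Notation phi0 := (mgf mu0).
Variables als bs : R.
Hypothesis astar_min : forall a, Num.max (phi (als, bs)) (phi0 (als, bs)) <=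
  Num.max (phi a) (phi0 a).
Hypothesis astar_unique : forall b,
  (forall a, Num.max (phi b) (phi0 b) <= Num.max (phi a) (phi0 a)) -> b = (als, bs).
Hypothesis dphi_lt0 : derive1 (fun v : R => phi (als, v)) bs < 0.
Local Notation rho := (rho W als bs).
Let phi_cont := convex_continuous (@phi_convex R W) (@phi_semiconcave R W).

Lemma rho_ge0 : 0 <= rho.
Proof. by rewrite /rho le_max (mgf_ge0 (@step_mass_ge0 R W) (@step_mass_fin R W)). Qed.

Lemma rho_phi : phi (als, bs) = rho.
Proof. by have [] := phi_eq_phi0 astar_min dphi_lt0. Qed.

Lemma rho_phi0 : phi0 (als, bs) = rho.
Proof. by have [] := phi_eq_phi0 astar_min dphi_lt0. Qed.

Lemma convergence_norm_le z t : rho < t ->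
  convergence_norm (reflected_kernel mu mu0) z z <= t.
Proof.
move=> rt; have t0 : 0 < t by exact: le_lt_trans rho_ge0 rt.
apply: ge_inf; first by exists 0 => s /= [/ltW].
split => //; rewrite green_gr//.
by apply: (@gr_finite_inner R W t t0 als bs); rewrite ?rho_phi ?rho_phi0.
Qed.

Lemma convergence_norm_lt z t : rho < t ->
  convergence_norm (reflected_kernel mu mu0) z z < t.
Proof.
move=> rt; apply: (@le_lt_trans _ _ ((rho + t) / 2)); last by lra.
by apply: convergence_norm_le; lra.
Qed.

(** When the level decreases to [rho] the corner tends to the minimizer and the
upper point [(al, b1)] to [(als, bU)].  The descent in the direction
[(1, - m')], strict at [(als, bU)], persists by continuity. *)
Lemma corner_data bU pU qU m' : bs < bU -> phi (als, bU) = rho ->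
  (forall b, bs < b -> b < bU -> phi (als, b) < rho) ->
  grad_at phi als bU pU qU -> 0 < qU -> pU < m' * qU ->
  exists t al b b2 b1 mm d, [/\ rho < t, lens_corner W t al b als bs b2,
    phi (al, b1) = t, b < b1 &
    [/\ 0 < d, phi (al + d, b1 - d * m') < t & phi (al - d, b1 + d * mm) < t]].
Proof.
move=> bsU pbU below gU qU0 slope.
pose m0 := (pU - 1) / qU.
have m0q : m0 * qU < pU by rewrite /m0 divfK ?gt_eqF// gtrBl ltr01.
have [dU dU0 HU] := grad_descent gU qU0 m0q slope.
have [pdU _] := HU dU dU0 (lexx _); rewrite pbU in pdU.
have gap0 : 0 < (rho - phi (als + dU, bU - dU * m')) / 2 by rewrite divr_gt0// subr_gt0.
have [e1 e10 He1] := phi_cont (als + dU) (bU - dU * m') gap0.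
pose e2 := Num.min e1 ((bU - bs) / 4).
have e20 : 0 < e2 by rewrite lt_min e10 divr_gt0// subr_gt0.
have e21 : e2 <= e1 by rewrite ge_min lexx.
have e2b : e2 <= (bU - bs) / 4 by rewrite ge_min lexx orbT.
pose v1 := bU - e2; pose v2 := bU + e2.
have pv1 : phi (als, v1) < rho.
  by apply: below; rewrite /v1; move: e20 e2b bsU; clear -R W als bs astar_min astar_unique dphi_lt0 phi_cont; lra.
have pv2 : rho + qU * e2 <= phi (als, v2).
  by have := gU.1 0 e2; rewrite addr0 mulr0 addr0 pbU.
pose kap := qU * e2 / 2.
have kap0 : 0 < kap by rewrite divr_gt0// mulr_gt0.
have g1 : 0 < (rho - phi (als, v1)) / 2 by rewrite divr_gt0// subr_gt0.
have [f1 f10 Hf1] := phi_cont als v1 g1.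
have [f2 f20 Hf2] := phi_cont als v2 kap0.
pose r := Num.min (Num.min f1 f2) (Num.min e1 ((bU - bs) / 4)).
have r0 : 0 < r by rewrite !lt_min f10 f20 e10 divr_gt0// subr_gt0.
have rf1 : r <= f1 by rewrite !ge_min lexx.
have rf2 : r <= f2 by rewrite !ge_min lexx ?orbT.
have re1 : r <= e1 by rewrite !ge_min lexx ?orbT.
have rb : r <= (bU - bs) / 4 by rewrite !ge_min lexx ?orbT.
have z0 : `|(0 : R)| <= r by rewrite normr0 ltW.
have bv : bs + r < v1 by rewrite /v1; move: rb e2b bsU; clear -R W als bs astar_min astar_unique dphi_lt0 phi_cont; lra.
have low h : `|h| <= r -> phi (als + h, v1) < rho.
  move=> hr; have := Hf1 h 0 (le_trans hr rf1) (le_trans z0 rf1).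
  by rewrite addr0 ler_norml => /andP[_]; move: pv1; clear -R W als bs astar_min astar_unique dphi_lt0 phi_cont; lra.
have high h : `|h| <= r -> rho + kap <= phi (als + h, v2).
  move=> hr; have := Hf2 h 0 (le_trans hr rf2) (le_trans z0 rf2).
  by rewrite addr0 ler_norml => /andP[+ _]; move: pv2; rewrite /kap; clear -R W als bs astar_min astar_unique dphi_lt0 phi_cont; lra.
have [t [al [b [rt tk alsal alr [b1' b2' pt p0t]]]]] :=
  corner_exists astar_min astar_unique r0 bv kap0 low.
have hal : `|al - als| <= r by rewrite ger0_norm; move: alsal alr; clear -R W als bs astar_min astar_unique dphi_lt0 phi_cont; lra.
have alE : als + (al - als) = al by rewrite addrC subrK.
have plow := low _ hal; have phigh := high _ hal; rewrite alE in plow phigh.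
have v12 : v1 <= v2 by rewrite /v1 /v2; move: e20; clear -R W als bs astar_min astar_unique dphi_lt0 phi_cont; lra.
have [b1 /andP[b11 b12] pb1] := phi_ivt v12 (ltW (lt_trans plow rt)) (le_trans tk phigh).
have bb1 : b < b1 by exact: le_lt_trans b2' (lt_le_trans bv b11).
have v1b1 : v1 < b1.
  rewrite lt_neqAle b11 andbT; apply/eqP => e; move: plow; rewrite e pb1 => h.
  by have := lt_trans h rt; rewrite ltxx.
have [p1 [q1 g1']] := grad_exists (@phi_convex R W) (@phi_semiconcave R W) al b1.
have q10 : 0 < q1 by apply: (grad_pos g1' v1b1); rewrite pb1; exact: lt_trans plow rt.
pose mm := (p1 - 1) / q1; pose mp := (p1 + 1) / q1.
have mmq : mm * q1 < p1 by rewrite /mm divfK ?gt_eqF// gtrBl ltr01.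
have mpq : p1 < mp * q1 by rewrite /mp divfK ?gt_eqF// ltrDl ltr01.
have [d1 d10 Hd1] := grad_descent g1' q10 mmq mpq.
pose d := Num.min d1 dU.
have d0 : 0 < d by rewrite lt_min d10.
have dd1 : d <= d1 by rewrite ge_min lexx.
have ddU : d <= dU by rewrite ge_min lexx orbT.
exists t, al, b, v1, b1, mm, d; split => //; last split => //.
- split => //; rewrite ?rho_phi ?rho_phi0//.
    exact: le_lt_trans b2' bv.
  exact: lt_trans plow rt.
- (* The descent at (als, bU) survives at (al, b1) with the full length dU, and
     convexity brings it down to the length d. *)
  have far : phi (al + dU, b1 - dU * m') < t.
    apply: lt_trans rt.
    have h1 : `|al - als| <= e1 := le_trans hal re1.
    have h2 : `|b1 - bU| <= e1.
      by apply: le_trans e21; rewrite ler_norml; move: b11 b12; rewrite /v1 /v2; clear -R W als bs astar_min astar_unique dphi_lt0 phi_cont; lra.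
    have := He1 _ _ h1 h2.
    have -> : als + dU + (al - als) = al + dU by ring.
    have -> : bU - dU * m' + (b1 - bU) = b1 - dU * m' by ring.
    by rewrite ler_norml => /andP[_]; move: pdU; clear -R W als bs astar_min astar_unique dphi_lt0 phi_cont; lra.
  pose s := d / dU.
  have s0 : 0 < s by rewrite divr_gt0.
  have s01 : 0 <= s <= 1 by rewrite (ltW s0) /= ler_pdivrMr// mul1r.
  have sE : s * dU = d by rewrite /s divfK// gt_eqF.
  have := @phi_convex R W al b1 (al + dU) (b1 - dU * m') s s01.
  have -> : (1 - s) * al + s * (al + dU) = al + d by rewrite -sE; ring.
  have -> : (1 - s) * b1 + s * (b1 - dU * m') = b1 - d * m' by rewrite -sE; ring.
  rewrite pb1 => /le_lt_trans; apply.
  have : s * phi (al + dU, b1 - dU * m') < s * t by rewrite ltr_pM2l.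
  by clear -R W als bs astar_min astar_unique dphi_lt0 phi_cont; lra.
- by have [_] := Hd1 d d0 dd1; rewrite pb1.
Qed.

Lemma odd_even_eventually (P : nat -> Prop) (N N' : nat) :
  (forall k, (N <= k)%N -> P k.*2) -> (forall k, (N' <= k)%N -> P k.*2.+1) ->
  forall n, ((N + N').*2 <= n)%N -> P n.
Proof.
move=> H H' n; rewrite -(odd_double_half n); case: (odd n) => /= h.
  by apply: H'; lia.
by apply: H; lia.
Qed.

Lemma finite_set_bounded (V : set E) : finite_set V ->
  exists N, forall z, V z -> (`|z.1| <= N)%N /\ (z.2 <= N)%N.
Proof.
move=> /(finite_seqP V).1 [X ->]; elim: X => [|x X [N HN]].
  by exists 0%N => z.
exists (N + `|x.1| + x.2)%N => z /=; rewrite inE => /orP[/eqP->|/HN[h1 h2]].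
  by split; lia.
by split; lia.
Qed.

Variable z0 : E.

(** The slopes satisfy [pU / qU < m' < m1 < mm < p / q].  At level [t1] all points
of slope at least [m1] share the limit of the axis, whereas at level [t2] such
points can be chosen with one-jump ratio at most [exp (al0 + del)], below the
value that the axis imposes. *)
Lemma unstable_right bU pU qU t2 al0 b0 p q al2 :
  bs < bU -> phi (als, bU) = rho ->
  (forall b, bs < b -> b < bU -> phi (als, b) < rho) ->
  grad_at phi als bU pU qU -> 0 < qU ->
  rho < t2 -> phi (al0, bs) < t2 -> phi0 (al0, bs) < t2 ->
  al0 < al2 -> phi (al2, bs) < t2 -> phi0 (al2, bs) < t2 ->
  phi (al0, b0) = t2 -> bs < b0 -> grad_at phi al0 b0 p q -> 0 < q ->
  pU / qU < p / q ->
  ~ martin_stable (reflected_kernel mu mu0) z0.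
Proof.
move=> bsU pbU below gU qU0 rt2 p_l p0_l al02 p_2 p0_2 pb0 bsb0 g0 q0 slopes st.
pose D := (p / q - pU / qU) / 4.
have D0 : 0 < D by rewrite divr_gt0// subr_gt0.
pose m' := pU / qU + D; pose m1 := pU / qU + 2 * D; pose mm := pU / qU + 3 * D.
pose mp := p / q + 1.
have m'q : pU < m' * qU by rewrite -ltr_pdivrMr// /m' ltrDl.
have mmq : mm * q < p by rewrite -ltr_pdivlMr// /mm /D; move: slopes; clear -R W als bs astar_min astar_unique dphi_lt0 phi_cont z0; lra.
have mpq : p < mp * q by rewrite -ltr_pdivrMr// /mp ltrDl ltr01.
have m'm1 : m' < m1 by rewrite /m' /m1; move: D0; clear -R W als bs astar_min astar_unique dphi_lt0 phi_cont z0; lra.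
have m1mm : m1 < mm by rewrite /m1 /mm; move: D0; clear -R W als bs astar_min astar_unique dphi_lt0 phi_cont z0; lra.
have [d2 d20 Hd2] := grad_descent g0 q0 mmq mpq.
have [pr2 pl2] := Hd2 d2 d20 (lexx _); rewrite pb0 in pr2 pl2.
have t20 : 0 < t2 by exact: le_lt_trans rho_ge0 rt2.
have [t1 [al [b [b2 [b1 [mm1 [d [rt1 LC pb1 bb1 [d0 pr1 pl1]]]]]]]]] :=
  corner_data bsU pbU below gU qU0 m'q.
have t10 : 0 < t1 by exact: le_lt_trans rho_ge0 rt1.
pose del := (al2 - al0) / 4.
have del0 : 0 < del by rewrite divr_gt0// subr_gt0.
have ex_w k : exists w : E, [/\ (k <= w.2)%N, m1 * w.2%:R <= w.1%:~R &
    fgreen W t2 (hshift 1 z0) w <= expR (al0 + del) * fgreen W t2 z0 w].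
  have [x [y [h1 h2 h3]]] :=
    cone_ratio_le t20 z0 p_l p0_l pb0 bsb0 d20 pr2 pl2 m1mm k del0.
  by exists (x, y).
have [w Hw] := choice ex_w.
pose u n : E := if odd n then w n./2 else (n./2%:Z, 0%N).
have u_even k : u k.*2 = (k%:Z, 0%N) by rewrite /u odd_double doubleK.
have u_odd k : u k.*2.+1 = w k.
  by rewrite /u /= odd_double /= uphalf_double.
have Goo1 := corner_gr_finite t10 LC.
have Goo2 := gr_finite_inner t20 p_l p0_l.
have lu : leaves_finite_sets u.
  move=> V /finite_set_bounded[N HN]; exists (N.+1 + N.+1).*2 => n /ltnW; move: n.
  apply: odd_even_eventually => k Nk; rewrite ?u_even ?u_odd => /HN[].
    by move: Nk; clear -R W als bs astar_min astar_unique dphi_lt0 phi_cont z0; rewrite /=; lia.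
  by have [h _ _] := Hw k; move=> _ h2; have := leq_trans (leq_trans Nk h) h2; rewrite ltnn.
have kernelE t (t0 : 0 < t) z n :
    martin_kernel (reflected_kernel mu mu0) z0 t z (u n) = fgreen W t z (u n) / fgreen W t z0 (u n).
  by rewrite /martin_kernel !green_gr.
have upper z z' e : 0 < e -> exists N, forall n, (N <= n)%N ->
    fgreen W t1 z (u n) <= (pexp (al, b) z / pexp (al, b) z' + e) * fgreen W t1 z' (u n).
  move=> e0; have [N HN] := axis_limit t10 LC z z' e0.
  have [Y HY] := cone_limit t10 LC pb1 bb1 d0 pr1 pl1 m'm1 z z' e0.
  exists (N + Y).*2; apply: odd_even_eventually => k Nk; rewrite ?u_even ?u_odd.
    exact: HN.
  have [h1 h2 _] := Hw k; rewrite [w k]surjective_pairing; apply: HY => //.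
  exact: leq_trans Nk h1.
have cvg1 : cvg_to_martin_boundary (reflected_kernel mu mu0) z0 t1 u.
  split => // z; pose L := pexp (al, b) z / pexp (al, b) z0.
  have L0 : 0 < L by rewrite divr_gt0// pexp_gt0.
  apply/cvg_ex; exists L; apply/cvgrPdist_le => e e0.
  have [N HN] := upper z z0 e e0.
  have e'0 : 0 < e / L ^+ 2 by rewrite divr_gt0// exprn_gt0.
  have [N' HN'] := upper z0 z _ e'0.
  exists (N + N')%N => // n nN.
  have h1 := HN n (leq_trans (leq_addr _ _) nN).
  have h2 := HN' n (leq_trans (leq_addl _ _) nN).
  rewrite (kernelE _ t10); set gz := fgreen W t1 z (u n) in h1 h2 *.
  set gz0 := fgreen W t1 z0 (u n) in h1 h2 *.
  have gz00 : 0 < gz0 by exact: fgreen_gt0.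
  have LV : pexp (al, b) z0 / pexp (al, b) z = L^-1 by rewrite /L invf_div.
  rewrite LV in h2; rewrite -/L in h1.
  rewrite distrC ler_norml; apply/andP; split; last first.
    by rewrite lerBlDl ler_pdivrMr.
  rewrite lerBrDl addrC -[leRHS]opprK.
  have : (L - e) * gz0 <= gz.
    have [Le|Le] := leP 0 (L - e); last first.
      apply: (@le_trans _ _ 0); last exact/ltW/fgreen_gt0.
      by rewrite nmulr_rle0// ltW.
    apply: (@le_trans _ _ ((L - e) * ((L^-1 + e / L ^+ 2) * gz))).
      by rewrite ler_wpM2l.
    have gzp : 0 < gz by exact: fgreen_gt0.
    rewrite mulrA ger_pMl//.
    have -> : (L - e) * (L^-1 + e / L ^+ 2) = 1 - e ^+ 2 / L ^+ 2.
      by field; rewrite gt_eqF.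
    by rewrite gerBl divr_ge0 ?sqr_ge0.
  by rewrite -ler_pdivlMr// opprK; clear -R W als bs astar_min astar_unique dphi_lt0 phi_cont z0; lra.
have [_ cvg2] : cvg_to_martin_boundary (reflected_kernel mu mu0) z0 t2 u.
  apply: st lu _ _ (convergence_norm_lt z0 rt2).
  by exists t1; split => //; exact: convergence_norm_lt.
have /cvg_ex[l /cvgrPdist_le Hl] := cvg2 (hshift 1 z0).
have del20 : 0 < expR (al0 + 2 * del) - expR (al0 + del).
  by rewrite subr_gt0 ltr_expR; move: del0; clear -R W als bs astar_min astar_unique dphi_lt0 phi_cont z0; lra.
pose e := (expR (al0 + 2 * del) - expR (al0 + del)) / 2.
have e0 : 0 < e by rewrite divr_gt0.
have [N _ HN] := Hl e e0.
have lle : l <= expR (al0 + del) + e.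
  have := HN N.*2.+1 => /=; rewrite (kernelE _ t20) u_odd.
  have -> : (N <= N.*2.+1)%N by clear -R W als bs astar_min astar_unique dphi_lt0 phi_cont z0; lia.
  move=> /(_ isT); rewrite ler_norml => /andP[_ h].
  have [_ _ h2] := Hw N.
  have : fgreen W t2 (hshift 1 z0) (w N) / fgreen W t2 z0 (w N) <= expR (al0 + del).
    by rewrite ler_pdivrMr// fgreen_gt0.
  by move: h; clear -R W als bs astar_min astar_unique dphi_lt0 phi_cont z0; lra.
have r1 : expR (al0 + 2 * del) < expR al2 by rewrite ltr_expR /del; move: al02; clear -R W als bs astar_min astar_unique dphi_lt0 phi_cont z0; lra.
apply: (@axis_ratio_ge R W t2 t20 z0 _ _ _ p_2 p0_2 (expR_gt0 _) r1).
exists N => n Nn; have := HN n.*2 => /=; rewrite (kernelE _ t20) u_even.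
have -> : (N <= n.*2)%N by move: Nn; clear -R W als bs astar_min astar_unique dphi_lt0 phi_cont z0; lia.
move=> /(_ isT); rewrite distrC ler_norml => /andP[_ h].
have gp : 0 < fgreen W t2 z0 (n%:Z, 0%N) by exact: fgreen_gt0.
rewrite -ler_pdivrMr//.
by move: lle h; rewrite /e; clear -R W als bs astar_min astar_unique dphi_lt0 phi_cont z0; lra.
Qed.

End Core.

Section TwoSided.
Variable R : realType.
Variable W : halfplane_walk R.
Local Notation E := (int * nat)%type.
Local Notation phi := (mgf (step_mass W)).
Local Notation phi0 := (mgf (axis_mass W)).
Variables als bs : R.
Hypothesis astar_min : forall a, Num.max (phi (als, bs)) (phi0 (als, bs)) <=
  Num.max (phi a) (phi0 a).
Hypothesis astar_unique : forall b,
  (forall a, Num.max (phi b) (phi0 b) <= Num.max (phi a) (phi0 a)) -> b = (als, bs).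
Hypothesis dphi_lt0 : derive1 (fun v : R => phi (als, v)) bs < 0.
Local Notation rho := (rho W als bs).

Lemma upper_point t al : phi (al, bs) < t -> exists b p q,
  [/\ phi (al, b) = t, bs < b, grad_at phi al b p q & 0 < q].
Proof.
move=> lt; have [y bsy py] := phi_large W al t bs.
have [b /andP[b1 b2] pb] := phi_ivt bsy (ltW lt) (ltW py).
have bsb : bs < b.
  by rewrite lt_neqAle b1 andbT; apply/eqP => e; move: lt; rewrite e pb ltxx.
have [p [q gr]] := grad_exists (@phi_convex R W) (@phi_semiconcave R W) al b.
exists b, p, q; split => //; apply: (grad_pos gr bsb); by rewrite pb.
Qed.

(** Strict convexity along the chord joining the two points of the level curve. *)
Lemma slopes_increase t x x' y y' p q p' q' : x < x' ->
  phi (x, y) = t -> phi (x', y') = t ->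
  grad_at phi x y p q -> grad_at phi x' y' p' q' -> 0 < q -> 0 < q' ->
  p / q < p' / q'.
Proof.
move=> xx' pt pt' [lo _] [lo' _] q0 q'0.
pose h := (x' - x) / 2; pose k := (y' - y) / 2.
have h0 : 0 < h by rewrite divr_gt0// subr_gt0.
have hk : (h != 0) || (k != 0) by rewrite gt_eqF.
have := phi_midpoint W (x + h) (y + k) hk.
have -> : x + h + h = x' by rewrite /h; field.
have -> : y + k + k = y' by rewrite /k; field.
rewrite !addrK pt pt' => mid.
have := lo h k; have := lo' (- h) (- k); rewrite pt pt'.
have -> : x' - h = x + h by rewrite /h; field.
have -> : y' - k = y + k by rewrite /k; field.
move=> l1 l2.
have a1 : p * h + q * k < 0 by lra.
have a2 : 0 < p' * h + q' * k by lra.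
apply: (@lt_trans _ _ (- k / h)).
  rewrite ltr_pdivrMr// mulrAC ltr_pdivlMr//; lra.
rewrite ltr_pdivlMr// mulrAC ltr_pdivrMr//; lra.
Qed.

End TwoSided.

(** Two upper points at level [t2], one on each side of the minimizer, have
different slopes, so one of them differs from the slope at [(als, bU)]: if the
right one is not larger, then the left one is smaller, and in the mirror image
it becomes larger. *)
Theorem reflected_walk_unstable (R : realType) (W : halfplane_walk R) (als bs : R) (z0 : int * nat) :
  (forall a, Num.max (mgf (step_mass W) (als, bs)) (mgf (axis_mass W) (als, bs)) <=
     Num.max (mgf (step_mass W) a) (mgf (axis_mass W) a)) ->
  (forall b, (forall a, Num.max (mgf (step_mass W) b) (mgf (axis_mass W) b) <=
     Num.max (mgf (step_mass W) a) (mgf (axis_mass W) a)) -> b = (als, bs)) ->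
  derive1 (fun v : R => mgf (step_mass W) (als, v)) bs < 0 ->
  ~ martin_stable (reflected_kernel (step_mass W) (axis_mass W)) z0.
Proof.
move=> amin auni dlt st.
have [bU bsU [pbU below]] := upper_root amin dlt.
have pals := rho_phi amin dlt; have p0als := rho_phi0 amin dlt.
set rh := rho W als bs in pbU below pals p0als.
have [pU [qU gU]] := grad_exists (@phi_convex R W) (@phi_semiconcave R W) als bU.
have qU0 : 0 < qU.
  have h1 : bs < (bs + bU) / 2 by lra.
  have h2 : (bs + bU) / 2 < bU by lra.
  by apply: (grad_pos gU h2); rewrite pbU; apply: below.
pose t2 := rh + 1.
have rt2 : rh < t2 by rewrite ltrDl ltr01.
have half0 : 0 < 1 / 2 :> R by lra.
have [d d0 Hd] := convex_continuous (@phi_convex R W) (@phi_semiconcave R W) als bs half0.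
have [d' d'0 Hd'] := convex_continuous (@phi0_convex R W) (@phi0_semiconcave R W) als bs half0.
pose s := Num.min d d' / 2.
have m0 : 0 < Num.min d d' by rewrite lt_min d0.
have s0 : 0 < s by rewrite divr_gt0.
have s2d : 2 * s <= d by rewrite /s mulrCA divff ?mulr1 ?ge_min ?lexx// pnatr_eq0.
have s2d' : 2 * s <= d' by rewrite /s mulrCA divff ?mulr1 ?ge_min ?lexx ?orbT// pnatr_eq0.
have inner h : `|h| <= 2 * s ->
    mgf (step_mass W) (als + h, bs) < t2 /\ mgf (axis_mass W) (als + h, bs) < t2.
  move=> hs.
  have z0d : `|(0 : R)| <= d by rewrite normr0 ltW.
  have z0d' : `|(0 : R)| <= d' by rewrite normr0 ltW.
  have := Hd h 0 (le_trans hs s2d) z0d; have := Hd' h 0 (le_trans hs s2d') z0d'.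
  rewrite addr0 pals p0als !ler_norml => /andP[_ h1] /andP[_ h2].
  by split; rewrite /t2; lra.
have n1 : `|s| <= 2 * s by rewrite gtr0_norm//; lra.
have n2 : `|2 * s| <= 2 * s by rewrite gtr0_norm// mulr_gt0.
have n1' : `|- s| <= 2 * s by rewrite normrN.
have n2' : `|- (2 * s)| <= 2 * s by rewrite normrN.
have [ir i0r] := inner _ n1; have [ir2 i0r2] := inner _ n2.
have [il i0l] := inner _ n1'; have [il2 i0l2] := inner _ n2'.
have [br [pr [qr [tr bsr gr qr0]]]] := upper_point ir.
have [bl [pl [ql [tl bsl gl ql0]]]] := upper_point il.
have lr : als + - s < als + s.
  by rewrite ltrD2l; apply: (lt_trans _ s0); rewrite oppr_lt0.
have s2s : s < 2 * s by rewrite ltr_pMl// ltr1n.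
have sl := slopes_increase lr tl tr gl gr ql0 qr0.
have [right|left] := ltP (pU / qU) (pr / qr).
  apply: (unstable_right amin auni dlt bsU pbU below gU qU0 rt2 ir i0r _ ir2 i0r2
    tr bsr gr qr0 right st).
  by rewrite ltrD2l.
pose W' := mirror_walk W.
have mE a : mgf (step_mass W') a = mgf (step_mass W) (- a.1, a.2) := mgf_mirror W a.
have mE0 a : mgf (axis_mass W') a = mgf (axis_mass W) (- a.1, a.2) := mgf0_mirror W a.
have rE : rho W' (- als) bs = rh by rewrite /rho /rh /rho mE mE0 /= opprK.
have amin' a : Num.max (mgf (step_mass W') (- als, bs)) (mgf (axis_mass W') (- als, bs)) <=
    Num.max (mgf (step_mass W') a) (mgf (axis_mass W') a).
  by rewrite !mE !mE0 /= opprK.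
have auni' b : (forall a, Num.max (mgf (step_mass W') b) (mgf (axis_mass W') b) <=
    Num.max (mgf (step_mass W') a) (mgf (axis_mass W') a)) -> b = (- als, bs).
  move=> H; have [e1 e2] : (- b.1, b.2) = (als, bs).
    apply: auni => a; have := H (- a.1, a.2).
    by rewrite !mE !mE0 /= opprK -surjective_pairing.
  by rewrite [b]surjective_pairing -e1 e2 opprK.
have dlt' : derive1 (fun v : R => mgf (step_mass W') (- als, v)) bs < 0.
  rewrite (_ : (fun v => _) = fun v : R => mgf (step_mass W) (als, v))//.
  by apply/funext => v; rewrite mE /= opprK.
have st' : martin_stable (reflected_kernel (step_mass W') (axis_mass W')) (mirror z0).
  apply: (martin_stable_bij (@mirrorK) _ _ st).
    by move=> z w; rewrite lee_fin; case: ifP => _; [exact: axis_mass_ge0|exact: step_mass_ge0].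
  by move=> z w; exact: reflected_kernel_mirror.
have g0' := grad_mirror gl.
have lslope : - pU / qU < - pl / ql.
  by rewrite !mulNr ltrN2; exact: lt_le_trans sl left.
refine (unstable_right (t2 := t2) (al2 := - (als + - (2 * s))) amin' auni' dlt' bsU _ _ (grad_mirror gU) qU0 _ _ _ _ _ _ _ bsl g0' ql0 lslope st').
- by rewrite mE /= opprK pbU rE.
- by move=> b h1 h2; rewrite mE /= opprK rE; exact: below.
- by rewrite rE.
- by rewrite mE /= opprK.
- by rewrite mE0 /= opprK.
- by rewrite ltrN2 ltrD2l ltrN2.
- by rewrite mE /= opprK.
- by rewrite mE0 /= opprK.
- by rewrite mE /= opprK.
Qed.

Theorem proposition3p1 (R : realType) (mu mu0 : int * int -> R)
    (z0 : int * nat) (astar : R * R)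
  (mu_ge0 : forall z, 0 <= mu z)
  (mu0_ge0 : forall z, 0 <= mu0 z)
  (mu_mass : (0 < total_mass mu <= 1)%E)
  (mu0_mass : (0 < total_mass mu0 <= 1)%E)
  (mu_neq_mu0 : mu <> mu0)
  (A0 : forall x y : int, y < -1 -> mu (x, y) = 0)
  (A0' : forall x y : int, y < 0 -> mu0 (x, y) = 0)
  (A1 : irreducible_kernel (reflected_kernel mu mu0))
  (A2 : irreducible_kernel (walk_kernel mu))
  (A3 : forall a : R * R, (emgf mu a < +oo)%E)
  (A3' : forall a : R * R, (emgf mu0 a < +oo)%E)
  (A4 : aperiodic_kernel (last_coordinate_kernel mu))
  (astar_min : forall a : R * R,
     Num.max (mgf mu astar) (mgf mu0 astar) <= Num.max (mgf mu a) (mgf mu0 a))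
  (astar_unique : forall b : R * R,
     (forall a : R * R,
        Num.max (mgf mu b) (mgf mu0 b) <= Num.max (mgf mu a) (mgf mu0 a)) ->
     b = astar)
  (inf_gt : inf (range (mgf mu)) <
            inf (range (fun a : R * R => Num.max (mgf mu a) (mgf mu0 a))))
  (dphi_lt0 : derive1 (fun beta : R => mgf mu (astar.1, beta)) astar.2 < 0) :
  ~ martin_stable (reflected_kernel mu mu0) z0.
Proof.
pose W := @HalfplaneWalk R mu mu0 mu_ge0 mu0_ge0 A0 A0' A3 A3' A1 A2.
move: astar_min astar_unique dphi_lt0; rewrite [astar]surjective_pairing => amin auni dlt.
exact: (@reflected_walk_unstable R W astar.1 astar.2 z0 amin auni dlt).
Qed.
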